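(* For any finite root system $\Phi$ of Dynkin type, any Coxeter element $c$ of its Weyl group, any symmetrizer $D_\Phi$ of the Cartan matrix $C_\Phi$ and any field $K$, the torsion lattice $\mathsf{tors}\,H$ of the GLS path algebra $H=H(C_\Phi,D_\Phi,c)$ over $K$ is isomorphic to the $c$-Cambrian lattice $\mathfrak{C}_c$.
   Context: $\Phi$ has rank $n$, simple roots $\alpha_1,\dots,\alpha_n$, positive roots $\Phi^+$, simple reflections $s_1,\dots,s_n$, Weyl group $W(\Phi)$ and Cartan matrix $C_\Phi=(C_{ij})$, with $s_i(\alpha_j)=\alpha_j-C_{ij}\alpha_i$. A Coxeter element is a product $c=c_1\cdots c_n$ of all simple reflections, each once, in some order; $c=\cdots s_i\cdots s_j\cdots$ means $s_i$ occurs before $s_j$. GLS path algebra. $D_\Phi=\mathrm{diag}(d_1,\dots,d_n)$, $d_i$ positive integers, with $D_\Phi C_\Phi$ symmetric. $Q^c$ is the quiver with vertices $1,\dots,n$, arrows $\alpha_{ij}\colon i\to j$ whenever $c=\cdots s_i\cdots s_j\cdots$ and $s_is_j\neq s_js_i$, and loops $\varepsilon_i\colon i\to i$. $H=KQ^c/I$, with $I$ generated by $\varepsilon_i^{d_i}$ (all $i$) and $\varepsilon_i^{|C_{ji}|}\alpha_{ij}-\alpha_{ij}\varepsilon_j^{|C_{ij}|}$ (all arrows $\alpha_{ij}$); paths are composed from left to right. $\mathsf{tors}\,H$ is the set of torsion classes of the category of finitely generated right $H$-modules, ordered by inclusion. Cambrian lattice. Let $c^\infty=c_1\cdots c_nc_1\cdots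 c_n\cdots$. The $c$-sorting word of $w\in W(\Phi)$ is the reduced word of $w$ whose leftmost embedding as a subword of $c^\infty$ is lexicographically first. Cutting $c^\infty$ into consecutive blocks $c_1\cdots c_n|c_1\cdots c_n|\cdots$, the $c$-sorting word gives the sequence of subsets of $\{s_1,\dots,s_n\}$ of letters used in each block; $w$ is $c$-sortable if this sequence is weakly decreasing under inclusion. $\mathrm{I}(w)=\{\alpha\in\Phi^+\mid w^{-1}(\alpha)\text{ is a negative root}\}$. $\mathfrak{C}_c$ is the set of $c$-sortable elements ordered by inclusion of inversion sets. *)

(* Defs.v *)
From HB Require Import structures.
From mathcomp Require Import all_boot all_order all_algebra.
From mathcomp Require Import boolp reals.
From mathcomp Require Import finmap monalg.

Set Implicit Arguments.
Unset Strict Implicit.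
Unset Printing Implicit Defensive.

Import Order.TTheory GRing.Theory Num.Theory.

Local Open Scope ring_scope.

Definition reflection (R : realType) (V : vectType R)
    (inner : {dot V for idfun}) (a : V) : 'End(V) :=
  linfun (fun v => v - (2 * inner a v / inner a a) *: a).

(* A reduced crystallographic root system in the Euclidean space [V], together
   with a numbered base; irreducibility is not required. *)
Record root_system (R : realType) (V : vectType R) (n : nat) := RootSystem {
  inner : {dot V for idfun};
  root_seq : seq V;
  simple_roots : n.-tuple V;
  root_neq0 : 0 \notin root_seq;
  root_span : <<root_seq>>%VS = fullv;
  root_refl : forall a b, a \in root_seq -> b \in root_seq ->
    reflection inner a b \in root_seq;
  root_int : forall a b, a \in root_seq -> b \in root_seq ->
    2 * inner a b / inner a a \is a Num.int;
  root_reduced : forall (a : V) (t : R), a \in root_seq -> t *: a \in root_seq ->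
    t = 1 \/ t = -1;
  simple_root : {subset simple_roots <= root_seq};
  simple_basis : basis_of fullv simple_roots;
  simple_sign : forall a, a \in root_seq -> exists m : 'I_n -> nat,
    a = \sum_i (m i)%:R *: tnth simple_roots i \/
    a = - \sum_i (m i)%:R *: tnth simple_roots i
}.

Section RootSystem.
Variables (R : realType) (V : vectType R) (n : nat) (Phi : root_system V n).

(* The argument of [Num.floor] is an integer by [root_int], so nothing is
   rounded: s_i (alpha_j) = alpha_j - C_ij alpha_i. *)
Definition cartan : 'M[int]_n :=
  \matrix_(i, j) Num.floor
    (2 * inner Phi (tnth (simple_roots Phi) i) (tnth (simple_roots Phi) j)
       / inner Phi (tnth (simple_roots Phi) i) (tnth (simple_roots Phi) i)).

Definition symmetrizer (d : 'I_n -> nat) : Prop :=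
  (forall i, 0 < d i)%N /\
  let DC := diag_mx (\row_i (d i)%:Z) *m cartan in DC^T = DC.

Definition positive_root (a : V) : Prop :=
  a \in root_seq Phi /\
  exists m : 'I_n -> nat, a = \sum_i (m i)%:R *: tnth (simple_roots Phi) i.

Definition weyl_group (w : 'End(V)) : Prop :=
  exists2 s : seq V, {subset s <= root_seq Phi} &
    w = foldr (fun a f => (reflection (inner Phi) a \o f)%VF) \1%VF s.

Definition simple_reflection (i : 'I_n) : 'End(V) :=
  reflection (inner Phi) (tnth (simple_roots Phi) i).

Definition word_product (u : seq 'I_n) : 'End(V) :=
  foldr (fun i f => (simple_reflection i \o f)%VF) \1%VF u.

Definition reduced_word (w : 'End(V)) (u : seq 'I_n) : Prop :=
  word_product u = w /\
  forall u', word_product u' = w -> (size u <= size u')%N.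

Definition inversion (w : 'End(V)) (a : V) : Prop :=
  positive_root a /\ positive_root (- (w^-1)%VF a).

(* A Coxeter element c = c_1 ... c_n is given by the word c_1, ..., c_n. *)
Definition coxeter_word (c : seq 'I_n) : bool := perm_eq c (enum 'I_n).

(* The letter in position [k] (counted from 0) of the infinite word
   c_1 ... c_n c_1 ... c_n ...; it is [None] only when [c] is empty. *)
Definition cinf (c : seq 'I_n) (k : nat) : option 'I_n := onth c (k %% size c).

Definition embedding (c u : seq 'I_n) (p : seq nat) : Prop :=
  sorted ltn p /\ [seq cinf c k | k <- p] = [seq Some i | i <- u].

Definition leftmost_embedding (c u : seq 'I_n) (p : seq nat) : Prop :=
  embedding c u p /\ forall q, embedding c u q -> all2 leq p q.

Definition sorting_word (c : seq 'I_n) (w : 'End(V)) (u : seq 'I_n)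
    (p : seqlexi nat) : Prop :=
  [/\ reduced_word w u, leftmost_embedding c u p &
      forall (u' : seq 'I_n) (p' : seqlexi nat),
        reduced_word w u' -> leftmost_embedding c u' p' -> (p <= p')%O].

Definition block (c : seq 'I_n) (p : seq nat) (k : nat) : {set 'I_n} :=
  [set i | has (fun q => (q %/ size c == k)%N && (cinf c q == Some i)) p].

Definition sortable (c : seq 'I_n) (w : 'End(V)) : Prop :=
  weyl_group w /\
  exists u p, sorting_word c w u p /\
    forall k, block c p k.+1 \subset block c p k.

Definition cambrian (c : seq 'I_n) := {w : 'End(V) | sortable c w}.

Definition cambrian_le (c : seq 'I_n) (v w : cambrian c) : Prop :=
  forall a, inversion (sval v) a -> inversion (sval w) a.

End RootSystem.

Record quiver := Quiver {
  vertex : finType;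
  arrow : finType;
  source : arrow -> vertex;
  target : arrow -> vertex
}.

Section PathAlgebra.
Variables (K : fieldType) (Q : quiver).

Fixpoint composable (v : vertex Q) (s : seq (arrow Q)) : bool :=
  if s is a :: s' then (source a == v) && composable (target a) s' else true.

(* A path is its starting vertex with its list of arrows. *)
Definition qpath := {p : vertex Q * seq (arrow Q) | composable p.1 p.2}.

HB.instance Definition _ := Choice.on qpath.

Definition path_start (p : qpath) : vertex Q := (val p).1.
Definition path_end (p : qpath) : vertex Q :=
  last (val p).1 [seq target a | a <- (val p).2].

Definition path_algebra := {malg K[qpath]}.

HB.instance Definition _ := GRing.Lmodule.on path_algebra.

Definition path_elt (p : qpath) : path_algebra := mkmalgU p 1.

Lemma composable_cat v s t : composable v (s ++ t) =
  composable v s && composable (last v [seq target a | a <- s]) t.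
Proof. by elim: s v => //= a s IH v; rewrite IH andbA. Qed.

Definition trivial_path (v : vertex Q) : qpath :=
  exist (fun p => composable p.1 p.2) (v, [::]) isT.

Fact arrow_path_subproof a :
  composable (source a, [:: a]).1 (source a, [:: a]).2.
Proof. by rewrite /= eqxx. Qed.
Definition arrow_path (a : arrow Q) : qpath :=
  exist (fun p => composable p.1 p.2) (source a, [:: a])
    (arrow_path_subproof a).

(* Left to right: [p] is followed by [q]. *)
Definition path_cat (p q : qpath) : option qpath :=
  if path_end p == path_start q
  then (insub ((val p).1, (val p).2 ++ (val q).2) : option qpath) else None.

Definition path_mul (p q : qpath) : path_algebra :=
  if path_cat p q is Some r then path_elt r else 0.

(* The linear extension of a map defined on the basis of paths. *)
Definition path_ext (h : qpath -> path_algebra) (x : path_algebra) :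
    path_algebra :=
  \sum_(p <- msupp x) mcoeff p x *: h p.

Definition pa_one : path_algebra := \sum_(v : vertex Q) path_elt (trivial_path v).

Definition pa_mul (x y : path_algebra) : path_algebra :=
  path_ext (fun p => path_ext (path_mul p) y) x.

Local Notation ext := path_ext.

Lemma path_extEw (d : {fset qpath}) h x : (msupp x `<=` d)%fset ->
  ext h x = \sum_(p <- d) mcoeff p x *: h p.
Proof.
move=> sub; rewrite /ext (big_fset_incl _ sub) // => p _ px.
by rewrite mcoeff_outdom // scale0r.
Qed.

Lemma path_ext_linear h : linear (ext h).
Proof.
move=> c x y; pose d := (msupp x `|` msupp y `|` msupp (c *: x + y))%fset.
rewrite !(@path_extEw d) ?fsubsetUr //; last 2 first.
- by rewrite /d -fsetUA fsetUCA fsubsetUl.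
- by rewrite /d -fsetUA fsubsetUl.
rewrite scaler_sumr -big_split /=; apply: eq_bigr => p _.
by rewrite mcoeffD mcoeffZ scalerDl scalerA.
Qed.

HB.instance Definition _ h :=
  GRing.isLinear.Build K path_algebra path_algebra *:%R (ext h)
    (path_ext_linear h).

Lemma path_extU h p : ext h (path_elt p) = h p.
Proof.
by rewrite (path_extEw h (msuppU_le (x := 1))) big_seq_fset1 mcoeffUU scale1r.
Qed.

Lemma path_ext_id x : ext path_elt x = x.
Proof.
apply/malgP => p; rewrite /ext raddf_sum /=.
under eq_bigr do rewrite mcoeffZ mcoeffU.
have [px|px] := boolP (p \in msupp x).
  rewrite (big_fsetD1 p) //= eqxx mulr1 big1_seq ?addr0 // => q /andP[_].
  by rewrite in_fsetD1 => /andP[/negPf-> _]; rewrite mulr0.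
rewrite (mcoeff_outdom px) big1_seq // => q /andP[_ qx].
by case: eqVneq qx px => [->->//|_ _ _]; rewrite mulr0.
Qed.

Lemma eq_path_ext h h' x : h =1 h' -> ext h x = ext h' x.
Proof. by move=> e; apply: eq_bigr => p _; rewrite e. Qed.

Lemma path_ext_comp (f : {linear path_algebra -> path_algebra}) h x :
  f (ext h x) = ext (f \o h) x.
Proof.
rewrite /ext raddf_sum; apply: eq_bigr => p _ /=.
by rewrite linearZ_LR.
Qed.

Lemma path_ext_sum (I : finType) (h : I -> qpath -> path_algebra) x :
  \sum_i ext (h i) x = ext (fun p => \sum_i h i p) x.
Proof.
rewrite exchange_big; apply: eq_bigr => p _.
by rewrite scaler_sumr.
Qed.

Lemma path_catP p q r : path_cat p q = Some r ->
  [/\ path_end p = path_start q,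
      val r = (path_start p, (val p).2 ++ (val q).2),
      path_start r = path_start p & path_end r = path_end q].
Proof.
rewrite /path_cat; case: eqP => // e; case: insubP => // r' _ er [<-].
split=> //; first by rewrite /path_start er.
by rewrite /path_end er /= map_cat last_cat -/(path_end p) e.
Qed.

Lemma path_catN p q : path_cat p q = None -> path_end p != path_start q.
Proof.
rewrite /path_cat; case: eqP => // e; case: insubP => // /negP[] /=.
by rewrite composable_cat (valP p) -/(path_end p) e (valP q).
Qed.

Lemma path_catE p q r : path_end p = path_start q ->
  val r = (path_start p, (val p).2 ++ (val q).2) -> path_cat p q = Some r.
Proof. by move=> e er; rewrite /path_cat e eqxx -/(path_start p) -er valK. Qed.

Lemma path_catNE p q : path_end p != path_start q -> path_cat p q = None.
Proof. by rewrite /path_cat => /negPf->. Qed.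

Lemma path_mulA p q r :
  ext (path_mul p) (path_mul q r) = ext (fun s => path_mul s r) (path_mul p q).
Proof.
rewrite /path_mul; case eqr: (path_cat q r) => [qr|].
  have [e1 e2 e3 e4] := path_catP eqr.
  rewrite path_extU; case epq: (path_cat p q) => [pq|].
    have [f1 f2 f3 f4] := path_catP epq.
    rewrite path_extU; case epr: (path_cat pq r) => [s|]; last first.
      by have := path_catN epr; rewrite f4 e1 eqxx.
    have [g1 g2 g3 g4] := path_catP epr.
    rewrite (path_catE (r := s)) // ?e3 //.
    by rewrite g2 f3 f2 e2 /= catA.
  by rewrite linear0 path_catNE // e3 path_catN.
rewrite linear0; case epq: (path_cat p q) => [pq|]; last by rewrite linear0.
have [f1 f2 f3 f4] := path_catP epq.
by rewrite path_extU path_catNE // f4 path_catN.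
Qed.

Fact pa_mulDl : left_distributive pa_mul +%R.
Proof. by move=> x y z; rewrite /pa_mul linearD. Qed.

Fact pa_mulDr : right_distributive pa_mul +%R.
Proof.
move=> x y z; rewrite /pa_mul -big_split; apply: eq_bigr => p _ /=.
by rewrite linearD scalerDr.
Qed.

Fact pa_mulA : associative pa_mul.
Proof.
move=> x y z; rewrite /pa_mul path_ext_comp; apply: eq_path_ext => p /=.
rewrite !path_ext_comp; apply: eq_path_ext => q /=.
rewrite path_ext_comp /=.
rewrite -[RHS]/(pa_mul (path_mul p q) z).
transitivity (ext (fun r => ext (fun s => path_mul s r) (path_mul p q)) z).
  by apply: eq_path_ext => r /=; rewrite path_mulA.
rewrite /path_mul; case epq: (path_cat p q) => [pq|].
  by rewrite /pa_mul path_extU; apply: eq_path_ext => r; rewrite path_extU.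
rewrite /pa_mul linear0 [LHS]big1 // => r _.
by rewrite linear0 scaler0.
Qed.

Fact pa_mul1 : left_id pa_one pa_mul.
Proof.
move=> x; rewrite /pa_mul raddf_sum /=.
under eq_bigr do rewrite path_extU.
rewrite path_ext_sum -[RHS]path_ext_id; apply: eq_path_ext => p.
rewrite (bigD1 (path_start p)) //= big1 ?addr0 => [|v nv]; rewrite /path_mul.
  suff -> : path_cat (trivial_path (path_start p)) p = Some p by [].
  by apply: path_catE => //; rewrite /path_start /=; case: (\val p).
by rewrite path_catNE.
Qed.

Fact pa_mulr1 : right_id pa_one pa_mul.
Proof.
move=> x; rewrite /pa_mul -[RHS]path_ext_id; apply: eq_path_ext => p.
rewrite raddf_sum /=.
under eq_bigr do rewrite path_extU.
rewrite (bigD1 (path_end p)) //= big1 ?addr0 => [|v nv]; rewrite /path_mul.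
  suff -> : path_cat p (trivial_path (path_end p)) = Some p by [].
  by apply: path_catE => //; rewrite /path_start /= cats0; case: (\val p).
by rewrite path_catNE // eq_sym.
Qed.

HB.instance Definition _ := GRing.Zmodule_isPzRing.Build path_algebra
  pa_mulA pa_mul1 pa_mulr1 pa_mulDl pa_mulDr.

Definition arrow_elt (a : arrow Q) : path_algebra := path_elt (arrow_path a).

End PathAlgebra.

Section QuotientRing.
Variables (A : pzRingType) (S : A -> Prop).

Inductive generated_ideal : A -> Prop :=
| Ideal_gen x of S x : generated_ideal x
| Ideal_zero : generated_ideal 0
| Ideal_add x y of generated_ideal x & generated_ideal y :
    generated_ideal (x + y)
| Ideal_mul a x b of generated_ideal x : generated_ideal (a * x * b).

Definition ideal_pred : {pred A} := fun x => `[< generated_ideal x >].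

Fact ideal_zmod_closed : zmod_closed ideal_pred.
Proof.
split=> [|x y /asboolP Ix /asboolP Iy]; apply/asboolP; first exact: Ideal_zero.
apply: Ideal_add => //; rewrite -[y]mulr1 -mulN1r mulrA; exact: Ideal_mul.
Qed.

HB.instance Definition _ := GRing.isZmodClosed.Build A ideal_pred
  ideal_zmod_closed.

Definition quotient_ring : Type := {ideal_quot ideal_pred}.

HB.instance Definition _ := GRing.Zmodule.on quotient_ring.

Definition quotient_pi (x : A) : quotient_ring :=
  \pi_({ideal_quot ideal_pred})%qT x.

Definition quotient_mul (x y : quotient_ring) : quotient_ring :=
  quotient_pi (generic_quotient.repr x * generic_quotient.repr y).

Lemma quotient_piP x y :
  quotient_pi x = quotient_pi y <-> generated_ideal (x - y).
Proof.
split=> [e|I]; first by apply/asboolP; move/eqP: e; rewrite -Quotient.idealrBE.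
by apply/eqP; rewrite -Quotient.idealrBE; apply/asboolP.
Qed.

Lemma quotient_pi_surj (x : quotient_ring) : exists y, quotient_pi y = x.
Proof. by exists (generic_quotient.repr x); apply: generic_quotient.reprK. Qed.

Lemma quotient_piD : {morph quotient_pi : x y / x + y}.
Proof. exact: (@Quotient.pi_add A ideal_pred). Qed.

Lemma quotient_piM x y :
  quotient_pi (x * y) = quotient_mul (quotient_pi x) (quotient_pi y).
Proof.
rewrite /quotient_mul; set x' := generic_quotient.repr _.
set y' := generic_quotient.repr _.
have Ix : generated_ideal (x - x').
  by apply/quotient_piP; rewrite [RHS]generic_quotient.reprK.
have Iy : generated_ideal (y - y').
  by apply/quotient_piP; rewrite [RHS]generic_quotient.reprK.
apply/quotient_piP.
have -> : x * y - x' * y' = 1 * (x - x') * y + x' * (y - y') * 1.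
  by rewrite mul1r mulr1 mulrBl mulrBr addrA subrK.
by apply: Ideal_add; apply: Ideal_mul.
Qed.

Fact quotient_mulA : associative quotient_mul.
Proof.
move=> x y z; have [x' <-] := quotient_pi_surj x.
have [y' <-] := quotient_pi_surj y; have [z' <-] := quotient_pi_surj z.
by rewrite -!quotient_piM mulrA.
Qed.

Fact quotient_mul1 : left_id (quotient_pi 1) quotient_mul.
Proof.
by move=> x; have [y <-] := quotient_pi_surj x; rewrite -quotient_piM mul1r.
Qed.

Fact quotient_mulr1 : right_id (quotient_pi 1) quotient_mul.
Proof.
by move=> x; have [y <-] := quotient_pi_surj x; rewrite -quotient_piM mulr1.
Qed.

Fact quotient_mulDl : left_distributive quotient_mul +%R.
Proof.
move=> x y z; have [x' <-] := quotient_pi_surj x.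
have [y' <-] := quotient_pi_surj y; have [z' <-] := quotient_pi_surj z.
by rewrite -quotient_piD -!quotient_piM mulrDl quotient_piD.
Qed.

Fact quotient_mulDr : right_distributive quotient_mul +%R.
Proof.
move=> x y z; have [x' <-] := quotient_pi_surj x.
have [y' <-] := quotient_pi_surj y; have [z' <-] := quotient_pi_surj z.
by rewrite -quotient_piD -!quotient_piM mulrDr quotient_piD.
Qed.

HB.instance Definition _ := GRing.Zmodule_isPzRing.Build quotient_ring
  quotient_mulA quotient_mul1 quotient_mulr1 quotient_mulDl quotient_mulDr.

End QuotientRing.

Section TorsionClasses.
Variable A : pzRingType.

(* Right A-modules are left modules over the converse ring. *)
Definition rmod := lmodType A^c.

Definition finitely_generated (M : rmod) : Prop :=
  exists (m : nat) (g : 'I_m -> M),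
    forall x : M, exists a : 'I_m -> A^c, x = \sum_i a i *: g i.

Definition surjection (M N : rmod) (f : {linear M -> N}) : Prop :=
  forall y, exists x, f x = y.

(* [torsion_quot] includes closure under isomorphisms. *)
Record torsion_class (T : rmod -> Prop) : Prop := TorsionClass {
  torsion_fg : forall M, T M -> finitely_generated M;
  torsion_zero : forall M : rmod, (forall x : M, x = 0) -> T M;
  torsion_quot : forall (M N : rmod) (f : {linear M -> N}),
    surjection f -> T M -> T N;
  torsion_ext : forall (L M N : rmod)
      (f : {linear L -> M}) (g : {linear M -> N}),
    injective f -> surjection g ->
    (forall y, g y = 0 <-> exists x, f x = y) ->
    T L -> T N -> T M
}.

Definition tors := {T : rmod -> Prop | torsion_class T}.

Definition tors_le (T U : tors) : Prop := forall M, sval T M -> sval U M.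

End TorsionClasses.

Section GLS.
Variables (R : realType) (V : vectType R) (n : nat) (Phi : root_system V n).
Variables (c : seq 'I_n) (d : 'I_n -> nat) (K : fieldType).

Definition is_arrow (p : 'I_n * 'I_n) : bool :=
  (index p.1 c < index p.2 c)%N &&
  ((simple_reflection Phi p.1 \o simple_reflection Phi p.2)%VF !=
   (simple_reflection Phi p.2 \o simple_reflection Phi p.1)%VF).

(* The loop at i is [inl i], the arrow i -> j is [inr] of the pair (i, j). *)
Definition gls_quiver : quiver :=
  @Quiver 'I_n ('I_n + {p : 'I_n * 'I_n | is_arrow p})%type
    (fun a => match a with inl i => i | inr p => (val p).1 end)
    (fun a => match a with inl i => i | inr p => (val p).2 end).

Definition gls_loop (i : 'I_n) : path_algebra K gls_quiver :=
  arrow_elt K (inl i : arrow gls_quiver).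

Definition gls_arrow (i j : 'I_n) (ij : is_arrow (i, j)) :
    path_algebra K gls_quiver :=
  arrow_elt K (inr (exist is_arrow (i, j) ij) : arrow gls_quiver).

Inductive gls_relation : path_algebra K gls_quiver -> Prop :=
| GLS_nilpotent i : gls_relation (gls_loop i ^+ d i)
| GLS_commute i j (ij : is_arrow (i, j)) :
    gls_relation
      (gls_loop i ^+ `|cartan Phi j i|%N * gls_arrow ij -
       gls_arrow ij * gls_loop j ^+ `|cartan Phi i j|%N).

Definition gls_algebra : pzRingType := quotient_ring gls_relation.

End GLS.

Definition order_isomorphic (X Y : Type) (leX : X -> X -> Prop)
    (leY : Y -> Y -> Prop) : Prop :=
  exists f : X -> Y, bijective f /\
    forall x x', leX x x' <-> leY (f x) (f x').

(* Main.v *)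
(* A module over H is a representation (M_j, eps_j, M_jk) of the quiver with
   relations. To a torsion class T attach the set N(T) of the positive roots a for
   which T contains a rigid locally free representation of rank vector a. Write
   c = i c'. If every member of T vanishes at the source i, then T is a torsion
   class for c', with the same N(T). Otherwise T contains the representations
   concentrated at i, and the reflection functor at i turns T into a torsion class
   T' for the rotated word c' i, whose members have no quotient concentrated at i,
   with N(T) = {alpha_i} + s_i N(T'). As a rigid locally free representation without
   submodule concentrated at i reflects to one of rank s_i a, and any other one has
   rank alpha_i, these two steps match Reading's recursion for c-sortable elements.
   By induction on the length of the word plus the number of roots, N(T) is the
   inversion set of a c-sortable element, every c-sortable element arises, and N(T)
   inside N(U) implies T inside U. *)

From HB Require Import structures.
Require Import Defs.
From mathcomp Require Import all_boot all_order all_algebra.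
From mathcomp Require Import boolp reals.
From mathcomp Require Import finmap monalg.
From mathcomp Require Import zify.
From mathcomp Require Import ring lra.

Set Implicit Arguments.
Unset Strict Implicit.
Unset Printing Implicit Defensive.

Import Order.TTheory GRing.Theory Num.Theory.

Local Open Scope ring_scope.

(** Reflection is encoded as a relation. Writing H_i for K[x]/(x^d_i), a representation M yields the
    H_i-module [coind M], built from the neighbours of i, and M is compared with M' through a
    sequence M_i -> [coind M] -> M'_i, exact in the middle. Cokernels lead from M to M', kernels
    back, and morphisms, exact sequences, local freeness, ranks and splittings of self-extensions
    are all transferred by chases in this sequence.

    The delicate point is that a rigid locally free M of rank a, with [s i a] positive, has no
    subrepresentation concentrated at i. The map out of M_i turns out to be injective or surjective;
    positivity of [s i a] bounds the rank of M_i by that of [coind M], so in the second case the map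
    is injective as well.

    The symmetrizer enters through a divisibility: if C_ij is not 0, then d_i = |C_ji| k and d_j =
    |C_ij| k for some k, because one of the two entries has absolute value 1. This makes [coind M] a
    module over H_i, free if the M_j are.

    The induction adds the number of roots to the length of the word because a rotation keeps the
    length and loses only the root alpha_i, while dropping a letter keeps the roots. *)

Lemma linfun_linearE (K : fieldType) (U W : vectType K) (f : U -> W) :
  linear f -> linfun f =1 f.
Proof.
move=> lf; pose g : {linear U -> W} :=
  HB.pack f (GRing.isLinear.Build K U W *:%R f lf).
exact: (lfunE g).
Qed.

(** * Root systems and sortable elements *)

Section Roots.
Variables (R : realType) (V : vectType R) (n : nat) (Phi : root_system V n).

Local Notation ip := (inner Phi).
Local Notation al i := (tnth (simple_roots Phi) i).
Local Notation rt := (root_seq Phi).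
Local Notation pos := (positive_root Phi).
Local Notation C i j := (cartan Phi i j).
Local Notation s i := (simple_reflection Phi i).
Local Notation wp := (word_product Phi).
Local Notation inv := (inversion Phi).
Local Notation co i v := (coord (simple_roots Phi) i v).

Lemma ipC u v : ip u v = ip v u.
Proof. by rewrite hermC /= expr0 mul1r. Qed.

Lemma ip_gt0 a : a != 0 -> 0 < ip a a.
Proof. exact: neq0_dnorm_gt0. Qed.

Lemma root_nz a : a \in rt -> a != 0.
Proof. by apply: contraTneq => ->; apply: root_neq0. Qed.

Lemma alr i : al i \in rt.
Proof. by apply: simple_root; apply: mem_tnth. Qed.

Lemma reflE a v : reflection ip a v = v - (2 * ip a v / ip a a) *: a.
Proof.
apply: linfun_linearE => k u w /=.
rewrite linearDr linearZr /= mulrDr mulrDl scalerDl scalerBr scalerA opprD.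
by rewrite addrACA; congr (_ - _ *: _ + _); rewrite !mulrA (mulrC 2).
Qed.

Lemma refl_ip a u v : a != 0 -> ip (reflection ip a u) (reflection ip a v) = ip u v.
Proof.
move=> /ip_gt0 a0; rewrite !reflE !(linearBl, linearBr) /=.
rewrite !(linearZl_LR, linearZr) /= !(ipC _ a) .
have: ip a a != 0 by apply: lt0r_neq0.
by move: (ip a a) (ip a u) (ip a v) => x y z nx; field.
Qed.

Lemma reflK a : a != 0 -> involutive (reflection ip a).
Proof.
move=> /ip_gt0 /lt0r_neq0 a0 v; rewrite !reflE linearBr linearZr /=.
rewrite -addrA -opprD -scalerDl.
have -> : 2 * ip a v / ip a a +
    2 * (ip a v - 2 * ip a v / ip a a * ip a a) / ip a a = 0 by field.
by rewrite scale0r subr0.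
Qed.

Lemma refl_self a : a != 0 -> reflection ip a a = - a.
Proof.
move=> /ip_gt0 /lt0r_neq0 a0; rewrite reflE mulfK //.
by rewrite -{1}[a]scale1r -scalerBl -scaleN1r; congr (_ *: _); ring.
Qed.

Lemma rootN a : a \in rt -> - a \in rt.
Proof.
by move=> ar; rewrite -(refl_self (root_nz ar)); apply: root_refl.
Qed.

Lemma cartanE i j : (C i j)%:~R = 2 * ip (al i) (al j) / ip (al i) (al i).
Proof.
rewrite mxE; apply/eqP.
by rewrite -intrEfloor; apply: root_int; apply: alr.
Qed.

Lemma s_al i v : s i v = v - (2 * ip (al i) v / ip (al i) (al i)) *: al i.
Proof. exact: reflE. Qed.

Lemma sK i : involutive (s i).
Proof. exact/reflK/root_nz/alr. Qed.

Lemma s_root i a : a \in rt -> s i a \in rt.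
Proof. by apply: root_refl; apply: alr. Qed.

Lemma s_self i : s i (al i) = - al i.
Proof. exact/refl_self/root_nz/alr. Qed.

Lemma s_simple i j : s i (al j) = al j - (C i j)%:~R *: al i.
Proof. by rewrite s_al cartanE. Qed.

Lemma co_al i j : co i (al j) = (i == j)%:R.
Proof.
rewrite (tnth_nth 0) coord_free ?(basis_free (simple_basis Phi)) //.
by rewrite eq_sym.
Qed.

Lemma coE v : v = \sum_i co i v *: al i.
Proof.
rewrite {1}(coord_basis (simple_basis Phi) (memvf v)).
by apply: eq_bigr => i _; rewrite (tnth_nth 0).
Qed.

Lemma co_sum (m : 'I_n -> R) i : co i (\sum_j m j *: al j) = m i.
Proof.
rewrite linear_sum (bigD1 i) //= linearZ /= co_al eqxx mulr1 big1 ?addr0 //.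
by move=> j ji; rewrite linearZ /= co_al eq_sym (negPf ji) mulr0.
Qed.

Lemma co_eq u v : (forall i, co i u = co i v) -> u = v.
Proof. by move=> e; rewrite [u]coE [v]coE; apply: eq_bigr => i _; rewrite e. Qed.

Lemma co_s i j v : j != i -> co j (s i v) = co j v.
Proof.
by move=> ji; rewrite s_al linearB linearZ /= co_al (negPf ji) mulr0 subr0.
Qed.

Lemma co_s_self i v : co i (s i v) = co i v - \sum_j (C i j)%:~R * co j v.
Proof.
have e : s i v = \sum_j co j v *: s i (al j).
  by rewrite {1}[v]coE linear_sum; apply: eq_bigr => j _; rewrite linearZ.
rewrite e linear_sum /=.
under eq_bigr => j _ do rewrite linearZ /= s_simple linearB linearZ /= !co_al eqxx mulr1 mulrBr.
rewrite sumrB; congr (_ - _); last by apply: eq_bigr => j _; rewrite mulrC.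
rewrite (bigD1 i) //= eqxx mulr1 big1 ?addr0 // => j ji.
by rewrite eq_sym (negPf ji) mulr0.
Qed.

Lemma pos_co a i : pos a -> 0 <= co i a.
Proof. by case=> _ [m ->]; rewrite co_sum ler0n. Qed.

Lemma posE a : pos a <-> a \in rt /\ forall i, 0 <= co i a.
Proof.
split=> [p|[ar p]]; first by split=> [|i]; [case: p | apply: pos_co].
split=> //; have [m [e|e]] := simple_sign ar; first by exists m.
suff a0 : a = 0 by move: (root_nz ar); rewrite a0 eqxx.
apply: co_eq => i; rewrite linear0; apply/eqP.
rewrite eq_le p andbT e linearN /= co_sum oppr_le0 ler0n //.
Qed.

Lemma root_sign a : a \in rt -> pos a \/ pos (- a).
Proof.
move=> ar; have [m [e|e]] := simple_sign ar; [left|right].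
  by split=> //; exists m.
by split; [apply: rootN | exists m; rewrite e opprK].
Qed.

Lemma pos_coP a i : a \in rt -> 0 < co i a -> pos a.
Proof.
move=> ar ci; have [//|/(pos_co i)] := root_sign ar.
by rewrite linearN /= oppr_ge0 leNgt ci.
Qed.

Lemma posN a : pos a -> ~ pos (- a).
Proof.
move=> pa pna; have /posE[/root_nz/eqP[]] := pa.
apply: co_eq => i; rewrite linear0; apply/eqP.
by rewrite eq_le (pos_co i pa) -oppr_ge0 -linearN (pos_co i pna).
Qed.

Lemma al_pos i : pos (al i).
Proof. by apply: (@pos_coP _ i (alr i)); rewrite co_al eqxx. Qed.

Lemma pos_simple a i : pos a -> (forall j, j != i -> co j a = 0) -> a = al i.
Proof.
move=> pa z; have e : a = co i a *: al i.
  by rewrite {1}[a]coE (bigD1 i) //= big1 ?addr0 // => j /z->; rewrite scale0r.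
case: (pa) => ar _; have := ar; rewrite e => /(root_reduced (alr i)).
case=> [->|ci]; first by rewrite scale1r.
by have := pos_co i pa; rewrite ci oppr_ge0 ler10.
Qed.

(** As the system is reduced, a positive root other than [al i] has a positive coordinate away from
    [i]. [s i] leaves it unchanged, and one positive coordinate makes a root positive. *)
Lemma s_pos i a : pos a -> a != al i -> pos (s i a).
Proof.
move=> pa ai; have [j ji cj] : exists2 j, j != i & 0 < co j a.
  apply: contrapT => h; move/eqP: ai; apply; apply: pos_simple => // j ji.
  apply/eqP; rewrite eq_le (pos_co j pa) andbT leNgt; apply/negP => cj.
  by apply: h; exists j.
by case: pa => ar _; apply: (@pos_coP _ j (s_root i ar)); rewrite co_s.
Qed.

Lemma s_neq i a : pos a -> s i a != al i.
Proof.
move=> pa; apply/eqP => e; apply: (@posN (al i) (al_pos i)).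
by rewrite -s_self -e sK.
Qed.

(** The root [s i (al j)] has [j]-coordinate 1, hence is positive, and its [i]-coordinate is
    [- C i j]. *)
Lemma cartan_le0 i j : i != j -> C i j <= 0.
Proof.
move=> ij; have ji : j != i by rewrite eq_sym.
have sr := s_root i (alr j).
have /(pos_co i) : pos (s i (al j)).
  by apply: (@pos_coP _ j sr); rewrite co_s // co_al eqxx.
rewrite s_simple linearB linearZ /= !co_al eqxx (negPf ij) mulr1 sub0r.
by rewrite oppr_ge0 lerz0.
Qed.

Lemma cartan_diag i : C i i = 2.
Proof.
apply: (@intr_inj R); rewrite cartanE mulfK //.
exact/lt0r_neq0/ip_gt0/root_nz/alr.
Qed.

Lemma cartan_eq0 i j : (C i j == 0) = (C j i == 0).
Proof.
rewrite -!(intr_eq0 R) !cartanE ![_ / _ == 0]mulf_eq0 !invr_eq0 !mulf_eq0.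
by rewrite !(gt_eqF (ip_gt0 (root_nz (alr _)))) ipC.
Qed.

(** Strict Cauchy-Schwarz: the product is 4 z^2 / (x y), and z^2 < x y because
    [x *: al j - z *: al i] is nonzero, its [j]-coordinate being x. *)
Lemma cartan_lt4 i j : i != j -> C i j * C j i < 4.
Proof.
move=> ij; rewrite -(ltr_int R) intrM !cartanE [ip (al j) (al i)]ipC.
have pi := ip_gt0 (root_nz (alr i)); have pj := ip_gt0 (root_nz (alr j)).
set x := ip (al i) (al i) in pi *; set y := ip (al j) (al j) in pj *.
set z := ip (al i) (al j).
have : 0 < ip (x *: al j - z *: al i) (x *: al j - z *: al i).
  apply/ip_gt0/eqP => e; have := congr1 (fun v => co j v) e.
  rewrite linearB !linearZ /= !co_al eqxx eq_sym (negPf ij) mulr0 subr0 mulr1 linear0.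
  by move/eqP; rewrite (gt_eqF pi).
rewrite !(linearBl, linearBr) /= !(linearZl_LR, linearZr) /=.
rewrite !(ipC (al j) (al i)) -/x -/y -/z => h.
have h' : z * z < x * y.
  have : 0 < x * (x * y - z * z) by move: h; congr (_ < _); ring.
  by rewrite pmulr_rgt0 // subr_gt0.
have -> : 2 * z / x * (2 * z / y) = (4 * (z * z)) / (x * y).
  by field; rewrite !gt_eqF.
by rewrite ltr_pdivrMr ?mulr_gt0 // (_ : 4%:~R = 4) // ltr_pM2l.
Qed.

(** Two positive integers with product below 4 cannot both exceed 1. The divisibility in [acartan_d]
    comes from here. *)
Lemma cartan_min i j : i != j -> C i j != 0 ->
  (`|C i j| = 1)%N \/ (`|C j i| = 1)%N.
Proof.
move=> ij c0; have cj0 : C j i != 0 by rewrite -cartan_eq0.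
have ji : j != i by rewrite eq_sym.
have := cartan_lt4 ij; have := cartan_le0 ij; have := cartan_le0 ji.
move: (C i j) (C j i) c0 cj0 => x y x0 y0 lx ly; nia.
Qed.

Lemma comm_cartan i j : i != j ->
  ((s i \o s j)%VF != (s j \o s i)%VF) = (C i j != 0).
Proof.
move=> ij; apply/idP/idP; apply: contra.
  rewrite -(intr_eq0 R) cartanE mulf_eq0 invr_eq0 mulf_eq0.
  rewrite !(gt_eqF (ip_gt0 (root_nz (alr _)))) pnatr_eq0 /= orbF => /eqP e.
  have e' : ip (al j) (al i) = 0 by rewrite ipC.
  apply/eqP/lfunP => v; rewrite !comp_lfunE !s_al !linearBr !linearZr /= e e'.
  by rewrite !mulr0 !subr0 -!addrA [X in _ + X]addrC.
(* On [al j] the two composites have [i]-coordinates [C i j] and [- C i j]. *)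
move=> /eqP/(congr1 (fun f : 'End(V) => co i (f (al j)))).
rewrite /= !comp_lfunE s_self linearN /= linearN /= (co_s _ ij) s_simple.
rewrite linearB linearZ /= !co_al eqxx (negPf ij) mulr1 sub0r opprK.
by rewrite -(intr_eq0 R); move: (C i j)%:~R => x e; apply/eqP; lra.
Qed.

Lemma wp_cons i u v : wp (i :: u) v = s i (wp u v).
Proof. by rewrite /= comp_lfunE. Qed.

Lemma wp_cat u1 u2 v : wp (u1 ++ u2) v = wp u1 (wp u2 v).
Proof. by elim: u1 => [|i u1 IH]; rewrite /= ?id_lfunE // !comp_lfunE IH. Qed.

Lemma wp_rcons u i v : wp (rcons u i) v = wp u (s i v).
Proof. by rewrite -cats1 wp_cat wp_cons /= id_lfunE. Qed.

Lemma wp_revK u : cancel (wp (rev u)) (wp u).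
Proof.
elim: u => [|i u IH] v; first by rewrite /= !id_lfunE.
by rewrite rev_cons wp_rcons wp_cons IH sK.
Qed.

Lemma wpK u : cancel (wp u) (wp (rev u)).
Proof. by move=> v; rewrite -{2}[u]revK wp_revK. Qed.

Lemma wpV u : ((wp u)^-1)%VF = wp (rev u).
Proof.
have /lker0_lfunK k0 : lker (wp u) == 0%VS by apply/lker0P/(can_inj (wpK u)).
by apply/lfunP => v; rewrite -{1}[v](wp_revK u) k0.
Qed.

Lemma wp_root u a : a \in rt -> wp u a \in rt.
Proof.
by elim: u => [|i u IH] ar; rewrite ?wp_cons ?s_root ?IH //= id_lfunE.
Qed.

Lemma invE u a : inv (wp u) a <-> pos a /\ pos (- wp (rev u) a).
Proof. by rewrite /inversion wpV. Qed.

Lemma inv_pos w a : inv w a -> pos a. Proof. by case. Qed.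

Lemma inv_s_other i u a : pos a -> a != al i ->
  (inv (wp (i :: u)) a <-> inv (wp u) (s i a)).
Proof.
move=> pa ai; have psa := s_pos pa ai; rewrite !invE rev_cons wp_rcons.
by split=> -[].
Qed.

Lemma inv_s_self i u : inv (wp (i :: u)) (al i) <-> ~ inv (wp u) (al i).
Proof.
rewrite !invE rev_cons wp_rcons s_self linearN opprK.
split=> [[_ p] [_ /posN]|h]; first by rewrite opprK.
split; first exact: al_pos.
have [//|pn] := root_sign (wp_root (rev u) (alr i)).
by case: h; split=> //; apply: al_pos.
Qed.

Lemma conj_refl j a v : s j (reflection ip (s j a) v) = reflection ip a (s j v).
Proof.
rewrite (reflE (s j a)) (reflE a) linearB linearZ /= sK /simple_reflection.
have nj := root_nz (alr j).
by rewrite -{2}[v](reflK nj) !refl_ip.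
Qed.

(** Strong exchange. Carried along the word, [a] becomes simple at some letter; deleting that letter
    amounts to multiplying by the reflection in [a], by conjugation of reflections. *)
Lemma inv_exchange u a : inv (wp u) a ->
  exists u', size u = (size u').+1 /\ wp u = (reflection ip a \o wp u')%VF.
Proof.
elim: u a => [|j u IH] a.
  by rewrite invE /= id_lfunE => -[/posN].
have [-> _|aj ia] := eqVneq a (al j); first by exists u.
have pa := inv_pos ia.
have [u' [su eu]] := IH _ ((inv_s_other u pa aj).1 ia).
exists (j :: u'); split; first by rewrite /= su.
by apply/lfunP => v; rewrite comp_lfunE !wp_cons eu comp_lfunE conj_refl.
Qed.

(** Letters other than [i] do not change the [i]-coordinate, so the image of [al i] keeps
    [i]-coordinate 1 and stays positive. *)
Lemma inv_notin i u : i \notin u -> ~ inv (wp u) (al i).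
Proof.
move=> iu; rewrite invE => -[_]; apply: (@posN (wp (rev u) (al i))).
apply: (@pos_coP _ i (wp_root _ (alr i))); suff -> : co i (wp (rev u) (al i)) = 1 by [].
elim: u iu => [_|j u IH]; first by rewrite /= id_lfunE co_al eqxx.
rewrite inE negb_or => /andP[ij iu]; rewrite rev_cons wp_rcons s_simple.
rewrite linearB linearZ /= linearB linearZ /= IH //.
suff -> : co i (wp (rev u) (al j)) = 0 by rewrite mulr0 subr0.
have: i \notin rev u by rewrite mem_rev.
have: co i (al j) = 0 by rewrite co_al (negPf ij).
move: (al j) (rev u) => v t; elim: t => [|k t IHt] /= e; first by rewrite id_lfunE.
rewrite inE negb_or => /andP[ik it]; rewrite comp_lfunE co_s ?IHt //.
Qed.

(** * Reduced words, descents and inversion sets *)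

Lemma has_reduced u : exists v, reduced_word Phi (wp u) v.
Proof.
have ex : exists k, `[< exists2 v, wp v = wp u & size v = k >].
  by exists (size u); apply/asboolP; exists u.
case: (ex_minnP ex) => k /asboolP[v ev sv] mk; exists v; split=> // u' eu.
by rewrite sv; apply: mk; apply/asboolP; exists u'.
Qed.

(** Otherwise [al i] is an inversion of the tail, and the exchange in the tail cancels the leading
    [s i], leaving a shorter word. *)
Lemma reduced_descent w i u : reduced_word Phi w (i :: u) -> inv w (al i).
Proof.
case=> <- mn; rewrite inv_s_self => /inv_exchange[u' [su eu]].
have /mn : wp u' = wp (i :: u).
  by apply/lfunP => v; rewrite wp_cons eu comp_lfunE /= sK.
by rewrite /= su; lia.
Qed.

Lemma descent_reduced u i v : inv (wp u) (al i) ->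
  reduced_word Phi (wp (i :: u)) v -> reduced_word Phi (wp u) (i :: v).
Proof.
move=> iu [ev mn]; split=> [|u' eu'].
  by apply/lfunP => x; rewrite wp_cons ev wp_cons sK.
move: iu; rewrite -eu' => /inv_exchange[u2 [s2 e2]].
rewrite s2 /= ltnS; apply: mn; apply/lfunP => x.
by rewrite wp_cons -eu' e2 comp_lfunE /= sK.
Qed.

Lemma reduced_behead w i u : reduced_word Phi w (i :: u) ->
  reduced_word Phi (s i \o w)%VF u.
Proof.
move=> [<- mn]; split=> [|u' eu']; first by apply/lfunP => x; rewrite comp_lfunE wp_cons sK.
rewrite -ltnS; apply: (mn (i :: u')).
by apply/lfunP => x; rewrite wp_cons eu' comp_lfunE sK.
Qed.

Lemma no_descent u : (forall i, ~ inv (wp u) (al i)) -> wp u = \1%VF.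
Proof.
have [[|i v] rv] := has_reduced u; first by case: rv.
by move=> /(_ i)[]; apply: (reduced_descent rv).
Qed.

Lemma inv_id a : ~ inv \1%VF a.
Proof. by have /= := invE [::] a; rewrite id_lfunE => -> [/posN]. Qed.

(** The first letter of a reduced word of one element is a descent of both; removing it changes both
    inversion sets in the same way, and the length has dropped. *)
Lemma inversion_inj u v : (forall a, inv (wp u) a <-> inv (wp v) a) -> wp u = wp v.
Proof.
have [u1 r1] := has_reduced u; case: (r1) => e1 _; rewrite -e1 in r1 *.
move: r1 {e1}; elim: u1 v => [|i u1 IH] v r1 e.
  by rewrite [wp v]no_descent // => i /e /inv_id.
have iv : inv (wp v) (al i) by apply/e/(reduced_descent r1).
have r2 := reduced_behead r1.
have eu : (s i \o wp (i :: u1))%VF = wp u1.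
  by apply/lfunP => x; rewrite comp_lfunE wp_cons sK.
rewrite eu in r2.
have /(_ (i :: v)) := IH _ r2.
have ev : wp v = wp [:: i, i & v] by apply/lfunP => x; rewrite !wp_cons sK.
move=> h; rewrite ev; suff hh : wp u1 = wp (i :: v).
  by apply/lfunP => x; rewrite wp_cons hh [RHS]wp_cons.
apply: h => x.
have niv : ~ inv (wp (i :: v)) (al i) by rewrite inv_s_self.
have niu : ~ inv (wp u1) (al i).
  by apply: (inv_s_self i u1).1; apply: reduced_descent r1.
have [->|xi] := eqVneq x (al i); first by [].
have px_iff : pos x -> (inv (wp u1) x <-> inv (wp (i :: v)) x).
  move=> px; have psx := s_pos px xi; have nsx := s_neq i px.
  have h1 := inv_s_other u1 psx nsx; have h2 := inv_s_other (i :: v) psx nsx.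
  rewrite sK in h1 h2; have h3 := e (s i x); rewrite ev in h3.
  split; first by move/h1/h3/h2.
  by move/h2/h3/h1.
by split=> ix; apply/(px_iff (inv_pos ix)).
Qed.

(* Reading's recursion: drop the initial letter of [c], or rotate it to the end. *)
Inductive csort : seq 'I_n -> 'End(V) -> Prop :=
| csort_nil : csort [::] \1%VF
| csort_drop i c w of csort c w : csort (i :: c) w
| csort_refl i c w of csort (rcons c i) w & ~ inv w (al i) :
    csort (i :: c) (s i \o w)%VF.

Lemma scomp_invol i (w : 'End(V)) : (s i \o (s i \o w))%VF = w.
Proof. by apply/lfunP => v; rewrite !comp_lfunE sK. Qed.

Lemma csort_word c w : csort c w -> exists2 u, {subset u <= c} & w = wp u.
Proof.
elim=> {c w} [|i c w _ [u uc ->]|i c w _ [u uc ->] _].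
- by exists [::].
- by exists u => // j /uc; rewrite inE => ->; rewrite orbT.
- exists (i :: u) => // j; rewrite inE => /predU1P[->|/uc]; first by rewrite mem_head.
  by rewrite mem_rcons.
Qed.

Lemma csort1 c : csort c \1%VF.
Proof. by elim: c => [|i c IH]; [apply: csort_nil | apply: csort_drop]. Qed.

(* [u] is the word of [w] read off greedily along [c] c [c] ..., one letter
   being taken exactly when it is a left descent of what remains; [p] lists the
   positions taken. *)
Inductive greedy : seq 'I_n -> 'End(V) -> seq 'I_n -> seq nat -> Prop :=
| greedy_nil c : greedy c \1%VF [::] [::]
| greedy_take i c w u p of inv w (al i) & greedy (rcons c i) (s i \o w)%VF u p :
    greedy (i :: c) w (i :: u) (0%N :: map S p)
| greedy_skip i c w u p of ~ inv w (al i) & greedy (rcons c i) w u p :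
    greedy (i :: c) w u (map S p).

(** Each non-descent in [c1] is skipped and moves to the end of the word, until the descent [i] is
    in front. *)
Lemma greedy_find c1 c2 i w u p : (forall j, j \in c1 -> ~ inv w (al j)) ->
  inv w (al i) -> greedy (rcons (c2 ++ c1) i) (s i \o w)%VF u p ->
  exists u' p', greedy (c1 ++ i :: c2) w u' p'.
Proof.
elim: c1 c2 => [|j c1 IH] c2 nd iw g.
  by rewrite cats0 in g; exists (i :: u), (0%N :: map S p); apply: greedy_take.
have [||u' [p' g']] := IH (rcons c2 j) _ iw.
- by move=> k kc; apply: nd; rewrite inE kc orbT.
- by rewrite cat_rcons.
exists u', (map S p'); rewrite cat_cons; apply: greedy_skip.
  by apply: nd; rewrite mem_head.
by rewrite -cats1 -catA cat_cons cats1.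
Qed.

(** Every simple reflection occurs in [c], so a nontrivial element has a descent there. Taking the
    first one leaves an element with a shorter reduced word. *)
Lemma greedy_exists c u0 : (forall i, i \in c) -> exists u p, greedy c (wp u0) u p.
Proof.
have [u ru] := has_reduced u0; case: (ru) => e1 _; rewrite -e1 in ru *.
move: ru {e1 u0}; elim: {u}(size u) {-2}u (erefl (size u)) c => [|k IH] u su c ru call.
  by case: u su {ru} => // _; exists [::], [::]; apply: greedy_nil.
case: u su ru => // i0 u [su] ru.
have hd : has (fun i => `[< inv (wp (i0 :: u)) (al i) >]) c.
  apply/hasP; exists i0; first exact: call.
  by apply/asboolP/(reduced_descent ru).
move: (hd); rewrite has_find; set m := find _ _ => mc.
have im : inv (wp (i0 :: u)) (al (nth i0 c m)) by apply/asboolP; apply: (nth_find i0 hd).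
have nd j : j \in take m c -> ~ inv (wp (i0 :: u)) (al j).
  move=> /(nthP i0)[l]; rewrite size_take mc => lm; rewrite nth_take // => <- h.
  by have := before_find i0 lm; move/asboolP.
have cE := cat_take_drop m c; rewrite (drop_nth i0 mc) in cE.
move: im nd cE; move: (nth i0 c m) (take m c) (drop m.+1 c) => i c1 c2 im nd cE.
have [v rv] := has_reduced (i :: i0 :: u).
have rw := descent_reduced im rv.
have sv : size v = k.
  by case: (ru) (rw) => _ m1 [e2 m2]; have := m1 _ e2; have := m2 _ erefl; rewrite /=; lia.
have ev : wp v = (s i \o wp (i0 :: u))%VF by case: rv.
have rv' : reduced_word Phi (wp v) v.
  by case: rv => e mv; split=> // u'; rewrite e; apply: mv.
have [|u1 [p1 g1]] := IH v sv (rcons (c2 ++ c1) i) rv'.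
  move=> j; have := call j; rewrite -cE mem_rcons inE !mem_cat inE.
  by case: (j == i); case: (j \in c1); case: (j \in c2).
by rewrite -cE; apply: (greedy_find (u := u1) (p := p1)) => //; rewrite -ev.
Qed.

Lemma greedy_word c w u p : greedy c w u p -> reduced_word Phi w u.
Proof.
elim=> {c w u p} [c|i c w u p iw _ ru|i c w u p _ _ //].
  by split=> // u' _; apply: leq0n.
have ew : wp (i :: u) = w by case: ru => /= -> _; rewrite scomp_invol.
rewrite -ew in iw *; apply: (descent_reduced iw).
rewrite /= scomp_invol; case: ru => e m; split=> // u' eu'.
by apply: m; rewrite eu'.
Qed.

(** * Positions in the infinite word and leftmost embeddings *)

Lemma cinf_shift (i : 'I_n) c k : cinf (i :: c) k.+1 = cinf (rcons c i) k.
Proof.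
rewrite /cinf size_rcons -[size (i :: c)]/(size c).+1; set N := size c.
have -> : (k.+1 %% N.+1 = (k %% N.+1).+1 %% N.+1)%N.
  by rewrite -addn1 -modnDml addn1.
have : (k %% N.+1 < N.+1)%N by rewrite ltn_mod.
move: (k %% N.+1)%N => r; rewrite ltnS leq_eqVlt -cats1 onth_cat => /predU1P[->|rN].
  by rewrite modnn ltnn subnn.
by rewrite modn_small ?ltnS //= rN.
Qed.

Lemma cinf0 (i : 'I_n) c : cinf (i :: c) 0 = Some i.
Proof. by rewrite /cinf mod0n. Qed.

Lemma cinf_index (c : seq 'I_n) k i : uniq c -> cinf c k = Some i ->
  (k %% size c = index i c)%N.
Proof.
move=> uc; rewrite /cinf; move: (k %% size c)%N => r e.
have rc : (r < size c)%N by rewrite -onthTE e.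
by have := odflt_onth i c r; rewrite e /= => ->; rewrite index_uniq.
Qed.

Lemma cinf_some (c : seq 'I_n) k : (0 < size c)%N -> exists i, cinf c k = Some i.
Proof.
move=> c0; case e: (cinf c k) => [i|]; first by exists i.
by have := onthTE c (k %% size c)%N; rewrite ltn_mod c0 -/(cinf c k) e.
Qed.

Lemma sorted_map_succ p : sorted ltn (map S p) = sorted ltn p.
Proof. by rewrite sorted_map; apply: eq_sorted => x y /=; rewrite ltnS. Qed.

Lemma embedding_shift (i : 'I_n) c u p :
  embedding (i :: c) u (map S p) <-> embedding (rcons c i) u p.
Proof.
rewrite /embedding sorted_map_succ -map_comp.
by under eq_map => k do rewrite /= cinf_shift.
Qed.

Lemma map_succ_pred p : 0%N \notin p -> map S (map predn p) = p.
Proof.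
move=> p0; rewrite -map_comp -[RHS]map_id; apply/eq_in_map => k kp /=.
by case: k kp p0 => // ->.
Qed.

(** Whether position 0 is used decides how an embedding in [i c i c ...] comes from one in
    [c i c i ...], whose positions are smaller by one. *)
Variant embedding_spec (i : 'I_n) c : seq 'I_n -> seq nat -> Prop :=
| Embedding_nil : embedding_spec i c [::] [::]
| Embedding_take u p of embedding (rcons c i) u p :
    embedding_spec i c (i :: u) (0%N :: map S p)
| Embedding_skip u p of embedding (rcons c i) u p :
    embedding_spec i c u (map S p).

Lemma embeddingP (i : 'I_n) c u p :
  embedding (i :: c) u p -> embedding_spec i c u p.
Proof.
have path0 q r : path ltn q r -> 0%N \notin r.
  elim: r q => // a r IH q /= /andP[qa ar]; rewrite inE negb_or (IH _ ar) andbT.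
  by case: a qa {ar}.
case: p => [|q p] e.
  by case: e => _; case: u => // _; apply: Embedding_nil.
case: q e => [|q] e.
  case: u e => [[_]//|j u] [/= sp]; rewrite cinf0 => -[<- e].
  have p0 := path0 _ _ sp.
  rewrite -(map_succ_pred p0); apply: Embedding_take; apply/embedding_shift.
  by rewrite map_succ_pred //; split=> //; apply: path_sorted sp.
have p0 : 0%N \notin q.+1 :: p.
  by case: e => /= /path0 sp _; rewrite inE negb_or.
rewrite -(map_succ_pred p0); apply: Embedding_skip; apply/embedding_shift.
by rewrite map_succ_pred.
Qed.

Lemma greedy_embedding c w u p : greedy c w u p -> embedding c u p.
Proof.
elim=> {c w u p} [c|i c w u p _ _ [sp e]|i c w u p _ _ e].
- by split.
- split=> /=.
    rewrite path_min_sorted ?sorted_map_succ //.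
    by apply/allP => _ /mapP[k _ ->].
  rewrite cinf0 -e -map_comp; congr (_ :: _).
  by apply: eq_map => k /=; rewrite cinf_shift.
- exact/embedding_shift.
Qed.

Lemma all2_leq_succ p q : all2 leq (map S p) (map S q) = all2 leq p q.
Proof. by elim: p q => [|a p IH] [|b q] //=; rewrite ltnS IH. Qed.

(** A letter is skipped only if it is not a descent; then no reduced word of what remains starts
    with it, so no embedding of [u] can use that position earlier. *)
Lemma greedy_least c w u p q : greedy c w u p -> embedding c u q -> all2 leq p q.
Proof.
move=> g; elim: g q => {c w u p} [c|i c w u p _ _ IH|i c w u p ni g IH] q eq.
- by case: q eq => // a q [].
- move: eq; move E: (i :: u) => iu eq.
  case: (embeddingP eq) E => // {iu q eq} [u' q e E|u' q e E].
    have eu : u = u' by case: E.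
    by rewrite /= all2_leq_succ IH ?eu.
  case: q e => [|a q] [/= sq eqq]; rewrite -E // in eqq.
  rewrite /= all2_leq_succ; apply: IH; case: eqq => _ eqq; split=> //.
  exact: path_sorted sq.
- have ru := greedy_word g.
  case: (embeddingP eq) ru IH => {u q eq g} [ru|u q e ru|u q e _] IH.
  + by have := IH [::] (conj isT erefl); case: (p).
  + by case: ni; apply: reduced_descent ru.
  + by rewrite all2_leq_succ; apply: IH.
Qed.

Lemma lexi_map_succ (p q : seqlexi nat) :
  ((map S p : seqlexi nat) <= map S q)%O = (p <= q)%O.
Proof.
by elim: p q => [|a p IH] [|b q] //; rewrite /= !Order.SeqLexiOrder.lexi_cons IH.
Qed.

Lemma greedy_lexi c w u p u' (p' : seqlexi nat) : greedy c w u p ->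
  reduced_word Phi w u' -> embedding c u' p' -> ((p : seqlexi nat) <= p')%O.
Proof.
move=> g; elim: g u' p' => {c w u p} [c|i c w u p iw g IH|i c w u p ni g IH] u' p' ru eq.
- by [].
- move: ru; case: (embeddingP eq) => {u' p' eq} [|u' q e ru|u' [|a q] e ru].
  + by case=> ew _; rewrite -ew /= in iw; case: (inv_id iw).
  + rewrite Order.SeqLexiOrder.lexi_cons lexx /= lexi_map_succ.
    by apply: IH e; apply: reduced_behead ru.
  + case: e ru => _; case: u' => // _ [ew _].
    by rewrite -ew /= in iw; case: (inv_id iw).
  + by rewrite Order.SeqLexiOrder.lexi_cons.
- move: ru; case: (embeddingP eq) => {u' p' eq} [ru|u' q e ru|u' q e ru].
  + by have := IH [::] [::] ru (conj isT erefl); case: (p).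
  + by case: ni; apply: reduced_descent ru.
  + by rewrite lexi_map_succ; apply: IH ru e.
Qed.

Lemma greedy_sorting c w u p : greedy c w u p -> sorting_word Phi c w u p.
Proof.
move=> g; split; first exact: greedy_word g.
  by split=> [|q]; [apply: greedy_embedding g | apply: greedy_least g].
by move=> u' p' ru [e _]; apply: greedy_lexi g ru e.
Qed.

Lemma sorting_word_inj c w u p u' p' : sorting_word Phi c w u p ->
  sorting_word Phi c w u' p' -> u = u' /\ p = p'.
Proof.
move=> [r1 l1 m1] [r2 l2 m2].
have e : p = p' by apply: (@le_anti _ (seqlexi nat)); rewrite (m1 _ _ r2 l2) (m2 _ _ r1 l1).
split=> //; case: l1 l2 => -[_ e1] _ [[_ e2] _].
by apply: (inj_map Some_inj); rewrite -e1 -e2 e.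
Qed.

Lemma greedy_cinf c w u p i : greedy c w u p -> i \in u ->
  exists2 k, k \in p & cinf c k = Some i.
Proof.
move=> /greedy_embedding[_ e] iu.
have : Some i \in [seq Some j | j <- u] by apply: map_f.
by rewrite -e => /mapP[k kp ->]; exists k.
Qed.

(** The positions [q] and [q + N] are the same place in two consecutive blocks. *)
Definition block_decreasing N (p : seq nat) := forall q, (q + N)%N \in p -> q \in p.

Lemma block_decreasing_mod N p k : block_decreasing N p -> k \in p -> (k %% N)%N \in p.
Proof.
move=> bd; rewrite {1}(divn_eq k N); elim: (k %/ N)%N => [|m IH]; first by rewrite mul0n.
by rewrite mulSn -addnA addnC => /bd.
Qed.

Lemma mem_map_succ k p : (k.+1 \in map S p) = (k \in p).
Proof. exact: (mem_map succn_inj). Qed.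

Lemma filter_predI_predC1 (J : pred 'I_n) i c : i \notin c ->
  filter (predI J (predC1 i)) (rcons c i) = filter J c.
Proof.
move=> ic; rewrite filter_rcons /= eqxx andbF; apply: eq_in_filter => j jc /=.
by rewrite (_ : j != i) ?andbT //; apply: contraNneq ic => <-.
Qed.

(** [J] holds the letters still in use: the recursion deletes letters from its word, whereas the
    greedy reading keeps rotating the full word. A letter once refused leaves [J]. *)
Lemma greedy_csort c w u p (J : pred 'I_n) : greedy c w u p -> uniq c ->
  block_decreasing (size c) p -> all J u -> csort (filter J c) w.
Proof.
move=> g; elim: g J => {c w u p} [c|i c w u p iw g IH|i c w u p ni g IH] J.
- by move=> _ _ _; apply: csort1.
- move=> uc bd /= /andP[Ji Ju]; rewrite Ji.
  rewrite -(scomp_invol i w); apply: csort_refl.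
    rewrite -[rcons _ _]/(rcons (filter J c) i).
    have <- : filter J (rcons c i) = rcons (filter J c) i by rewrite filter_rcons Ji.
    apply: IH => //; first by rewrite rcons_uniq.
    move=> q qp; rewrite -mem_map_succ; have := bd q.+1.
    rewrite !inE /= addSn mem_map_succ; apply.
    by rewrite size_rcons in qp.
  have [e _] := greedy_word g; rewrite -e; apply: (inv_s_self i u).1.
  by rewrite /= e scomp_invol.
- move=> uc bd Ju; have /= /andP[ic uc'] := uc.
  (* With decreasing blocks, a letter that occurs at all occurs in the first block, and there
     position 0 has just been refused. *)
  have iu : i \notin u.
    apply/negP => /(greedy_cinf (greedy_skip ni g))[k kp ck].
    have := block_decreasing_mod bd kp.
    by rewrite (cinf_index uc ck) /= eqxx; case/mapP.
  have bd' : block_decreasing (size (rcons c i)) p.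
    move=> q qp; rewrite -mem_map_succ; apply: bd.
    by rewrite addSn mem_map_succ; rewrite size_rcons in qp.
  have uc2 : uniq (rcons c i) by rewrite rcons_uniq.
  have e := filter_predI_predC1 J ic.
  have : csort (filter J c) w.
    rewrite -e; apply: IH => //; apply/allP => j ju /=.
    by rewrite (allP Ju) //=; apply: contraNneq iu => <-.
  by move=> h /=; case: ifP => // _; apply: csort_drop.
Qed.

Lemma csort_greedy c w u p (J : pred 'I_n) : greedy c w u p -> uniq c ->
  csort (filter J c) w -> block_decreasing (size c) p /\ all J u.
Proof.
move=> g; elim: g J => {c w u p} [c|i c w u p iw g IH|i c w u p ni g IH] J.
- by [].
- move=> uc cs; have uc' : uniq (rcons c i) by rewrite rcons_uniq.
  have Ji : J i.
    apply: contraPT iw => nJ; have [v vc ->] := csort_word cs; apply: inv_notin.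
    by apply/negP => /vc; rewrite mem_filter (negPf nJ).
  have ic : i \notin c by case/andP: uc.
  have [] := IH J uc'.
    rewrite filter_rcons Ji; rewrite /= Ji in cs.
    (* If [i] were dropped, [w] would be a product of letters of [c], which omits [i], and [al i]
       could not be an inversion. *)
    inversion cs as [|j c' w' cs' e1 e2|j c' w' cs' ni [e1 e2] e3].
      have [v vc ew] := csort_word cs'; case: (@inv_notin i v); last by rewrite -ew.
      by apply/negP => /vc; rewrite mem_filter (negPf ic) andbF.
    by rewrite scomp_invol.
  rewrite size_rcons => bd Ju; rewrite /= Ji; split=> // -[//|q].
  by rewrite !inE /= addSn !mem_map_succ; apply: bd.
- move=> uc; have uc' : uniq (rcons c i) by rewrite rcons_uniq.
  have ic : i \notin c by case/andP: uc.
  have [u0 eu0] : exists u0, w = wp u0 by have [<- _] := greedy_word g; exists u.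
  have e := filter_predI_predC1 J ic.
  move=> cs; have cs' : csort (filter J c) w.
    move: cs; rewrite /=; case: (J i) => // cs.
    inversion cs as [|j c' w' cs' e1 e2|j c' w' cs' ni' [e1 e2] e3] => //.
    case: ni; rewrite -e3; have [v _ ev] := csort_word cs'.
    by move: ni'; rewrite ev; apply: (inv_s_self i v).2.
  have [] := IH (predI J (predC1 i)) uc'; first by rewrite e.
  rewrite size_rcons => bd Ju; split; last first.
    by apply: sub_all Ju => j /andP[].
  case=> [|q]; rewrite ?addSn ?mem_map_succ; last exact: bd.
  (* Position [size c] of the rotated word carries the letter [i], which [u] avoids. *)
  move=> cp; exfalso; rewrite -[X in X \in p]/(size c) in cp.
  have [_ ee] := greedy_embedding g.
  have : cinf (rcons c i) (size c) \in [seq Some j | j <- u] by rewrite -ee map_f.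
  rewrite /cinf size_rcons modn_small // -cats1 onth_cat ltnn subnn /=.
  by case/mapP => j ju [ej]; have := allP Ju _ ju; rewrite /= ej eqxx andbF.
Qed.

Lemma block_subsetP (c : seq 'I_n) p : uniq c ->
  (forall k, block c p k.+1 \subset block c p k) <-> block_decreasing (size c) p.
Proof.
move=> uc; have [c0|c0] := posnP (size c).
  split=> [_ q|_ k]; first by rewrite c0 addn0.
  apply/subsetP => i; rewrite inE => /hasP[q _ /andP[_ /eqP]].
  by rewrite (size0nil c0) /cinf onth0n.
split=> [h q qp|bd k].
  have [i ci] := cinf_some (q + size c)%N c0.
  have : i \in block c p (q %/ size c).+1.
    by rewrite inE; apply/hasP; exists (q + size c)%N => //; rewrite divnDr // divnn c0 addn1 ci !eqxx.
  move/(subsetP (h _)); rewrite inE => /hasP[q' q'p /andP[/eqP e /eqP ci']].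
  suff -> : q = q' by [].
  rewrite (divn_eq q (size c)) (divn_eq q' (size c)) e (cinf_index uc ci').
  by rewrite -(cinf_index uc ci) modnDr.
apply/subsetP => i; rewrite !inE => /hasP[q qp /andP[/eqP e /eqP ci]].
have qc : (size c <= q)%N by rewrite leqNgt; apply/negP => /divn_small; rewrite e.
apply/hasP; exists (q - size c)%N; first by apply: bd; rewrite subnK.
apply/andP; split; first by rewrite -eqSS -e -{2}(subnK qc) divnDr ?divnn ?c0 ?addn1.
by rewrite -ci /cinf -{2}(subnK qc) modnDr.
Qed.

Lemma sortableE c w : coxeter_word c -> sortable Phi c w <-> csort c w.
Proof.
move=> cx; have uc : uniq c by rewrite (perm_uniq cx) enum_uniq.
have call i : i \in c by rewrite (perm_mem cx) mem_enum.
have fT : filter predT c = c by apply: filter_predT.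
split=> [[_ [u [p [su bl]]]]|cs].
  have [v [q g]] : exists v q, greedy c w v q.
    by case: (su) => -[<- _] _ _; apply: greedy_exists.
  have [eu ep] := sorting_word_inj su (greedy_sorting g); rewrite -eu -ep in g.
  rewrite -fT; apply: (greedy_csort g uc); last by rewrite all_predT.
  by apply/block_subsetP.
have [u0 _ ew] := csort_word cs; split.
  exists (map (tnth (simple_roots Phi)) u0).
    by move=> _ /mapP[i _ ->]; apply: alr.
  by rewrite ew; elim: u0 {ew} => //= i u0 ->.
have [u [p g]] : exists u p, greedy c w u p by rewrite ew; apply: greedy_exists.
exists u, p; split; first exact: greedy_sorting g.
by apply/block_subsetP => //; have [] := @csort_greedy _ _ _ _ predT g uc; rewrite ?fT.
Qed.

Lemma inv_csort_refl i c w a : csort (rcons c i) w -> ~ inv w (al i) -> pos a ->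
  (inv (s i \o w)%VF a <-> a = al i \/ a != al i /\ inv w (s i a)).
Proof.
move=> /csort_word[u _ ->] ni pa; rewrite -[(_ \o _)%VF]/(wp (i :: u)).
have [->|ai] := eqVneq a (al i).
  by split=> _; [left | apply: (inv_s_self i u).2].
by rewrite (inv_s_other u pa ai); split=> [|[|[]]] //; [right | move/eqP: ai].
Qed.

End Roots.
Import VectorInternalTheory.

(** * Linear algebra *)

Section LinearAlgebra.
Variable K : fieldType.

Section Quotient.
Variables (V : vectType K) (U : {vspace V}).

(** The quotient by [U] is realized on a complement of [U], so that it is again a [vectType];
    [quo_lift] is a section of the projection. *)
Definition quo_space : vectType K := subvs_of (U^C)%VS.

Definition quo_proj : 'Hom(V, quo_space) :=
  (linfun (vsproj (U^C)%VS) \o daddv_pi (U^C) U)%VF.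

Definition quo_lift : 'Hom(quo_space, V) := linfun (vsval : quo_space -> V).

Lemma capC : (U^C :&: U)%VS = 0%VS.
Proof. by rewrite capvC; apply: capv_compl. Qed.

Lemma quo_liftK w : quo_proj (quo_lift w) = w.
Proof.
rewrite /quo_proj /quo_lift comp_lfunE !lfunE /= daddv_pi_id ?capC ?subvsP //.
exact: vsvalK.
Qed.

Lemma quo_proj_eq0 v : quo_proj v = 0 <-> v \in U.
Proof.
have e : v = daddv_pi (U^C) U v + daddv_pi U (U^C) v.
  rewrite daddv_pi_add ?capC //.
  by rewrite addvC addv_complf memvf.
have q : quo_proj v = vsproj (U^C)%VS (daddv_pi (U^C) U v).
  by rewrite /quo_proj comp_lfunE lfunE.
split=> [|vU].
  rewrite q => /(congr1 val)/=; rewrite vsprojK ?memv_pi // => z.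
  by rewrite e z add0r memv_pi.
rewrite q; suff -> : daddv_pi (U^C) U v = 0 by rewrite linear0.
apply/eqP; rewrite -memv0 -capC memv_cap memv_pi /=.
by rewrite -(addrK (daddv_pi U (U^C) v) (daddv_pi _ _ _)) -e memvB ?memv_pi.
Qed.

End Quotient.
#[local] Opaque quo_proj quo_lift.

Lemma functional (V : vectType K) (U : {vspace V}) (v : V) : v \notin U ->
  exists f : 'Hom(V, K^o), f v = 1 /\ forall u, u \in U -> f u = 0.
Proof.
move=> vU; have qv : quo_proj U v != 0.
  by apply: contraNneq vU => /quo_proj_eq0.
set q := quo_proj U v in qv *.
have [k qk] : exists k, v2r q 0 k != 0.
  apply: contrapT => h; move/eqP: qv; apply; apply: (can_inj v2rK).
  apply/rowP => k; rewrite linear0 mxE; apply/eqP; apply: contrapT => nk.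
  by apply: h; exists k; apply/negP.
have lf : linear (fun u : V => (v2r q 0 k)^-1 * v2r (quo_proj U u) 0 k : K^o).
  move=> a x y; rewrite linearP linearP !mxE mulrDr; congr (_ + _).
  by rewrite mulrCA.
exists (linfun (fun u : V => (v2r q 0 k)^-1 * v2r (quo_proj U u) 0 k : K^o)).
split=> [|u /quo_proj_eq0 e]; rewrite linfun_linearE //; first by rewrite mulVf.
by rewrite e linear0 mxE mulr0.
Qed.

Section DirectSum.
Variables (X : finType) (S : X -> vectType K).

(** The direct sum, held as one family of coordinates in K because the summands have different
    types; [dmk] and [dco] translate to and from tuples of vectors. *)
Definition dsum : vectType K := {ffun {x : X & 'I_(dim (S x))} -> K^o}.

Definition dmk (t : forall x, S x) : dsum := [ffun y => v2r (t (tag y)) 0 (tagged y)].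

Definition dco (x : X) (p : dsum) : S x := r2v (\row_k p (Tagged _ k)).

Lemma dmkK t x : dco x (dmk t) = t x.
Proof.
rewrite /dco -[RHS]v2rK; congr r2v; apply/rowP => k.
by rewrite mxE ffunE.
Qed.

Lemma dcoK p : dmk (fun x => dco x p) = p.
Proof. by apply/ffunP => -[x k]; rewrite ffunE /= r2vK mxE. Qed.

Lemma dsum_eq p q : (forall x, dco x p = dco x q) -> p = q.
Proof. by move=> e; rewrite -[p]dcoK -[q]dcoK; apply/ffunP => y; rewrite !ffunE e. Qed.

Fact dco_linear x : linear (dco x).
Proof.
move=> a p q; rewrite /dco -linearP; congr r2v; apply/rowP => k.
by rewrite !mxE !ffunE.
Qed.
HB.instance Definition _ x := GRing.isLinear.Build K dsum (S x) *:%R (dco x) (dco_linear x).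

Lemma dim_dsum : \dim {:dsum} = (\sum_x \dim {:S x})%N.
Proof.
rewrite dimvf /dim /= card_tagged sumnE big_map big_enum /= muln1.
by apply: eq_bigr => x _; rewrite card_ord dimvf.
Qed.

End DirectSum.

Lemma lfun_inj (U V : vectType K) (f : 'Hom(U, V)) x y :
  (forall u, f u = 0 -> u = 0) -> f x = f y -> x = y.
Proof. by move=> fI; apply: raddf_inj. Qed.

Lemma dim_eq0 (V : vectType K) : (forall v : V, v = 0) -> \dim {:V} = 0%N.
Proof.
move=> V0; apply/eqP; rewrite dimv_eq0; apply/eqP/vspaceP => v.
by rewrite memvf [v]V0 mem0v.
Qed.

Lemma exact_dim (U V W : vectType K) (f : 'Hom(U, V)) (g : 'Hom(V, W)) :
  (forall u, f u = 0 -> u = 0) -> (forall w, exists v, g v = w) ->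
  (forall v, g v = 0 <-> exists u, f u = v) ->
  \dim {:V} = (\dim {:U} + \dim {:W})%N.
Proof.
move=> fi gs ex; rewrite -(limg_ker_dim g fullv) capfv; congr (_ + _)%N.
  have -> : lker g = limg f.
    apply/vspaceP => v; apply/idP/idP; rewrite memv_ker.
      by move=> /eqP/ex[u <-]; apply: memv_img; apply: memvf.
    by move=> /memv_imgP[u _ ->]; apply/eqP/ex; exists u.
  apply: limg_dim_eq; apply/eqP; rewrite -subv0; apply/subvP => u.
  by rewrite memv_cap memv_ker memv0 => /andP[_ /eqP/fi->].
congr (\dim _); apply/vspaceP => w; rewrite memvf.
by have [v <-] := gs w; rewrite memv_img ?memvf.
Qed.

Lemma bij_dim (U V : vectType K) (f : 'Hom(U, V)) :
  (forall u, f u = 0 -> u = 0) -> (forall w, exists v, f v = w) ->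
  \dim {:U} = \dim {:V}.
Proof.
move=> fi fs; rewrite -(limg_ker_dim f fullv) capfv.
have -> : lker f = 0%VS.
  apply/eqP; rewrite -subv0; apply/subvP => u.
  by rewrite memv_ker memv0 => /eqP/fi->.
rewrite dimv0 add0n; congr (\dim _); apply/vspaceP => w; rewrite memvf.
by have [v <-] := fs w; rewrite memv_img ?memvf.
Qed.

End LinearAlgebra.

#[global] Opaque quo_proj quo_lift dmk dco.

(** * Powers of an endomorphism, nilpotency *)

Section Powers.
Variable K : fieldType.

Definition lpow (V : vectType K) (f : 'End(V)) k : 'End(V) :=
  iter k (comp_lfun f) \1%VF.

Section Theory.
Variables (V : vectType K) (f : 'End(V)).

Lemma lpow0 v : lpow f 0 v = v. Proof. exact: id_lfunE. Qed.

Lemma lpowS k v : lpow f k.+1 v = f (lpow f k v). Proof. exact: comp_lfunE. Qed.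

Lemma lpowSr k v : lpow f k.+1 v = lpow f k (f v).
Proof. by elim: k => [|k IH]; rewrite ?lpowS ?lpow0 // -IH lpowS. Qed.

Lemma lpowD k l v : lpow f (k + l) v = lpow f k (lpow f l v).
Proof. by elim: k => [|k IH]; rewrite ?lpow0 // addSn !lpowS IH. Qed.

Lemma nilpotent_ker d : (forall v, lpow f d v = 0) -> (exists v : V, v != 0) ->
  exists2 v, v != 0 & f v = 0.
Proof.
elim: d => [|d IH] nf ex; first by have [v] := ex; have := nf v; rewrite lpow0 => ->; rewrite eqxx.
have [nd|] := pselect (forall v, lpow f d v = 0); first exact: IH.
move=> /existsNP[v /eqP nv]; exists (lpow f d v) => //.
by rewrite -lpowS nf.
Qed.

Lemma nilpotent_coker d : (forall v, lpow f d v = 0) -> (exists v : V, v != 0) ->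
  exists v, v \notin limg f.
Proof.
move=> nf [w w0]; apply: contrapT => h.
have fs v : exists u, f u = v.
  have : v \in limg f by apply: contrapT => /negP nv; apply: h; exists v.
  by move=> /memv_imgP[u _ ->]; exists u.
suff [v e] : exists v, lpow f d v = w by rewrite -e nf eqxx in w0.
elim: d {nf} => [|d [v <-]]; first by exists w; rewrite lpow0.
by have [u <-] := fs v; exists u; rewrite lpowSr.
Qed.

End Theory.

Lemma lpow_comm (V W : vectType K) (f : 'End(V)) (g : 'End(W)) (h : 'Hom(V, W)) k v :
  (forall u, h (f u) = g (h u)) -> h (lpow f k v) = lpow g k (h v).
Proof. by move=> e; elim: k => [|k IH]; rewrite ?lpow0 // !lpowS e IH. Qed.

End Powers.

#[global] Opaque lpow.

Section LinearFactor.
Variables (K : fieldType) (U V W : vectType K).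

(** [g^-1] picks preimages on the image of [g], so this is the map that [h] induces there when it
    vanishes on the kernel of [g]. *)
Definition lfactor (g : 'Hom(U, V)) (h : 'Hom(U, W)) : 'Hom(V, W) := (h \o g^-1)%VF.

Lemma lfactorE (g : 'Hom(U, V)) (h : 'Hom(U, W)) u :
  (forall u, g u = 0 -> h u = 0) -> lfactor g h (g u) = h u.
Proof.
move=> gh; rewrite comp_lfunE; apply/eqP; rewrite -subr_eq0 -linearB; apply/eqP.
by apply: gh; rewrite linearB /= limg_lfunVK ?subrr // memv_img ?memvf.
Qed.

Definition llift (g : 'Hom(V, W)) (h : 'Hom(U, W)) : 'Hom(U, V) := (g^-1 \o h)%VF.

Lemma lliftE (g : 'Hom(V, W)) (h : 'Hom(U, W)) u :
  (exists v, g v = h u) -> g (llift g h u) = h u.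
Proof.
by case=> v e; rewrite comp_lfunE limg_lfunVK // -e memv_img ?memvf.
Qed.

End LinearFactor.

#[global] Opaque lfactor llift.

Section Override.
Variables (K : fieldType) (n : nat) (i : 'I_n) (C : vectType K) (S : 'I_n -> vectType K).

(** The family [S] with the space at [i] replaced by [C]. The four maps below are identities where
    the types agree and 0 elsewhere; through them, proofs avoid transport along an equality of
    types. *)
Definition ovr j : vectType K := if j == i then C else S j.

Definition ovr_in j : 'Hom(S j, ovr j) :=
  match j == i as b return 'Hom(S j, if b then C else S j) with
  | true => 0 | false => \1%VF end.
Definition ovr_out j : 'Hom(ovr j, S j) :=
  match j == i as b return 'Hom(if b then C else S j, S j) with
  | true => 0 | false => \1%VF end.
Definition ovr_put j : 'Hom(C, ovr j) :=
  match j == i as b return 'Hom(C, if b then C else S j) with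
  | true => \1%VF | false => 0 end.
Definition ovr_get j : 'Hom(ovr j, C) :=
  match j == i as b return 'Hom(if b then C else S j, C) with
  | true => \1%VF | false => 0 end.

Lemma ovr_inK j v : j != i -> ovr_out j (ovr_in j v) = v.
Proof. by rewrite /ovr_out /ovr_in /ovr; case: (j == i) => // _; rewrite !id_lfunE. Qed.

Lemma ovr_outK j v : j != i -> ovr_in j (ovr_out j v) = v.
Proof.
by move: v; rewrite /ovr_out /ovr_in /ovr; case: (j == i) => // v _; rewrite !id_lfunE.
Qed.

Lemma ovr_in0 v : ovr_in i v = 0.
Proof.
have := eqxx i; rewrite /ovr_in /ovr; case: (i == i) => // _.
by rewrite zero_lfunE.
Qed.

Lemma ovr_out0 v : ovr_out i v = 0.
Proof.
have := eqxx i; move: v; rewrite /ovr_out /ovr; case: (i == i) => // v _.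
by rewrite zero_lfunE.
Qed.

Lemma ovr_put0 j v : j != i -> ovr_put j v = 0.
Proof. by rewrite /ovr_put /ovr; case: (j == i) => // _; rewrite zero_lfunE. Qed.

Lemma ovr_get0 j v : j != i -> ovr_get j v = 0.
Proof.
by move: v; rewrite /ovr_get /ovr; case: (j == i) => // v _; rewrite zero_lfunE.
Qed.

Lemma ovr_putK v : ovr_get i (ovr_put i v) = v.
Proof.
have := eqxx i; rewrite /ovr_get /ovr_put /ovr; case: (i == i) => // _.
by rewrite !id_lfunE.
Qed.

Lemma ovr_getK v : ovr_put i (ovr_get i v) = v.
Proof.
have := eqxx i; move: v; rewrite /ovr_get /ovr_put /ovr; case: (i == i) => // v _.
by rewrite !id_lfunE.
Qed.

End Override.

#[global] Opaque ovr ovr_in ovr_out ovr_put ovr_get.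

Local Notation "S ~> T" := (forall j, 'Hom(S j, T j)) (at level 70) : type_scope.

Lemma at_vertex (K : fieldType) (n : nat) (i : 'I_n) (S S' : 'I_n -> vectType K)
    (f : 'Hom(S i, S' i)) :
  exists h : S ~> S',
    (forall v, h i v = f v) /\ forall j v, j != i -> h j v = 0.
Proof.
pose h j : 'Hom(S j, S' j) := match eqVneq i j with
  | EqNotNeq e => match e in _ = k return 'Hom(S k, S' k) with erefl => f end
  | NeqNotEq _ => 0 end.
exists h; rewrite /h; split=> [v|j v ji]; case: eqVneq => [e|] //.
- by rewrite (eq_irrelevance e erefl).
- by rewrite eqxx.
- by rewrite -e eqxx in ji.
- by rewrite zero_lfunE.
Qed.

(** * Representations and their torsion classes *)

(** Every pair of vertices carries a map, made 0 by [rep_arr] where the word has no arrow.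
    Representations for a word, for its rotation and for a shorter word thus share one type. *)
Record rep (K : fieldType) (n : nat) := Rep {
  sp :> 'I_n -> vectType K;
  eps : forall i, 'End(sp i);
  arr : forall i j, 'Hom(sp i, sp j)
}.
Arguments eps {K n} M i : rename.
Arguments arr {K n} M i j : rename.

Section Reps.
Variables (K : fieldType) (n : nat).
Implicit Types M N L P : rep K n.

Definition is_hom M N (h : M ~> N) :=
  (forall j v, h j (eps M j v) = eps N j (h j v)) /\
  (forall j k v, h k (arr M j k v) = arr N j k (h j v)).

Definition hinj M N (h : M ~> N) := forall j v, h j v = 0 -> v = 0.
Definition hsurj M N (h : M ~> N) := forall j w, exists v, h j v = w.
Definition hexact L M N (f : L ~> M) (g : M ~> N) :=
  forall j v, g j v = 0 <-> exists u, f j u = v.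

Definition stable M (U : forall j, {vspace M j}) :=
  (forall j v, v \in U j -> eps M j v \in U j) /\
  (forall j k v, v \in U j -> arr M j k v \in U k).

Variables (A : 'I_n -> 'I_n -> nat) (d : 'I_n -> nat).

Definition arrow_at (c : seq 'I_n) j k :=
  [&& j \in c, k \in c, (index j c < index k c)%N & A j k != 0%N].

(** The word may omit vertices. These carry the zero space, so dropping a letter selects the
    representations that vanish at it. *)
Record is_rep (c : seq 'I_n) M : Prop := IsRep {
  rep_nil : forall i v, lpow (eps M i) (d i) v = 0;
  rep_rel : forall j k v, arr M j k (lpow (eps M j) (A k j) v) =
    lpow (eps M k) (A j k) (arr M j k v);
  rep_arr : forall j k v, ~~ arrow_at c j k -> arr M j k v = 0;
  rep_supp : forall j (v : M j), j \notin c -> v = 0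
}.

Lemma hom_pow M N (h : M ~> N) j k v : is_hom h ->
  h j (lpow (eps M j) k v) = lpow (eps N j) k (h j v).
Proof. by case=> e _; apply: lpow_comm. Qed.

Lemma hom_id M : is_hom (fun j => \1%VF : 'Hom(M j, M j)).
Proof. by split=> *; rewrite !id_lfunE. Qed.

Lemma stable_limg M N (h : M ~> N) :
  is_hom h -> stable (fun j => limg (h j)).
Proof.
by move=> hh; split=> [j v|j k v] /memv_imgP[u _ ->];
  rewrite -?hh.1 -?hh.2 memv_img ?memvf.
Qed.

Lemma subrep_ex c M (U : forall j, {vspace M j}) : is_rep c M -> stable U ->
  exists L (f : L ~> M), [/\ is_rep c L, is_hom f, hinj f &
    forall j v, v \in U j <-> exists x, f j x = v].
Proof.
move=> rM [s1 s2]; pose L0 j : vectType K := subvs_of (U j).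
pose f j : 'Hom(L0 j, M j) := linfun (vsval : L0 j -> M j).
pose g j : 'Hom(M j, L0 j) := linfun (vsproj (U j) : M j -> L0 j).
pose L := @Rep K n L0 (fun j => g j \o eps M j \o f j)%VF
  (fun j k => g k \o arr M j k \o f j)%VF.
have fE j (x : L j) : f j x \in U j by rewrite lfunE subvsP.
have fgK j v : v \in U j -> f j (g j v) = v by move=> vU; rewrite !lfunE /= vsprojK.
have fI j (x : L j) : f j x = 0 -> x = 0.
  by rewrite lfunE => e; apply: val_inj; rewrite e.
have fI2 j (x y : L j) : f j x = f j y -> x = y.
  by apply: lfun_inj => z; apply: fI.
have hf : is_hom (f : L ~> M).
  by split=> [j x|j k x] /=; rewrite !comp_lfunE fgK //; [apply: s1|apply: s2]; apply: fE.
exists L, f; split=> //; last first.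
  move=> j v; split=> [vU|[x <-]]; last exact: fE.
  by exists (g j v); rewrite fgK.
split=> [j x|j k x|j k x na|j x jc].
- by apply: fI; rewrite (hom_pow _ _ hf) (rep_nil rM).
- by apply: fI2; rewrite hf.2 !(hom_pow _ _ hf) hf.2 (rep_rel rM).
- by apply: fI; rewrite hf.2 (rep_arr rM).
- by apply: fI; apply: (rep_supp rM).
Qed.

Lemma quorep_ex c M (U : forall j, {vspace M j}) : is_rep c M -> stable U ->
  exists N (g : M ~> N), [/\ is_rep c N, is_hom g, hsurj g &
    forall j v, g j v = 0 <-> v \in U j].
Proof.
move=> rM [s1 s2].
have [N0 [g [f [gf gU]]]] : exists (N0 : 'I_n -> vectType K)
    (g : M ~> N0) (f : N0 ~> M),
    (forall j x, g j (f j x) = x) /\ (forall j v, g j v = 0 <-> v \in U j).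
  exists (fun j => quo_space (U j)), (fun j => quo_proj (U j)), (fun j => quo_lift (U j)).
  by split=> [j x|j v]; [apply: quo_liftK | apply: quo_proj_eq0].
pose N := @Rep K n N0 (fun j => g j \o eps M j \o f j)%VF
  (fun j k => g k \o arr M j k \o f j)%VF.
have fgU j v : f j (g j v) - v \in U j by apply/gU; rewrite linearB /= gf subrr.
have eqg j u v : u - v \in U j -> g j u = g j v.
  by move=> /gU; rewrite linearB => /eqP; rewrite subr_eq0 => /eqP.
have hg : is_hom (g : M ~> N).
  split=> [j x|j k x] /=; rewrite !comp_lfunE; apply: eqg; rewrite -linearB.
    by apply: s1; rewrite -opprB memvN; apply: fgU.
  by apply: s2; rewrite -opprB memvN; apply: fgU.
have gs : hsurj (g : M ~> N) by move=> j x; exists (f j x).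
exists N, g; split=> //.
split=> [j x|j k x|j k x na|j x jc]; have [v <-] := gs j x.
- by rewrite -(hom_pow _ _ hg) (rep_nil rM) linear0.
- by rewrite -!(hom_pow _ _ hg) -!hg.2 -(hom_pow _ _ hg) (rep_rel rM).
- by rewrite -hg.2 (rep_arr rM) ?linear0.
- by rewrite (rep_supp rM v jc) linear0.
Qed.

Record tcl (c : seq 'I_n) (T : rep K n -> Prop) : Prop := Tcl {
  tcl_rep : forall M, T M -> is_rep c M;
  tcl_zero : forall M, is_rep c M -> (forall j (v : M j), v = 0) -> T M;
  tcl_quot : forall M N (h : M ~> N),
    T M -> is_rep c N -> is_hom h -> hsurj h -> T N;
  tcl_ext : forall L M N (f : L ~> M) (g : M ~> N),
    is_rep c M -> is_hom f -> is_hom g -> hinj f -> hsurj g -> hexact f g ->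
    T L -> T N -> T M
}.

(** Replacing [L] by the image of [f], which is a quotient of [L], turns a right exact sequence into
    a short exact one. *)
Lemma tcl_ext_weak c T L M N (f : L ~> M) (g : M ~> N) :
  tcl c T -> is_rep c M -> is_hom f -> is_hom g -> hsurj g -> hexact f g ->
  T L -> T N -> T M.
Proof.
move=> tT rM hf hg gs ex TL TN.
have [I [i [rI hi ii ei]]] := subrep_ex rM (stable_limg hf).
have fi j x : exists v, i j v = f j x by apply/ei; rewrite memv_img ?memvf.
pose p j : 'Hom(L j, I j) := llift (i j) (f j).
have ip j x : i j (p j x) = f j x by apply: lliftE.
have iinj j x y : i j x = i j y -> x = y.
  by apply: lfun_inj => z; apply: ii.
apply: (tcl_ext tT rM hi hg ii gs _ _ TN).
  move=> j v; split=> [/ex[u <-]|[u <-]]; first exact: fi.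
  have : i j u \in limg (f j) by apply/ei; exists u.
  by move=> /memv_imgP[x _ ->]; apply/ex; exists x.
apply: (tcl_quot (h := p) tT TL rI).
  by split=> [j v|j k v]; apply: iinj; rewrite ?hi.1 ?hi.2 !ip ?hf.1 ?hf.2.
move=> j w; have : i j w \in limg (f j) by apply/ei; exists w.
by move=> /memv_imgP[x _ e]; exists x; apply: iinj; rewrite ip.
Qed.

Definition conc i M := forall j (v : M j), j != i -> v = 0.

(** Induction on the dimension of [Y i]: some map from [X] has as image a line that is a
    subrepresentation of [Y], and the quotient by this line is smaller and again concentrated at
    [i]. *)
Lemma tcl_conc c T i X Y : tcl c T -> T X -> conc i X -> (exists x : X i, x != 0) ->
  is_rep c Y -> conc i Y -> T Y.
Proof.
move=> tT TX cX X0; have rX := tcl_rep tT TX.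
(* [l] vanishes on the image of the loop of [X], and [y] below is killed by the loop of [Y], so
   [v |-> l v *: y] commutes with the loops. *)
have [x0 /functional[l [l1 l0]]] := nilpotent_coker (fun v : X i => rep_nil rX v) X0.
have [m] := ubnP (\dim {:Y i}); elim: m Y => // m IH Y dm rY cY.
have [Y0|] := pselect (forall v : Y i, v = 0).
  apply: (tcl_zero tT rY) => j v; have [e|ji] := eqVneq j i; last exact: cY.
  by move: v; rewrite e.
move=> /existsNP[y' /eqP y'0].
have [y y0 ye] : exists2 y, y != 0 & eps Y i y = 0.
  by apply: (nilpotent_ker (fun v => rep_nil rY v)); exists y'.
have aY j k v : arr Y j k v = 0.
  have [ji|ji] := eqVneq j i; last by rewrite (cY _ v ji) linear0.
  have [ki|ki] := eqVneq k i; last exact: cY.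
  move: v; rewrite ji ki => v.
  by rewrite (rep_arr rY) // /arrow_at ltnn !andbF.
have aX j k v : arr X j k v = 0.
  have [ji|ji] := eqVneq j i; last by rewrite (cX _ v ji) linear0.
  have [ki|ki] := eqVneq k i; last exact: cX.
  move: v; rewrite ji ki => v.
  by rewrite (rep_arr rX) // /arrow_at ltnn !andbF.
have [h [hi h0]] := @at_vertex K n i X Y (linfun (fun v => l v *: y)).
have {}hi v : h i v = l v *: y.
  rewrite hi linfun_linearE // => a u w.
  by rewrite linearP scalerDl scalerA.
have hh : is_hom h.
  split=> [j v|j k v]; last by rewrite aX aY linear0.
  have [ji|ji] := eqVneq j i; last by rewrite (cX _ v ji) !linear0.
  move: v; rewrite ji => v; rewrite !hi linearZ /= ye scaler0 l0 ?scale0r //.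
  by rewrite memv_img ?memvf.
have [N [g [rN hg gs gU]]] := quorep_ex rY (stable_limg hh).
have cN : conc i N by move=> j w ji; have [v <-] := gs j w; rewrite (cY _ v ji) linear0.
have ex : hexact h g.
  move=> j v; split=> [/gU/memv_imgP[u _ ->]|[u <-]]; first by exists u.
  by apply/gU; rewrite memv_img ?memvf.
apply: (tcl_ext_weak tT rY hh hg gs ex TX); apply: IH => //.
have dY : (\dim (lker (g i)) + \dim {:N i} = \dim {:Y i})%N.
  rewrite -(limg_ker_dim (g i) fullv) capfv; congr (_ + \dim _)%N.
  by apply/vspaceP => w; rewrite memvf; have [v <-] := gs i w; rewrite memv_img ?memvf.
suff : (0 < \dim (lker (g i)))%N by lia.
rewrite lt0n dimv_eq0; apply: contraNneq y0 => k0.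
rewrite -memv0 -k0 memv_ker; apply/eqP/gU/memv_imgP; exists x0; rewrite ?memvf //.
by rewrite hi l1 scale1r.
Qed.

End Reps.

(** * Local freeness, rigidity and rank vectors *)

Section Free.
Variables (K : fieldType) (V : vectType K) (f : 'End(V)) (D : nat).

(* Freeness over [K[x]/(x^D)], for [x] acting by [f]. *)
Definition free_over := forall v, f v = 0 -> exists u, v = lpow f D.-1 u.

Hypotheses (D0 : (0 < D)%N) (nf : forall v, lpow f D v = 0) (ff : free_over).

(** The inclusion of ker x in im x^(D-1) spreads to ker x^l in im x^(D-l): a preimage obtained for
    [f v] is corrected by a vector that [f] kills. *)
Lemma free_ker l v : (l <= D)%N -> lpow f l v = 0 -> exists u, v = lpow f (D - l) u.
Proof.
elim: l v => [|l IH] v lD; first by rewrite lpow0 => ->; exists 0; rewrite linear0.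
rewrite lpowSr => /(IH _ (ltnW lD))[u eu].
have e : (D - l = (D - l.+1).+1)%N by lia.
have /ff[w ew] : f (v - lpow f (D - l.+1) u) = 0.
  by rewrite linearB /= -lpowS -e -eu subrr.
exists (u + lpow f l w); rewrite linearD /= -lpowD.
have -> : (D - l.+1 + l = D.-1)%N by lia.
by rewrite -ew addrC subrK.
Qed.

Lemma free_im v : lpow f D.-1 v = 0 -> exists u, v = f u.
Proof.
move=> /free_ker[|u ->]; first exact: leq_pred.
have -> : (D - D.-1 = 1)%N by lia.
by exists u; rewrite lpowS lpow0.
Qed.

End Free.

Section Rigid.
Variables (K : fieldType) (n : nat) (A : 'I_n -> 'I_n -> nat) (d : 'I_n -> nat).
Implicit Types M N L : rep K n.

Definition locfree M := forall j, free_over (eps M j) (d j).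

(** Ext^1(M, M) = 0, expressed by the splitting of exact sequences because reflection transports
    those directly. *)
Definition rigid c M := forall (E : rep K n) (f : M ~> E) (g : E ~> M),
  is_rep A d c E -> is_hom f -> is_hom g -> hinj f -> hsurj g -> hexact f g ->
  exists s : M ~> E, is_hom s /\ forall j v, g j (s j v) = v.

Definition has_rank M (m : 'I_n -> nat) := forall j, \dim {:M j} = (d j * m j)%N.

(** [B] twists the arrows on the sum of two copies of [M] into a self-extension with unchanged
    loops; the first component of a splitting exhibits [B] as a coboundary. *)
Lemma rigid_coboundary c M (B : forall j k, 'Hom(M j, M k)) : is_rep A d c M -> rigid c M ->
  (forall j k v, ~~ arrow_at A c j k -> B j k v = 0) ->
  (forall j k v, B j k (lpow (eps M j) (A k j) v) = lpow (eps M k) (A j k) (B j k v)) ->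
  exists h : M ~> M, (forall j v, h j (eps M j v) = eps M j (h j v)) /\
    forall j k v, B j k v = h k (arr M j k v) - arr M j k (h j v).
Proof.
move=> rM gM B0 Br; pose E0 j : vectType K := (M j * M j)%type.
have pairl (U W X : vectType K) (p : 'Hom(U, W)) (q : 'Hom(U, X)) :
    linear (fun u => (p u, q u) : (W * X)%type).
  by move=> u x y; rewrite !linearP.
pose e0 j : 'End(E0 j) := linfun (fun x => (eps M j x.1, eps M j x.2) : E0 j).
pose a0 j k : 'Hom(E0 j, E0 k) :=
  linfun (fun x => (arr M j k x.1 + B j k x.2, arr M j k x.2) : E0 k).
have e0E j x : e0 j x = (eps M j x.1, eps M j x.2).
  apply: linfun_linearE => u [x1 x2] [y1 y2].
  by rewrite -[LHS]/(eps M j (u *: x1 + y1), eps M j (u *: x2 + y2)) !linearP.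
have a0E j k x : a0 j k x = (arr M j k x.1 + B j k x.2, arr M j k x.2).
  apply: linfun_linearE => u [x1 x2] [y1 y2].
  rewrite -[LHS]/(arr M j k (u *: x1 + y1) + B j k (u *: x2 + y2), arr M j k (u *: x2 + y2)).
  by rewrite !linearP addrACA -scalerDr.
pose E := @Rep K n E0 e0 a0.
have powE j k x : lpow (eps E j) k x = (lpow (eps M j) k x.1, lpow (eps M j) k x.2).
  by elim: k => [|k IH]; rewrite ?lpow0 ?lpowS; [case: x | rewrite IH e0E].
have rE : is_rep A d c E.
  split=> [j x|j k x|j k x na|j x jc].
  - by rewrite powE !(rep_nil rM).
  - by rewrite !powE !a0E /= !linearD /= !(rep_rel rM) Br.
  - by rewrite a0E !(rep_arr rM) // B0 // addr0.
  - by case: x => x1 x2; rewrite (rep_supp rM x1 jc) (rep_supp rM x2 jc).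
pose f j : 'Hom(M j, E j) := linfun (fun v => (v, 0) : E0 j).
pose g j : 'Hom(E j, M j) := linfun (fun x : E0 j => x.2).
have fE j v : f j v = (v, 0).
  apply: linfun_linearE => u x y.
  by rewrite -[RHS]/(u *: x + y, u *: 0 + 0) scaler0 addr0.
have gE j x : g j x = x.2 by apply: linfun_linearE => u [x1 x2] [y1 y2].
have [|||||s [hs gs]] := gM E f g rE.
- split=> [j v|j k v]; rewrite !fE ?e0E ?a0E /= ?linear0 ?addr0 //.
- by split=> [j v|j k v]; rewrite !gE ?e0E ?a0E.
- by move=> j v; rewrite fE => -[].
- by move=> j v; exists (0, v); rewrite gE.
- move=> j [v1 v2]; rewrite gE /=; split=> [->|[u]]; first by exists v1; rewrite fE.
  by rewrite fE => -[_ <-].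
have fstl j : linear (fun v => (s j v : E0 j).1) by move=> u x y; rewrite linearP.
exists (fun j => linfun (fun v => (s j v : E0 j).1)).
have gs2 j v : (s j v : E0 j).2 = v by rewrite -gE gs.
split=> [j v|j k v]; rewrite !(linfun_linearE (fstl _)); first by rewrite hs.1 e0E.
by rewrite hs.2 a0E /= gs2 // [X in X - _]addrC addrK.
Qed.

End Rigid.

Section Delta.
Variables (K : fieldType) (n : nat) (S : 'I_n -> vectType K).

(** A Kronecker delta for a family of spaces, used in place of transports along [i = j]. *)
Definition dlt (i j : 'I_n) : 'Hom(S i, S j) := match eqVneq i j with
  | EqNotNeq e => match e in _ = k return 'Hom(S i, S k) with erefl => \1%VF end
  | NeqNotEq _ => 0 end.

Lemma dlt_id i v : dlt i i v = v.
Proof.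
rewrite /dlt; case: eqVneq => [e|]; last by rewrite eqxx.
by rewrite (eq_irrelevance e erefl) id_lfunE.
Qed.

Lemma dlt_neq i j v : i != j -> dlt i j v = 0.
Proof.
rewrite /dlt; by case: eqVneq => // _ _; rewrite zero_lfunE.
Qed.

End Delta.
#[global] Opaque dlt.

(* [coind a S] is the direct sum of [a j] copies of each [S j]; with the action
   [cx] of the loop at [i] it is the H_i-module  (+)_j  iHj (x)_j M_j  of
   Geiss, Leclerc and Schroeer. *)
Section Coinduced.
Variables (K : fieldType) (n : nat) (a : 'I_n -> nat).
Implicit Types S : 'I_n -> vectType K.

Definition cidx : finType := {j & 'I_(a j)}.

Definition cidx_space S (x : cidx) : vectType K := S (tag x).

Definition coind S : vectType K := dsum (cidx_space S).

Section Components.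
Variable S : 'I_n -> vectType K.

Definition cdx j (k : 'I_(a j)) : cidx := Tagged (fun j => 'I_(a j)) k.

Definition cdco j (k : 'I_(a j)) (p : coind S) : S j := dco (cdx k) p.

Lemma cdco_linear j (k : 'I_(a j)) : linear (cdco k).
Proof. exact: (@dco_linear K cidx (cidx_space S) (cdx k)). Qed.

Definition cco j k : 'Hom(coind S, S j) :=
  if insub k is Some k' then linfun (cdco k') else 0.

Definition cmk (t : forall j, nat -> S j) : coind S :=
  @dmk K cidx (cidx_space S) (fun x => t (tag x) (tagged x)).

Lemma cmkK t j k : (k < a j)%N -> cco j k (cmk t) = t j k.
Proof.
move=> ka; rewrite /cco insubT (linfun_linearE (@cdco_linear _ _)).
exact: dmkK.
Qed.

Lemma cco_out j k p : (a j <= k)%N -> cco j k p = 0.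
Proof. by move=> ak; rewrite /cco insubF ?zero_lfunE // ltnNge ak. Qed.

Lemma coind_eq p q : (forall j k, (k < a j)%N -> cco j k p = cco j k q) -> p = q.
Proof.
move=> e; apply: dsum_eq => -[j k]; have := e j k (ltn_ord k).
by rewrite /cco valK !(linfun_linearE (@cdco_linear _ _)).
Qed.

Lemma cmk_linear (f : forall j, nat -> coind S -> S j) :
  (forall j k, linear (f j k)) -> linear (fun p => cmk (fun j k => f j k p)).
Proof.
by move=> lf u p q; apply: coind_eq => j k ka; rewrite linearP /= !cmkK // lf.
Qed.

Lemma dim_coind : \dim {:coind S} = (\sum_j a j * \dim {:S j})%N.
Proof.
rewrite dim_dsum.
rewrite -(@sig_big_dep _ _ _ _ (fun j => 'I_(a j)) xpredT (fun _ _ => true) (fun j _ => \dim {:S j})) /=.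
by apply: eq_bigr => j _; rewrite sum_nat_const card_ord.
Qed.

Definition cinj j k : 'Hom(S j, coind S) :=
  linfun (fun v => cmk (fun j' k' => if k' == k then dlt S j j' v else 0)).

Lemma cinjE j k v : cinj j k v = cmk (fun j' k' => if k' == k then dlt S j j' v else 0).
Proof.
rewrite /cinj linfun_linearE // => u x y; apply: coind_eq => j' k' ka.
by rewrite linearP /= !cmkK //; case: eqP => _; rewrite ?linearP // scaler0 addr0.
Qed.

Lemma cco_cinj j k v j' k' : (k' < a j')%N ->
  cco j' k' (cinj j k v) = if k' == k then dlt S j j' v else 0.
Proof. by move=> ka; rewrite cinjE cmkK. Qed.

Lemma cinj_out j k v : (a j <= k)%N -> cinj j k v = 0.
Proof.
move=> ak; apply: coind_eq => j' k' ka; rewrite cco_cinj // linear0.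
case: eqP => // e; have [jj|jj] := eqVneq j j'; last by rewrite dlt_neq.
by exfalso; move: ka; rewrite e -jj ltnNge ak.
Qed.

Lemma cinj_sum p : p = \sum_j \sum_(k < a j) cinj j k (cco j k p).
Proof.
apply: coind_eq => j k ka; rewrite linear_sum (bigD1 j) //= [X in _ + X]big1 ?addr0; last first.
  move=> j' jj; rewrite linear_sum big1 // => k' _ /=.
  by rewrite cco_cinj // dlt_neq // if_same.
rewrite linear_sum (bigD1 (Ordinal ka)) //= [X in _ + X]big1 ?addr0; last first.
  by move=> k' kk; rewrite cco_cinj // (_ : k == k' :> nat = false) // eq_sym; apply: negPf.
by rewrite cco_cinj // eqxx dlt_id.
Qed.

Variables (e : forall j, 'End(S j)) (b : 'I_n -> nat).

(** In [outmap], copy [k] at [j] records the arrow applied to [eps^k m]. One more loop at [i] reads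
    copy [k+1]; past the last copy, the relation trades [a j] loops at [i] for [b j] loops at [j] on
    copy 0. *)
Definition cx : 'End(coind S) := linfun (fun p => cmk (fun j k =>
  if (k.+1 < a j)%N then cco j k.+1 p else lpow (e j) (b j) (cco j 0 p))).

Lemma cco_cx j k p : (k < a j)%N -> cco j k (cx p) =
  if (k.+1 < a j)%N then cco j k.+1 p else lpow (e j) (b j) (cco j 0 p).
Proof.
move=> ka; rewrite /cx linfun_linearE ?cmkK //.
by apply: cmk_linear => j' k' u x y; case: ifP => _; rewrite !linearP.
Qed.

(** [a j] steps run once through the copies and act as [e j] to the power [b j]; the quotient and
    remainder of [l + m] by [a j] count the rounds and name the copy reached. *)
Lemma cco_cx_pow j m l p : (m < a j)%N -> cco j m (lpow cx l p) =
  lpow (e j) (b j * ((l + m) %/ a j))%N (cco j ((l + m) %% a j)%N p).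
Proof.
move=> ma; have a0 : (0 < a j)%N by apply: leq_ltn_trans ma.
elim: l m ma => [|l IH] m ma.
  by rewrite lpow0 add0n divn_small // muln0 lpow0 modn_small.
rewrite lpowS cco_cx //; case: ltnP => am; first by rewrite IH // addnS addSn.
have em : m.+1 = a j by apply/eqP; rewrite eqn_leq ma am.
rewrite IH // addn0 -lpowD -mulnS addSnnS em divnDr // divnn a0 addn1.
by rewrite modnDr.
Qed.

Lemma cco_cx0 j k p : (k < a j)%N -> cco j 0 (lpow cx k p) = cco j k p.
Proof.
move=> ka; rewrite cco_cx_pow ?(leq_ltn_trans _ ka) // addn0.
by rewrite divn_small // muln0 lpow0 modn_small.
Qed.

Lemma cco_cxa j p : (0 < a j)%N ->
  cco j 0 (lpow cx (a j) p) = lpow (e j) (b j) (cco j 0 p).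
Proof. by move=> a0; rewrite cco_cx_pow // addn0 divnn a0 muln1 modnn. Qed.

Lemma cco_cinj_neq j k v j' k' : j != j' -> cco j' k' (cinj j k v) = 0.
Proof.
move=> jj; have [ka|ka] := ltnP k' (a j'); last exact: cco_out.
by rewrite cco_cinj // dlt_neq // if_same.
Qed.

Lemma cx_cinj j k v : (k.+1 < a j)%N -> cx (cinj j k.+1 v) = cinj j k v.
Proof.
move=> ka; apply: coind_eq => j' k' ka'; rewrite cco_cx //.
have a0' : (0 < a j')%N by apply: leq_ltn_trans ka'.
have [jj|jj] := eqVneq j j'; last by rewrite !cco_cinj_neq // linear0 if_same.
rewrite [RHS]cco_cinj //; case: ifP => ka2; first by rewrite cco_cinj // eqSS.
rewrite cco_cinj //= linear0; case: (k' =P k) => // kk.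
by rewrite kk -jj ka in ka2.
Qed.

Lemma cx_cinj0 j v : (0 < a j)%N ->
  cx (cinj j 0 v) = cinj j (a j).-1 (lpow (e j) (b j) v).
Proof.
move=> a0; apply: coind_eq => j' k' ka'; rewrite cco_cx //.
have a0' : (0 < a j')%N by apply: leq_ltn_trans ka'.
have [jj|jj] := eqVneq j j'; last by rewrite !cco_cinj_neq // linear0 if_same.
rewrite [RHS]cco_cinj //; case: ifP => ka2.
  by rewrite cco_cinj //; have -> : (k' == (a j).-1) = false by apply/eqP; rewrite jj; lia.
rewrite cco_cinj //= -jj !dlt_id; case: (k' =P _) => // kk.
by move: ka2 ka'; rewrite -jj; lia.
Qed.

Lemma cx_cinj_pow j l k v : (k + l < a j)%N -> lpow cx l (cinj j (k + l)%N v) = cinj j k v.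
Proof.
elim: l => [|l IH]; first by rewrite lpow0 addn0.
by rewrite addnS => ka; rewrite lpowSr cx_cinj //; apply/IH/ltnW.
Qed.

Lemma cx_cinj_a j v : (0 < a j)%N ->
  lpow cx (a j) (cinj j (a j).-1 v) = cinj j (a j).-1 (lpow (e j) (b j) v).
Proof.
move=> a0; have e1 : lpow cx (a j).-1 (cinj j (a j).-1 v) = cinj j 0 v.
  by rewrite -{2}[(a j).-1]add0n cx_cinj_pow // add0n prednK.
by rewrite -{1}(prednK a0) lpowS e1 cx_cinj0.
Qed.

End Components.

Section Map.
Variables S S' : 'I_n -> vectType K.

Definition cmap (h : S ~> S') : 'Hom(coind S, coind S') :=
  linfun (fun p => cmk (fun j k => h j (cco S j k p))).

Lemma cco_cmap (h : S ~> S') j k p : cco S' j k (cmap h p) = h j (cco S j k p).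
Proof.
have [ka|ka] := ltnP k (a j); last by rewrite !cco_out ?linear0.
rewrite /cmap linfun_linearE ?cmkK // => u x y.
by apply: coind_eq => j' k' ka'; rewrite linearP /= !cmkK // !linearP.
Qed.

Lemma cmap_cinj (h : S ~> S') j k v : cmap h (cinj S j k v) = cinj S' j k (h j v).
Proof.
apply: coind_eq => j' k' ka; rewrite cco_cmap !cco_cinj //.
case: eqP => _; rewrite ?linear0 //.
have [<-|jj] := eqVneq j j'; first by rewrite !dlt_id.
by rewrite !dlt_neq ?linear0.
Qed.

Lemma cmap_cx (h : S ~> S') (e : forall j, 'End(S j)) (e' : forall j, 'End(S' j)) b p :
  (forall j v, (0 < a j)%N -> h j (e j v) = e' j (h j v)) ->
  cmap h (cx e b p) = cx e' b (cmap h p).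
Proof.
move=> he; apply: coind_eq => j k ka; rewrite cco_cmap !cco_cx // !cco_cmap.
case: ifP => // _; apply: lpow_comm => u.
by apply: he; apply: leq_ltn_trans ka.
Qed.

End Map.

Lemma cmap_comp S1 S2 S3 (f : S1 ~> S2) (g : S2 ~> S3) p :
  cmap g (cmap f p) = cmap (fun j => g j \o f j)%VF p.
Proof. by apply: coind_eq => j k ka; rewrite !cco_cmap comp_lfunE. Qed.

Lemma eq_cmap S S' (f g : S ~> S') p :
  (forall j v, (0 < a j)%N -> f j v = g j v) -> cmap f p = cmap g p.
Proof.
move=> e; apply: coind_eq => j k ka; rewrite !cco_cmap e //.
exact: leq_ltn_trans ka.
Qed.

Lemma cmap_id S (f : S ~> S) p :
  (forall j v, (0 < a j)%N -> f j v = v) -> cmap f p = p.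
Proof.
move=> e; apply: coind_eq => j k ka; rewrite !cco_cmap e //.
exact: leq_ltn_trans ka.
Qed.

Lemma cmap_surj S S' (f : S ~> S') q :
  (forall j w, (0 < a j)%N -> exists v, f j v = w) -> exists p, cmap f p = q.
Proof.
move=> fs; exists (cmap (fun j => (f j)^-1)%VF q).
rewrite cmap_comp cmap_id // => j v aj; rewrite comp_lfunE limg_lfunVK //.
by have [u <-] := fs j v aj; rewrite memv_img ?memvf.
Qed.

Lemma cmap_inj S S' (f : S ~> S') p :
  (forall j v, (0 < a j)%N -> f j v = 0 -> v = 0) -> cmap f p = 0 -> p = 0.
Proof.
move=> fi e; apply: coind_eq => j k ka; rewrite linear0; apply: fi.
  exact: leq_ltn_trans ka.
by rewrite -cco_cmap e linear0.
Qed.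

Lemma cmap_exact S1 S2 S3 (f : S1 ~> S2) (g : S2 ~> S3) q :
  (forall j v, (0 < a j)%N -> (g j v = 0 <-> exists u, f j u = v)) ->
  cmap g q = 0 <-> exists p, cmap f p = q.
Proof.
move=> ex; split=> [gq|[p <-]].
  exists (cmap (fun j => (f j)^-1)%VF q); apply: coind_eq => j k ka.
  have aj : (0 < a j)%N by apply: leq_ltn_trans ka.
  rewrite !cco_cmap limg_lfunVK //.
  have /(ex _ _ aj)[u <-] : g j (cco S2 j k q) = 0 by rewrite -cco_cmap gq linear0.
  by rewrite memv_img ?memvf.
rewrite cmap_comp; apply: coind_eq => j k ka; rewrite cco_cmap comp_lfunE linear0.
by apply/ex; [apply: leq_ltn_trans ka | exists (cco S1 j k p)].
Qed.

End Coinduced.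
#[global] Opaque coind cco cmk cinj cx cmap.
Arguments coind {K n} a S.
Arguments cco {K n a S} j k.
Arguments cmk {K n a S} t.
Arguments cinj {K n a S} j k.
Arguments cx {K n a S} e b.
Arguments cmap {K n} a {S S'} h.

(** * Reflection at a source *)

Section Reflection.
Variables (K : fieldType) (n : nat) (A : 'I_n -> 'I_n -> nat) (d : 'I_n -> nat).
Hypothesis d_gt0 : forall i, (0 < d i)%N.
Hypothesis A_sym : forall i j, A i j = 0%N -> A j i = 0%N.
Hypothesis A_d : forall i j, i != j -> A i j != 0%N ->
  exists k, d i = (A j i * k)%N /\ d j = (A i j * k)%N.
Variables (i : 'I_n) (c' : seq 'I_n).
Hypothesis uc : uniq (i :: c').

Local Notation c := (i :: c').
Local Notation cr := (rcons c' i).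
Local Notation rep := (rep K n).
Local Notation is_rep := (is_rep A d).
Implicit Types M N L P : rep.

(** Zero at [i], so that [coind] involves only the neighbours of [i], where a reflection at [i]
    changes nothing. *)
Definition mult j := if j == i then 0%N else A j i.
Local Notation a := mult.
Local Notation b := (A i).

Lemma mult_self : a i = 0%N. Proof. by rewrite /mult eqxx. Qed.
Lemma mult_other j : j != i -> a j = A j i. Proof. by rewrite /mult => /negPf->. Qed.
Lemma mult_gt0 j : (0 < a j)%N -> j != i.
Proof. by rewrite /mult; case: eqP. Qed.

Lemma arrow_at_other j k : j != i -> k != i -> arrow_at A cr j k = arrow_at A c j k.
Proof.
move=> ji ki; rewrite /arrow_at !mem_rcons !inE (negPf ji) (negPf ki) /=.
rewrite [i == j]eq_sym [i == k]eq_sym (negPf ji) (negPf ki) ltnS.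
case jc: (j \in c') => //=; case kc: (k \in c') => //=.
by rewrite -!cats1 !index_cat jc kc.
Qed.

Lemma arrow_at_into j : arrow_at A c j i = false.
Proof. by rewrite /arrow_at /= eqxx ltn0 !andbF. Qed.

Lemma arrow_at_outof k : arrow_at A cr i k = false.
Proof.
have ic : i \notin c' by case/andP: uc.
have ei : index i cr = size c' by rewrite -cats1 index_cat (negPf ic) /= eqxx addn0.
rewrite /arrow_at ei; case kc: (k \in cr); last by rewrite andbF.
by move: kc; rewrite -index_mem size_rcons ltnS leqNgt => /negPf->; rewrite !andbF.
Qed.

Lemma arrow_at_out j : arrow_at A c i j = (j \in c') && (A i j != 0%N).
Proof.
have ic : i \notin c' by case/andP: uc.
have [->|ji] := eqVneq j i; first by rewrite arrow_at_into (negPf ic).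
by rewrite /arrow_at !inE /= eqxx [i == j]eq_sym (negPf ji).
Qed.

Lemma arrow_at_in j : arrow_at A cr j i = (j \in c') && (A j i != 0%N).
Proof.
have ic : i \notin c' by case/andP: uc.
have [->|ji] := eqVneq j i; first by rewrite arrow_at_outof (negPf ic).
rewrite /arrow_at !mem_rcons !inE eqxx -cats1 !index_cat (negPf ic) /= eqxx addn0.
by rewrite (negPf ji) /=; case jc: (j \in c') => //=; rewrite index_mem jc.
Qed.

(** If d_i = A_ji k and d_j = A_ij k, then d_i steps are k rounds through the copies at [j] and act
    as [e j] to the power d_j. *)
Lemma cx_nil (S : 'I_n -> vectType K) (e : forall j, 'End(S j)) p :
  (forall j v, lpow (e j) (d j) v = 0) -> lpow (cx (a := a) e b) (d i) p = 0.
Proof.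
move=> ne; apply: coind_eq => j k ka; rewrite cco_cx_pow // linear0.
have aj : (0 < a j)%N by apply: leq_ltn_trans ka.
have ji := mult_gt0 aj; move: ka aj; rewrite mult_other // => ka aj.
have [m [di dj]] : exists k, d i = (A j i * k)%N /\ d j = (A i j * k)%N.
  have [|q [-> ->]] := A_d ji; first by rewrite -lt0n.
  by exists q.
have -> : (A i j * ((d i + k) %/ A j i) = d j)%N.
  by rewrite di (mulnC (A j i)) divnMDl // divn_small // addn0 dj.
exact: ne.
Qed.

Definition outmap (M : rep) : 'Hom(M i, coind a M) :=
  linfun (fun m => cmk (fun j k => arr M i j (lpow (eps M i) k m))).

Lemma cco_out_map M j k m : (k < a j)%N ->
  cco j k (outmap M m) = arr M i j (lpow (eps M i) k m).
Proof.
move=> ka; rewrite /outmap linfun_linearE ?cmkK // => u x y.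
by apply: coind_eq => j' k' ka'; rewrite linearP /= !cmkK // !linearP.
Qed.

Definition inmap (M : rep) : 'Hom(coind a M, M i) :=
  \sum_j \sum_(k < a j) (lpow (eps M i) (a j - k.+1) \o arr M j i \o cco j k)%VF.

Lemma inmapE M p : inmap M p =
  \sum_j \sum_(k < a j) lpow (eps M i) (a j - k.+1) (arr M j i (cco j k p)).
Proof.
rewrite /inmap sum_lfunE; apply: eq_bigr => j _; rewrite sum_lfunE.
by apply: eq_bigr => k _; rewrite !comp_lfunE.
Qed.

Local Notation cxM M := (cx (a := a) (eps M) b).

Lemma outmap_eps M m : is_rep c M -> outmap M (eps M i m) = cxM M (outmap M m).
Proof.
move=> rM; apply: coind_eq => j k ka; have aj : (0 < a j)%N by apply: leq_ltn_trans ka.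
rewrite cco_cx // [LHS]cco_out_map //; case: ltnP => ka2; first by rewrite cco_out_map // -lpowSr.
rewrite cco_out_map // -lpowSr (_ : k.+1 = A j i) ?(rep_rel rM) ?lpow0 //.
by rewrite -mult_other ?mult_gt0 //; apply/eqP; rewrite eqn_leq ka ka2.
Qed.

Lemma inmap_cx M p : is_rep cr M -> inmap M (cxM M p) = eps M i (inmap M p).
Proof.
move=> rM; rewrite !inmapE linear_sum; apply: eq_bigr => j _.
have [a0|aj] := posnP (a j); first by rewrite a0 !big_ord0 linear0.
have ji := mult_gt0 aj.
have co k (ka : (k < a j)%N) := @cco_cx K n a M (eps M) b j k p ka.
move: co; rewrite linear_sum /=.
case: (a j) aj (mult_other ji) => // m _ em co.
rewrite big_ord_recr big_ord_recl /= addrC; congr (_ + _).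
  rewrite co // ltnn subSS subnn lpow0 (rep_rel rM) -em subn1 /=.
  by rewrite -lpowS.
apply: eq_bigr => k _; have km := ltn_ord k; rewrite (co _ (ltnW km)) ltnS km -lpowS.
by congr (lpow _ _ _); rewrite /bump /= !subSS; lia.
Qed.

Lemma inmap_cinj M j v : (0 < a j)%N -> inmap M (cinj (a := a) j (a j).-1 v) = arr M j i v.
Proof.
move=> aj; rewrite inmapE (bigD1 j) //= [X in _ + X]big1 ?addr0; last first.
  move=> j' jj; rewrite big1 // => k _; rewrite cco_cinj // dlt_neq 1?eq_sym //.
  by rewrite if_same !linear0.
have lt : ((a j).-1 < a j)%N by rewrite prednK.
rewrite (bigD1 (Ordinal lt)) //= [X in _ + X]big1 ?addr0; last first.
  move=> k kk; rewrite cco_cinj // (_ : k == _ :> nat = false) ?linear0 //.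
  by apply: contraNF kk => /eqP e; apply/eqP/val_inj.
by rewrite cco_cinj // eqxx dlt_id prednK // subnn lpow0.
Qed.

(* The reflection functors are inverse equivalences between [Xc] and [Yc]. *)
Definition Xc (M : rep) := forall m, outmap M m = 0 -> m = 0.
Definition Yc (M : rep) := forall m, exists p, inmap M p = m.

(* Isomorphic outside [i], with a sequence  M_i -> coind M -> M'_i  exact in the middle. *)
Record refl_pair (M M' : rep) := ReflPair {
  refl_rep : is_rep c M;
  refl_rep' : is_rep cr M';
  refl_to : forall j, 'Hom(M j, M' j);
  refl_from : forall j, 'Hom(M' j, M j);
  refl_toK : forall j v, j != i -> refl_from j (refl_to j v) = v;
  refl_fromK : forall j v, j != i -> refl_to j (refl_from j v) = v;
  refl_eps : forall j v, j != i -> refl_to j (eps M j v) = eps M' j (refl_to j v);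
  refl_arr : forall j k v, j != i -> k != i ->
    refl_to k (arr M j k v) = arr M' j k (refl_to j v);
  refl_exact : forall p,
    inmap M' (cmap a refl_to p) = 0 <-> exists m, outmap M m = p
}.

Lemma outmap_hom M N (h : M ~> N) m : is_hom h ->
  outmap N (h i m) = cmap a h (outmap M m).
Proof.
move=> hh; apply: coind_eq => j k ka.
by rewrite cco_cmap !cco_out_map // -hom_pow // hh.2.
Qed.

Lemma inmap_hom M N (h : M ~> N) p : is_hom h ->
  inmap N (cmap a h p) = h i (inmap M p).
Proof.
move=> hh; rewrite !inmapE linear_sum; apply: eq_bigr => j _.
rewrite linear_sum; apply: eq_bigr => k _ /=.
by rewrite cco_cmap -hh.2 -hom_pow.
Qed.

Lemma coker_exists (V W : vectType K) (f : 'Hom(V, W)) :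
  exists (C : vectType K) (g : 'Hom(W, C)) (s : 'Hom(C, W)),
    (forall x, g (s x) = x) /\ forall w, g w = 0 <-> exists v, f v = w.
Proof.
exists (quo_space (limg f)), (quo_proj (limg f)), (quo_lift (limg f)).
split=> [x|w]; first exact: quo_liftK.
rewrite quo_proj_eq0; split=> [/memv_imgP[v _ ->]|[v <-]]; first by exists v.
by rewrite memv_img ?memvf.
Qed.

Lemma ker_exists (V W : vectType K) (f : 'Hom(V, W)) :
  exists (C : vectType K) (g : 'Hom(C, V)),
    (forall x, g x = 0 -> x = 0) /\ forall v, f v = 0 <-> exists x, g x = v.
Proof.
exists (subvs_of (lker f)), (linfun (vsval : subvs_of (lker f) -> V)).
split=> [x|v]; first by rewrite lfunE => e; apply: val_inj; rewrite e.
split=> [fv|[x <-]]; last by apply/eqP; rewrite -memv_ker lfunE subvsP.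
have vk : v \in lker f by rewrite memv_ker fv.
by exists (Subvs vk); rewrite lfunE.
Qed.

(** The cokernel of [outmap] is put at [i], with the loop induced by [cx]; the last copy at [j]
    gives the new arrow from [j]. The incoming map is then the projection onto the cokernel. *)
Lemma coker_refl M : is_rep c M -> exists M' (r : refl_pair M M'), Yc M'.
Proof.
move=> rM; have [C [g [s [gs gE]]]] := coker_exists (outmap M).
pose cx' := cxM M.
pose u := ovr_in i C M; pose v := ovr_out i C M.
pose pt := ovr_put i C M; pose gt := ovr_get i C M.
pose ce : 'End(C) := lfactor g (g \o cx')%VF.
have ceE p : ce (g p) = g (cx' p).
  rewrite lfactorE => [|q /gE[m <-]]; first exact: comp_lfunE.
  have -> : (g \o cx')%VF (outmap M m) = g (cx' (outmap M m)) by exact: comp_lfunE.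
  by apply/gE; exists (eps M i m); rewrite outmap_eps.
pose B j : 'Hom(M j, C) := (g \o cinj (a := a) j (a j).-1)%VF.
pose M' := @Rep K n (ovr i C M)
  (fun j => (u j \o eps M j \o v j) + (pt j \o ce \o gt j))%VF
  (fun j k => (u k \o arr M j k \o v j) + (pt k \o B j \o v j))%VF.
have eE j x : j != i -> eps M' j (u j x) = u j (eps M j x).
  move=> ji; rewrite /= add_lfunE !comp_lfunE /u /v ovr_inK //.
  by rewrite ovr_put0 // addr0.
have ei x : eps M' i (pt i x) = pt i (ce x).
  by rewrite /= add_lfunE !comp_lfunE /u ovr_in0 add0r /gt /pt ovr_putK.
have aE j k x : j != i -> k != i -> arr M' j k (u j x) = u k (arr M j k x).
  move=> ji ki; rewrite /= add_lfunE !comp_lfunE /u /v ovr_inK //.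
  by rewrite /pt ovr_put0 // addr0.
have ai j x : j != i -> arr M' j i (u j x) = pt i (g (cinj (a := a) j (a j).-1 x)).
  move=> ji; rewrite /= add_lfunE !comp_lfunE /u /v ovr_inK //.
  by rewrite ovr_in0 add0r.
have ao k x : arr M' i k x = 0.
  by rewrite /= add_lfunE !comp_lfunE /v ovr_out0 !linear0 addr0.
have ptE x : exists p, x = pt i (g p).
  by exists (s (gt i x)); rewrite gs /pt /gt ovr_getK.
have uE j x : j != i -> exists y, x = u j y.
  by move=> ji; exists (v j x); rewrite /u /v ovr_outK.
(* Copy [k] is the last copy moved by [a j - k - 1] steps of [cx], and these become loops in the
   cokernel. *)
have inME p : inmap M' (cmap a u p) = pt i (g p).
  rewrite inmapE {2}[p](cinj_sum) !linear_sum; apply: eq_bigr => j _ /=.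
  rewrite !linear_sum; apply: eq_bigr => k _ /=.
  have ji : j != i by apply: mult_gt0; apply: leq_ltn_trans (ltn_ord k).
  rewrite cco_cmap ai // -(lpow_comm (f := ce)); last by move=> x; rewrite ei.
  congr (pt i _); rewrite -(lpow_comm (f := cx')); last by move=> x; rewrite ceE.
  congr (g _); have e : ((a j).-1 = k + (a j - k.+1))%N by have := ltn_ord k; lia.
  by rewrite {1}e cx_cinj_pow //; have := ltn_ord k; lia.
have r' : is_rep cr M'.
  split=> [j x|j k x|j k x na|j x jc].
  - have [ji|ji] := eqVneq j i.
      move: x; rewrite ji => x; have [p ->] := ptE x.
      rewrite -(lpow_comm (f := ce)); last by move=> y; rewrite ei.
      rewrite -(lpow_comm (f := cx')); last by move=> y; rewrite ceE.
      by rewrite cx_nil ?linear0 // => k y; apply: (rep_nil rM).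
    have [y ->] := uE j x ji; rewrite -(lpow_comm (f := eps M j)) ?(rep_nil rM) ?linear0 //.
    by move=> z; rewrite eE.
  - have [ji|ji] := eqVneq j i; first by move: x; rewrite ji => x; rewrite !ao linear0.
    have [y ->] := uE j x ji; rewrite -(lpow_comm (f := eps M j)); last by move=> z; rewrite eE.
    have [ki|ki] := eqVneq k i.
      rewrite ki !ai // -(lpow_comm (f := ce)); last by move=> z; rewrite ei.
      rewrite -(lpow_comm (f := cx')); last by move=> z; rewrite ceE.
      have [a0|aj] := posnP (a j); first by rewrite !cinj_out ?a0 ?linear0.
      by rewrite -(mult_other ji) /cx' cx_cinj_a.
    rewrite !aE // (rep_rel rM) (lpow_comm (g := eps M' k)) // => z; rewrite eE //.
  - have [ji|ji] := eqVneq j i; first by move: x; rewrite ji => x; rewrite ao.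
    have [y ->] := uE j x ji; have [ki|ki] := eqVneq k i; last first.
      by rewrite aE // (rep_arr rM) ?linear0 // -arrow_at_other.
    rewrite ki ai //; move: na; rewrite ki arrow_at_in negb_and negbK.
    case/orP => [jc|/eqP A0]; last by rewrite cinj_out ?linear0 // mult_other // A0.
    by rewrite (rep_supp rM y) ?linear0 // inE (negPf ji).
  - move: jc; rewrite mem_rcons inE negb_or => /andP[ji jc].
    by have [y ->] := uE j x ji; rewrite (rep_supp rM y) ?linear0 // inE (negPf ji).
have rp : refl_pair M M'.
  apply: (@ReflPair M M' rM r' u v) => [j x ji|j x ji|j x ji|j k x ji ki|p].
  - by rewrite /u /v ovr_inK.
  - by rewrite /u /v ovr_outK.
  - by rewrite eE.
  - by rewrite aE.
  rewrite inME -gE; split=> [e|->]; last by rewrite linear0.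
  by rewrite -[g p](ovr_putK i M) -/pt e linear0.
exists M', rp => m; have [p ->] := ptE m; exists (cmap a u p); exact: inME.
Qed.

(** The kernel of [inmap] is put at [i], and the new arrow to a neighbour reads copy 0. As copy [k]
    is copy 0 after [k] steps of [cx], [outmap] becomes the inclusion of the kernel. *)
Lemma ker_refl M' : is_rep cr M' -> exists M (r : refl_pair M M'), Xc M.
Proof.
move=> r'; have [C [t [tinj tE]]] := ker_exists (inmap M').
pose cx' := cxM M'.
pose u := ovr_in i C M'; pose v := ovr_out i C M'.
pose pt := ovr_put i C M'; pose gt := ovr_get i C M'.
have cxt x : exists y, t y = cx' (t x).
  by apply/tE; rewrite inmap_cx // (tE _).2 ?linear0 //; exists x.
pose ce : 'End(C) := llift t (cx' \o t)%VF.
have ceE x : t (ce x) = cx' (t x).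
  have e : (cx' \o t)%VF x = cx' (t x) by exact: comp_lfunE.
  by rewrite lliftE e //; apply: cxt.
have tinj2 x y : t x = t y -> x = y.
  by apply: lfun_inj => z; apply: tinj.
pose B j : 'Hom(C, M' j) := (cco j 0 \o t)%VF.
have BE j x : B j x = cco j 0 (t x) by exact: comp_lfunE.
pose M := @Rep K n (ovr i C M')
  (fun j => (u j \o eps M' j \o v j) + (pt j \o ce \o gt j))%VF
  (fun j k => (u k \o arr M' j k \o v j) + (u k \o B k \o gt j))%VF.
have eE j x : j != i -> eps M j (u j x) = u j (eps M' j x).
  move=> ji; rewrite /= add_lfunE !comp_lfunE /u /v ovr_inK //.
  by rewrite ovr_put0 // addr0.
have ei x : eps M i (pt i x) = pt i (ce x).
  by rewrite /= add_lfunE !comp_lfunE /u ovr_in0 add0r /gt /pt ovr_putK.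
have aE j k x : j != i -> arr M j k (u j x) = u k (arr M' j k x).
  move=> ji; rewrite /= add_lfunE !comp_lfunE /u /v ovr_inK //.
  by rewrite /gt ovr_get0 // !linear0 addr0.
have ao k x : arr M i k (pt i x) = u k (cco k 0 (t x)).
  rewrite /= add_lfunE !comp_lfunE /v ovr_out0 !linear0 add0r ?BE.
  by rewrite /gt /pt ovr_putK.
have ai j x : arr M j i x = 0.
  by rewrite /= add_lfunE !comp_lfunE /u !ovr_in0 addr0.
have ptE (x : M i) : exists y, x = pt i y by exists (gt i x); rewrite /pt /gt ovr_getK.
have uE j (x : M j) : j != i -> exists y, x = u j y.
  by move=> ji; exists (v j x); rewrite /u /v ovr_outK.
have powp k x : lpow (eps M i) k (pt i x) = pt i (lpow ce k x).
  by rewrite (lpow_comm (g := eps M i)) // => y; rewrite ei.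
have powu j k x : j != i -> lpow (eps M j) k (u j x) = u j (lpow (eps M' j) k x).
  by move=> ji; rewrite (lpow_comm (g := eps M j)) // => y; rewrite eE.
have powt k x : t (lpow ce k x) = lpow cx' k (t x) by apply: lpow_comm.
have outE x : outmap M (pt i x) = cmap a u (t x).
  apply: coind_eq => j k ka; rewrite cco_out_map // powp ao powt cco_cmap.
  by congr (u j _); rewrite cco_cx0.
have rM : is_rep c M.
  split=> [j x|j k x|j k x na|j x jc].
  - have [ji|ji] := eqVneq j i.
      move: x; rewrite ji => x; have [y ->] := ptE x.
      rewrite powp; have -> : lpow ce (d i) y = 0; last by rewrite linear0.
      apply: tinj; rewrite powt cx_nil // => k z; exact: (rep_nil r').
    by have [y ->] := uE j x ji; rewrite powu // (rep_nil r') linear0.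
  - have [ki|ki] := eqVneq k i.
      by move: k ki => _ ->; rewrite !ai linear0.
    have [ji|ji] := eqVneq j i.
      move: x; rewrite ji => x; have [y ->] := ptE x.
      rewrite powp !ao powt powu //; congr (u k _).
      have [a0|ak] := posnP (a k); first by rewrite !cco_out ?a0 ?linear0.
      by rewrite -(mult_other ki) cco_cxa.
    by have [y ->] := uE j x ji; rewrite powu // !aE // powu // (rep_rel r').
  - have [ki|ki] := eqVneq k i; first by move: k ki na => _ -> _; rewrite ai.
    have [ji|ji] := eqVneq j i; last first.
      by have [y ->] := uE j x ji; rewrite aE // (rep_arr r') ?linear0 // arrow_at_other.
    move: x na; rewrite ji => x; have [y ->] := ptE x.
    rewrite arrow_at_out negb_and negbK ao => /orP[kc|/eqP A0].
      by rewrite [cco _ _ _](rep_supp r') ?linear0 // mem_rcons inE negb_or ki.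
    by rewrite cco_out ?linear0 // mult_other // A_sym.
  - move: jc; rewrite inE negb_or => /andP[ji jc].
    by have [y ->] := uE j x ji; rewrite (rep_supp r' y) ?linear0 // mem_rcons inE negb_or ji.
have uv p : cmap a u (cmap a v p) = p.
  rewrite cmap_comp cmap_id // => j x /mult_gt0 ji.
  by rewrite comp_lfunE /u /v ovr_outK.
have vu p : cmap a v (cmap a u p) = p.
  rewrite cmap_comp cmap_id // => j x /mult_gt0 ji.
  by rewrite comp_lfunE /u /v ovr_inK.
have rp : refl_pair M M'.
  apply: (@ReflPair M M' rM r' v u) => [j x ji|j x ji|j x ji|j k x ji ki|p].
  - by rewrite /u /v ovr_outK.
  - by rewrite /u /v ovr_inK.
  - by have [y ->] := uE j x ji; rewrite eE // /u /v !ovr_inK.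
  - by have [y ->] := uE j x ji; rewrite aE // /u /v !ovr_inK.
  rewrite tE; split=> [[x e]|[m <-]].
    by exists (pt i x); rewrite outE e uv.
  by have [x ->] := ptE m; exists x; rewrite outE vu.
exists M, rp => m; have [x ->] := ptE m; rewrite outE => e.
have -> : x = 0; last by rewrite linear0.
by apply: tinj; rewrite -[t x]vu e linear0.
Qed.

(** * Morphisms and exact sequences under reflection *)

Section HomLift.
Variables (M M' N N' : rep) (r : refl_pair M M') (q : refl_pair N N').

(** [Yc M'] makes M'_i the cokernel of M_i -> [coind M]; at [i] the new map is the one induced on
    cokernels. *)
Lemma hom_to_refl (h : M ~> N) : Yc M' -> is_hom h ->
  exists h' : M' ~> N', is_hom h' /\
    forall j v, j != i -> h' j (refl_to r j v) = refl_to q j (h j v).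
Proof.
move=> yM hh.
pose h0 j : 'Hom(M' j, N' j) := (refl_to q j \o h j \o refl_from r j)%VF.
pose f : 'Hom(M' i, N' i) := lfactor (inmap M') (inmap N' \o cmap a h0)%VF.
have h0E j v : j != i -> h0 j (refl_to r j v) = refl_to q j (h j v).
  by move=> ji; rewrite !comp_lfunE refl_toK.
have toM p : exists p', p = cmap a (refl_to r) p'.
  exists (cmap a (refl_from r) p); rewrite cmap_comp cmap_id // => j v /mult_gt0 ji.
  by rewrite comp_lfunE refl_fromK.
have cmh0 p : cmap a h0 (cmap a (refl_to r) p) = cmap a (refl_to q) (cmap a h p).
  rewrite !cmap_comp; apply: eq_cmap => j v /mult_gt0 ji.
  by rewrite comp_lfunE h0E // comp_lfunE.
have fE p : f (inmap M' p) = inmap N' (cmap a h0 p).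
  rewrite /f lfactorE => [|p' e]; first exact: comp_lfunE.
  have -> : (inmap N' \o cmap a h0)%VF p' = inmap N' (cmap a h0 p') by exact: comp_lfunE.
  have [p2 e2] := toM p'; rewrite e2 in e *; rewrite cmh0.
  have [m <-] := (refl_exact r p2).1 e.
  by apply/refl_exact; exists (h i m); rewrite outmap_hom.
have [g [gi g0]] := at_vertex f.
pose h' j : 'Hom(M' j, N' j) := if j == i then g j else h0 j.
have h'i v : h' i v = f v by rewrite /h' eqxx gi.
have h'j j v : j != i -> h' j v = h0 j v by rewrite /h' => /negPf->.
have cmh' p : cmap a h' p = cmap a h0 p.
  by apply: eq_cmap => j v /mult_gt0 ji; rewrite h'j.
have [rM rN] := (refl_rep' r, refl_rep' q).
exists h'; split; last by move=> j v ji; rewrite h'j // h0E.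
have frE j v : j != i -> exists w, v = refl_to r j w.
  by move=> ji; exists (refl_from r j v); rewrite refl_fromK.
split=> [j v|j k v].
  have [ji|ji] := eqVneq j i.
    move: v; rewrite ji => v; have [p <-] := yM v.
    rewrite -inmap_cx // !h'i !fE -inmap_cx // -!cmh'; congr (inmap N' _).
    apply: cmap_cx => k w /mult_gt0 ki; have [w' ->] := frE k w ki.
    rewrite !h'j // -refl_eps // !h0E // hh.1 refl_eps //.
  have [w ->] := frE j v ji.
  by rewrite !h'j // -refl_eps // !h0E // hh.1 refl_eps.
have [ji|ji] := eqVneq j i.
  by move: v; rewrite ji => v; rewrite (rep_arr rM) ?(rep_arr rN) ?linear0 // arrow_at_outof.
have [ki|ki] := eqVneq k i; last first.
  have [w ->] := frE j v ji.
  by rewrite !h'j // -refl_arr // !h0E // hh.2 refl_arr.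
rewrite ki; have [a0|aj] := posnP (a j).
  have na : ~~ arrow_at A cr j i.
    by rewrite arrow_at_in negb_and negbK -(mult_other ji) a0 eqxx orbT.
  by rewrite (rep_arr rM) ?(rep_arr rN) ?linear0.
by rewrite -!inmap_cinj // h'i fE -cmh' cmap_cinj.
Qed.

(** [Xc N] makes N_i the kernel of [coind N] -> N'_i; at [i] the new map is a lift along
    [outmap N]. *)
Lemma hom_from_refl (h' : M' ~> N') : Xc N -> is_hom h' ->
  exists h : M ~> N, is_hom h /\
    forall j v, j != i -> refl_to q j (h j v) = h' j (refl_to r j v).
Proof.
move=> xN hh.
pose h0 j : 'Hom(M j, N j) := (refl_from q j \o h' j \o refl_to r j)%VF.
pose f : 'Hom(M i, N i) := llift (outmap N) (cmap a h0 \o outmap M)%VF.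
have h0E j v : j != i -> refl_to q j (h0 j v) = h' j (refl_to r j v).
  by move=> ji; rewrite !comp_lfunE refl_fromK.
have cmh0 p : cmap a (refl_to q) (cmap a h0 p) = cmap a h' (cmap a (refl_to r) p).
  rewrite !cmap_comp; apply: eq_cmap => j v /mult_gt0 ji.
  by rewrite comp_lfunE h0E // comp_lfunE.
have fE m : outmap N (f m) = cmap a h0 (outmap M m).
  have e : (cmap a h0 \o outmap M)%VF m = cmap a h0 (outmap M m) by exact: comp_lfunE.
  rewrite /f lliftE e //; apply/(refl_exact q); rewrite cmh0 inmap_hom //.
  by rewrite (refl_exact r _).2 ?linear0 //; exists m.
have [g [gi g0]] := at_vertex f.
pose h j : 'Hom(M j, N j) := if j == i then g j else h0 j.
have hi v : h i v = f v by rewrite /h eqxx gi.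
have hj j v : j != i -> h j v = h0 j v by rewrite /h => /negPf->.
have cmh p : cmap a h p = cmap a h0 p.
  by apply: eq_cmap => j v /mult_gt0 ji; rewrite hj.
have [rM rN] := (refl_rep r, refl_rep q).
exists h; split; last by move=> j v ji; rewrite hj // h0E.
have xN2 x y : outmap N x = outmap N y -> x = y.
  by apply: lfun_inj => z; apply: xN.
have toinj j x y : j != i -> refl_to q j x = refl_to q j y -> x = y.
  by move=> ji e; rewrite -[x](refl_toK q) // e refl_toK.
have heps j v : j != i -> h j (eps M j v) = eps N j (h j v).
  by move=> ji; apply: (toinj j) => //; rewrite !(hj, h0E) // !refl_eps // hh.1 h0E.
split=> [j v|j k v].
  have [ji|ji] := eqVneq j i; last exact: heps.
  move: v; rewrite ji => v; apply: xN2; rewrite outmap_eps // !hi !fE outmap_eps //.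
  by rewrite -!cmh; apply: cmap_cx => k w /mult_gt0 ki; apply: heps.
have [ki|ki] := eqVneq k i.
  rewrite ki (rep_arr rM) ?(rep_arr rN) ?linear0 // arrow_at_into //.
have [ji|ji] := eqVneq j i; last first.
  by apply: (toinj k) => //; rewrite !(hj, h0E) // !refl_arr // hh.2 h0E.
move: v; rewrite ji => v; have [a0|ak] := posnP (a k).
  have na : ~~ arrow_at A c i k.
    rewrite arrow_at_out negb_and negbK; apply/orP; right; apply/eqP/A_sym.
    by rewrite -mult_other.
  by rewrite (rep_arr rM) ?(rep_arr rN) ?linear0.
have e := fE v; rewrite -cmh in e; have := congr1 (cco k 0) e.
by rewrite cco_cmap !cco_out_map // !lpow0 hi => ->.
Qed.

End HomLift.

Lemma Yc_quot M N (h : M ~> N) : is_hom h -> hsurj h -> Yc M -> Yc N.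
Proof.
move=> hh hs yM v; have [u <-] := hs i v; have [p <-] := yM u.
by exists (cmap a h p); rewrite inmap_hom.
Qed.

Lemma Yc_ext L M N (f : L ~> M) (g : M ~> N) :
  is_hom f -> is_hom g -> hsurj g -> hexact f g -> Yc L -> Yc N -> Yc M.
Proof.
move=> hf hg gs ex yL yN m; have [p e] := yN (g i m).
have [q eq] : exists q, cmap a g q = p by apply: cmap_surj => j w _; apply: gs.
have /ex[l el] : g i (m - inmap M q) = 0.
  by rewrite linearB /= -inmap_hom // eq e subrr.
have [p' el'] := yL l; exists (cmap a f p' + q).
by rewrite linearD /= inmap_hom // el' el subrK.
Qed.

Lemma Xc_ext L M N (f : L ~> M) (g : M ~> N) :
  is_hom f -> is_hom g -> hinj f -> hexact f g -> Xc L -> Xc N -> Xc M.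
Proof.
move=> hf hg fi ex xL xN m em.
have /ex[l el] : g i m = 0 by apply: xN; rewrite outmap_hom // em linear0.
rewrite -el (xL l) ?linear0 //; move: em; rewrite -el outmap_hom //.
by apply: cmap_inj => j v _; apply: fi.
Qed.

Lemma hexact_cmap L M N (f : L ~> M) (g : M ~> N) p :
  hexact f g -> cmap a g p = 0 <-> exists q, cmap a f q = p.
Proof. by move=> ex; apply: cmap_exact => j v _; apply: ex. Qed.

Definition compat M M' N N' (r : refl_pair M M') (q : refl_pair N N')
    (h : M ~> N) (h' : M' ~> N') :=
  forall j v, j != i -> h' j (refl_to r j v) = refl_to q j (h j v).

Lemma compat_cmap M M' N N' (r : refl_pair M M') (q : refl_pair N N') h h' p :
  compat r q h h' ->
  cmap a h' (cmap a (refl_to r) p) = cmap a (refl_to q) (cmap a h p).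
Proof.
move=> e; rewrite !cmap_comp; apply: eq_cmap => j v /mult_gt0 ji.
by rewrite !comp_lfunE e.
Qed.

Lemma refl_to_inj M M' (r : refl_pair M M') j v : j != i -> refl_to r j v = 0 -> v = 0.
Proof. by move=> ji e; rewrite -(refl_toK r v ji) e linear0. Qed.

Lemma refl_to_surj M M' (r : refl_pair M M') j w : j != i -> exists v, refl_to r j v = w.
Proof. by move=> ji; exists (refl_from r j w); rewrite refl_fromK. Qed.

Lemma cmap_to_surj M M' (r : refl_pair M M') p' : exists p, cmap a (refl_to r) p = p'.
Proof. by apply: cmap_surj => j w /mult_gt0; apply: refl_to_surj. Qed.

Lemma cmap_to_inj M M' (r : refl_pair M M') p : cmap a (refl_to r) p = 0 -> p = 0.
Proof. by apply: cmap_inj => j v /mult_gt0; apply: refl_to_inj. Qed.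

Lemma inmap_outmap M M' (r : refl_pair M M') m :
  inmap M' (cmap a (refl_to r) (outmap M m)) = 0.
Proof. by apply/(refl_exact r); exists m. Qed.

Section Exactness.
Variables (L L' M M' N N' : rep).
Variables (rl : refl_pair L L') (rm : refl_pair M M') (rn : refl_pair N N').
Variables (f : L ~> M) (g : M ~> N).
Variables (f' : L' ~> M') (g' : M' ~> N').
Hypotheses (hf : is_hom f) (hg : is_hom g) (hf' : is_hom f') (hg' : is_hom g').
Hypotheses (cf : compat rl rm f f') (cg : compat rm rn g g').

Lemma refl_surj : hsurj g -> Yc N' -> hsurj g'.
Proof.
move=> gs yN j w; have [ji|ji] := eqVneq j i.
  move: w; rewrite ji => w; have [p <-] := yN w.
  have [p0 <-] := cmap_to_surj rn p.
  have [q <-] : exists q, cmap a g q = p0 by apply: cmap_surj => k v _; apply: gs.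
  by exists (inmap M' (cmap a (refl_to rm) q)); rewrite -inmap_hom // (compat_cmap _ cg).
have [x <-] := refl_to_surj rn w ji; have [y <-] := gs j x.
by exists (refl_to rm j y); rewrite cg.
Qed.

Lemma refl_exactness : hsurj g -> hexact f g -> Yc L' -> Yc M' -> hexact f' g'.
Proof.
move=> gs ex yL yM j v; have [ji|ji] := eqVneq j i; last first.
  have [x <-] := refl_to_surj rm v ji; rewrite cg //; split.
    move=> /(refl_to_inj ji)/ex[u <-]; exists (refl_to rl j u); exact: cf.
  case=> u; have [y <-] := refl_to_surj rl u ji; rewrite cf // => e.
  rewrite (_ : x = f j y); first by rewrite (ex _ _).2 ?linear0 //; exists y.
  by apply: (lfun_inj (fun v => @refl_to_inj _ _ rm _ v ji)); rewrite e.
move: v; rewrite ji => v; split; last first.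
  case=> u <-; have [p <-] := yL u; have [p0 <-] := cmap_to_surj rl p.
  rewrite -!inmap_hom // (compat_cmap _ cf) (compat_cmap _ cg).
  have -> : cmap a g (cmap a f p0) = 0; last by rewrite !linear0.
  by apply/(hexact_cmap _ ex); exists p0.
have [p <-] := yM v; have [p0 <-] := cmap_to_surj rm p.
rewrite -inmap_hom // (compat_cmap _ cg) => /refl_exact[n' en].
(* Subtracting [outmap M m], which maps to 0 in M'_i, moves the preimage into the kernel of
   [cmap a g] without changing the vector it represents. *)
have [m em] := gs i n'.
have /(hexact_cmap _ ex)[pl el] : cmap a g (p0 - outmap M m) = 0.
  by rewrite linearB /= -outmap_hom // em en subrr.
exists (inmap L' (cmap a (refl_to rl) pl)).
rewrite -inmap_hom // (compat_cmap _ cf) el !linearB /=.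
by rewrite inmap_outmap subr0.
Qed.

Lemma refl_inj : hinj f -> hexact f g -> Yc L' -> Xc N -> hinj f'.
Proof.
move=> fi ex yL xN j v; have [ji|ji] := eqVneq j i; last first.
  have [x <-] := refl_to_surj rl v ji; rewrite cf // => /(refl_to_inj ji)/fi->.
  exact: linear0.
move: v; rewrite ji => v; have [p <-] := yL v; have [p0 <-] := cmap_to_surj rl p.
rewrite -inmap_hom // (compat_cmap _ cf) => /refl_exact[e ee].
have /ex[m em] : g i e = 0.
  apply: xN; rewrite outmap_hom // ee.
  by apply/(hexact_cmap _ ex); exists p0.
suff -> : p0 = outmap L m by rewrite inmap_outmap.
apply: (lfun_inj (fun z => cmap_inj (fun k x _ => fi k x))).
by rewrite -outmap_hom // em ee.
Qed.

Lemma unrefl_inj : hinj f' -> Xc L -> hinj f.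
Proof.
move=> fi xL j v; have [ji|ji] := eqVneq j i; last first.
  move=> e; apply: (refl_to_inj (r := rl) ji); apply: fi.
  by rewrite cf // e linear0.
move: v; rewrite ji => v e; apply: xL; apply: (cmap_to_inj (r := rl)).
apply: (cmap_inj (f := f')) => [k x _|]; first exact: fi.
by rewrite (compat_cmap _ cf) -outmap_hom // e !linear0.
Qed.

Lemma unrefl_surj : hsurj g' -> hexact f' g' -> hinj f' -> Yc L' -> Xc N -> hsurj g.
Proof.
move=> gs ex fi yL xN j w; have [ji|ji] := eqVneq j i; last first.
  have [x ex'] := gs j (refl_to rn j w); have [y ey] := refl_to_surj rm x ji.
  exists y; by apply: (lfun_inj (fun v => @refl_to_inj _ _ rn _ v ji)); rewrite -cg // ey ex'.
move: w; rewrite ji => w.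
have [p' ep] : exists p', cmap a g' p' = cmap a (refl_to rn) (outmap N w).
  by apply: cmap_surj => k v _; apply: gs.
have /ex[l el] : g' i (inmap M' p') = 0 by rewrite -inmap_hom // ep inmap_outmap.
(* Subtracting the image of [pl] puts the lift into the kernel of [inmap], that is, into the image
   of [outmap M]. *)
have [pl epl] := yL l; have [p0 ep0] := cmap_to_surj rm (p' - cmap a f' pl).
have [m em] : exists m, outmap M m = p0.
  by apply/(refl_exact rm); rewrite ep0 linearB /= inmap_hom // epl el subrr.
exists m; apply: (lfun_inj xN); rewrite outmap_hom // em.
apply: (lfun_inj (cmap_to_inj (r := rn))); rewrite -(compat_cmap _ cg) ep0 linearB /= ep.
have -> : cmap a g' (cmap a f' pl) = 0 by apply/(hexact_cmap _ ex); exists pl.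
by rewrite subr0.
Qed.

Lemma unrefl_exact : hexact f' g' -> hinj f' -> Yc L' -> Xc M -> Xc N -> hexact f g.
Proof.
move=> ex fi yL xM xN j v; have [ji|ji] := eqVneq j i; last first.
  split=> [e|[u <-]].
    have /ex[u eu] : g' j (refl_to rm j v) = 0 by rewrite cg // e linear0.
    have [u0 eu0] := refl_to_surj rl u ji; exists u0.
    by apply: (lfun_inj (fun v => @refl_to_inj _ _ rm _ v ji)); rewrite -cf // eu0 eu.
  apply: (refl_to_inj (r := rn) ji); rewrite -cg // -cf //.
  by apply/ex; exists (refl_to rl j u).
move: v; rewrite ji => v; split=> [e|[u <-]]; last first.
  apply: xN; rewrite !outmap_hom //; apply: (cmap_to_inj (r := rn)).
  rewrite -(compat_cmap _ cg) -(compat_cmap _ cf).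
  by apply/(hexact_cmap _ ex); exists (cmap a (refl_to rl) (outmap L u)).
have /(hexact_cmap _ ex)[p' ep] : cmap a g' (cmap a (refl_to rm) (outmap M v)) = 0.
  by rewrite (compat_cmap _ cg) -outmap_hom // e !linear0.
have [pl epl] := cmap_to_surj rl p'.
have [u eu] : exists u, outmap L u = pl.
  apply/(refl_exact rl); rewrite epl; apply: fi.
  by rewrite -inmap_hom // ep inmap_outmap.
exists u; apply: (lfun_inj xM); rewrite outmap_hom // eu.
by apply: (lfun_inj (cmap_to_inj (r := rm))); rewrite -(compat_cmap _ cf) epl ep.
Qed.

End Exactness.

(** The cokernel of [h] is concentrated at [i] and therefore in [T]; [N] is an extension of it by
    the image of [h]. *)
Lemma almost_surj T M N (h : M ~> N) :
  tcl A d c T -> (forall X, is_rep c X -> conc i X -> T X) ->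
  T M -> is_rep c N -> is_hom h -> (forall j w, j != i -> exists v, h j v = w) -> T N.
Proof.
move=> tT cT TM rN hh hs.
have [P [g [rP hg gs gU]]] := quorep_ex rN (stable_limg hh).
have ex : hexact h g.
  move=> j v; rewrite gU; split=> [/memv_imgP[u _ ->]|[u <-]]; first by exists u.
  by rewrite memv_img ?memvf.
apply: (tcl_ext_weak tT rN hh hg gs ex TM); apply: cT => // j w ji.
have [v <-] := gs j w; apply/gU; have [u <-] := hs j v ji.
by rewrite memv_img ?memvf.
Qed.

Definition refl_class (T : rep -> Prop) M' :=
  Yc M' /\ exists M (_ : refl_pair M M'), Xc M /\ T M.

(** Unlike [refl_class], this admits [M] with subrepresentations concentrated at [i].
    Representations concentrated at [i] reflect to zero and so enter the class. *)
Definition corefl_class (T' : rep -> Prop) M := exists M' (_ : refl_pair M M'), T' M'.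

(** Reflected back, a surjection is onto only away from [i]; its cokernel, concentrated at [i], is
    supplied by [cT]. *)
Lemma refl_class_tcl T : tcl A d c T -> (forall X, is_rep c X -> conc i X -> T X) ->
  tcl A d cr (refl_class T).
Proof.
move=> tT cT; split.
- by move=> M' [_ [M [r _]]]; apply: refl_rep' r.
- move=> M' rM' z; split; first by move=> m; exists 0; rewrite linear0 (z _ m).
  have [M [r xM]] := ker_refl rM'; exists M, r; split=> //.
  apply: (tcl_zero tT (refl_rep r)) => j v; have [ji|ji] := eqVneq j i; last first.
    by apply: (refl_to_inj (r := r) ji); apply: z.
  move: v; rewrite ji => v; apply: xM; apply: (cmap_to_inj (r := r)).
  by apply: coind_eq => k l _; rewrite (z _ (cco k l _)) linear0.
- move=> M' N' h' [yM [M [r [xM TM]]]] rN' hh' hs'.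
  split; first exact: Yc_quot hh' hs' yM.
  have [N [q xN]] := ker_refl rN'; exists N, q; split=> //.
  have [h [hh ch]] := hom_from_refl r q xN hh'.
  apply: (almost_surj tT cT TM (refl_rep q) hh) => j w ji.
  have [v' ev] := hs' j (refl_to q j w); have [v ev'] := refl_to_surj r v' ji.
  exists v; by apply: (lfun_inj (fun v => @refl_to_inj _ _ q _ v ji)); rewrite ch // ev' ev.
- move=> L' M' N' f' g' rM' hf' hg' fi' gs' ex' [yL [L [rl [xL TL]]]] [yN [N [rn [xN TN]]]].
  have yM := Yc_ext hf' hg' gs' ex' yL yN; split=> //.
  have [M [rm xM]] := ker_refl rM'; exists M, rm; split=> //.
  have [f [hf cf]] := hom_from_refl rl rm xM hf'.
  have [g [hg cg]] := hom_from_refl rm rn xN hg'.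
  have cf' : compat rl rm f f' by move=> j v ji; rewrite cf.
  have cg' : compat rm rn g g' by move=> j v ji; rewrite cg.
  apply: (tcl_ext tT (refl_rep rm) hf hg _ _ _ TL TN).
  + exact: (unrefl_inj hf cf' fi' xL).
  + exact: (unrefl_surj hg hf' hg' cg' gs' ex' fi' yL xN).
  + exact: (unrefl_exact hf hg hf' cf' cg' ex' fi' yL xM xN).
Qed.

Lemma corefl_class_tcl T' : tcl A d cr T' -> (forall M', T' M' -> Yc M') ->
  tcl A d c (corefl_class T').
Proof.
move=> tT yT; split.
- by move=> M [M' [r _]]; apply: refl_rep r.
- move=> M rM z; have [M' [r yM]] := coker_refl rM; exists M', r.
  apply: (tcl_zero tT (refl_rep' r)) => j v; have [ji|ji] := eqVneq j i; last first.
    by have [u <-] := refl_to_surj r v ji; rewrite (z _ u) linear0.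
  move: v; rewrite ji => v; have [p <-] := yM v; have [p0 <-] := cmap_to_surj r p.
  rewrite (_ : p0 = 0) ?linear0 //.
  by apply: coind_eq => k l _; rewrite (z _ (cco k l _)) linear0.
- move=> M N h [M' [r TM']] rN hh hs; have [N' [q yN]] := coker_refl rN; exists N', q.
  have [h' [hh' ch]] := hom_to_refl r q (yT _ TM') hh.
  apply: (tcl_quot tT TM' (refl_rep' q) hh').
  exact: (refl_surj hh' ch hs yN).
- move=> L M N f g rM hf hg fi gs ex [L' [rl TL]] [N' [rn TN]].
  have [M' [rm yM]] := coker_refl rM; exists M', rm.
  have [f' [hf' cf]] := hom_to_refl rl rm (yT _ TL) hf.
  have [g' [hg' cg]] := hom_to_refl rm rn yM hg.
  apply: (tcl_ext_weak tT (refl_rep' rm) hf' hg' _ _ TL TN).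
  + exact: (refl_surj hg' cg gs (yT _ TN)).
  + exact: (refl_exactness hg hf' hg' cf cg gs ex (yT _ TL) yM).
Qed.

(** Reflecting [M] to [M'] and back to [M2] divides out the largest subrepresentation concentrated
    at [i]. [M2] passes from [T] to [U] through [M'], and [M] is an extension of [M2] by that
    subrepresentation. *)
Lemma refl_class_le T U : tcl A d c T -> tcl A d c U ->
  (forall X, is_rep c X -> conc i X -> T X) -> (forall X, is_rep c X -> conc i X -> U X) ->
  (forall M', refl_class T M' -> refl_class U M') -> forall M, T M -> U M.
Proof.
move=> tT tU cT cU le M TM; have rM := tcl_rep tT TM.
have [M' [r yM]] := coker_refl rM; have [M2 [q xM2]] := ker_refl (refl_rep' r).
have [h [hh ch]] := hom_from_refl r q xM2 (hom_id M').
have hs j w : j != i -> exists v, h j v = w.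
  move=> ji; have [v ev] := refl_to_surj r (refl_to q j w) ji; exists v.
  by apply: (lfun_inj (fun v => @refl_to_inj _ _ q _ v ji)); rewrite ch // id_lfunE ev.
have TM2 : T M2 by apply: almost_surj tT cT TM (refl_rep q) hh hs.
(* Membership in [refl_class U] provides some [M3] over [M'], possibly other than [M2]; it maps to
   [M2], onto away from [i]. *)
have [|_ [M3 [q3 [xM3 UM3]]]] := le M'; first by split=> //; exists M2, q.
have [h3 [hh3 ch3]] := hom_from_refl q3 q xM2 (hom_id M').
have UM2 : U M2.
  apply: almost_surj tU cU UM3 (refl_rep q) hh3 _ => j w ji.
  have [v ev] := refl_to_surj q3 (refl_to q j w) ji; exists v.
  by apply: (lfun_inj (fun v => @refl_to_inj _ _ q _ v ji)); rewrite ch3 // id_lfunE ev.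
have cmq p : cmap a (refl_to q) (cmap a h p) = cmap a (refl_to r) p.
  rewrite cmap_comp; apply: eq_cmap => j v /mult_gt0 ji.
  by rewrite comp_lfunE ch // id_lfunE.
have hs2 : hsurj h.
  move=> j w; have [ji|] := eqVneq j i; last exact: hs.
  move: w; rewrite ji => w; have [p ep] := cmap_to_surj r (cmap a (refl_to q) (outmap M2 w)).
  have [m em] : exists m, outmap M m = p.
    by apply/(refl_exact r); rewrite ep inmap_outmap.
  exists m; apply: (lfun_inj xM2); rewrite outmap_hom // em.
  by apply: (lfun_inj (cmap_to_inj (r := q))); rewrite cmq ep.
have [|L [f [rL hf fi fE]]] := subrep_ex (U := fun j => lker (h j)) rM.
  split=> [j v|j k v]; rewrite !memv_ker => /eqP e.
    by rewrite hh.1 e linear0.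
  by rewrite hh.2 e linear0.
have ex : hexact f h.
  by move=> j v; rewrite -fE memv_ker; split=> /eqP.
apply: (tcl_ext tU rM hf hh fi hs2 ex _ UM2); apply: cU => // j v ji.
apply: fi; have /ex e : exists u, f j u = f j v by exists v.
apply: (refl_to_inj (r := r) ji); have := ch j (f j v) ji.
by rewrite e linear0 id_lfunE.
Qed.

(** A vector killed by [cx] is supported on the copies 0, where it is killed by the [b j]-th power
    of the loop; freeness of M_j writes it there as a power d_j - b_j. *)
Lemma coind_free M : (forall j, j != i -> free_over (eps M j) (d j)) ->
  free_over (cxM M) (d i).
Proof.
move=> lf p e.
have pk j k : (k.+1 < a j)%N -> cco j k.+1 p = 0.
  by move=> ka; have := cco_cx (eps M) b p (ltnW ka); rewrite e linear0 ka.
have p0 j : (0 < a j)%N -> lpow (eps M j) (b j) (cco j 0 p) = 0.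
  move=> aj; have lt : ((a j).-1 < a j)%N by rewrite prednK.
  by have := cco_cx (eps M) b p lt; rewrite e linear0 prednK // ltnn.
have dk j : (0 < a j)%N -> exists k, d i = (a j * k.+1)%N /\ d j = (b j * k.+1)%N.
  move=> aj; have ji := mult_gt0 aj; have a1 : A j i != 0%N by rewrite -mult_other // -lt0n.
  have [[|k] [dj di]] := A_d ji a1; first by have := d_gt0 j; rewrite dj muln0.
  by exists k; rewrite mult_other.
have hq j : exists v, (0 < a j)%N -> cco j 0 p = lpow (eps M j) (d j - b j) v.
  have [aj|aj] := posnP (a j); first by exists 0.
  have [k [_ dj]] := dk j aj.
  have [|u eu] := free_ker (d_gt0 j) (lf j (mult_gt0 aj)) _ (p0 j aj); last by exists u.
  by rewrite dj mulnS leq_addr.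
pose v j := projT1 (cid (hq j)).
(* With d_i = a_j (l + 1), d_i - 1 steps bring the last copy at [j] to copy 0 after l rounds, with
   exponent b_j l = d_j - b_j. *)
exists (cmk (fun j k => if k == (a j).-1 then v j else 0)).
apply: coind_eq => j k ka; have aj : (0 < a j)%N by apply: leq_ltn_trans ka.
have [l [di dj]] := dk j aj.
rewrite cco_cx_pow // cmkK ?ltn_mod //.
have -> : ((d i).-1 + k = l * a j + ((a j).-1 + k))%N by rewrite di mulnS; lia.
rewrite divnMDl // modnMDl; case: k ka => [|k] ka.
  rewrite addn0 divn_small ?modn_small ?prednK // eqxx addn0.
  rewrite (projT2 (cid (hq j))) //; congr (lpow _ _ _).
  by rewrite dj mulnS addKn.
rewrite pk // (_ : (a j).-1 + k.+1 = a j + k)%N; last by lia.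
rewrite modnDl modn_small 1?ltnW // (_ : k == _ = false) ?linear0 //.
by apply/eqP; lia.
Qed.

(* If [outmap] is not injective, a vector [k] outside the image of the loop is sent
   into the image of [cx]. The self-extensions of [M] twisted by H_i-maps
   [psi : M_i -> coind M] split; evaluating the splitting at [k] makes [outmap]
   surjective modulo the nilpotent [cx]. *)
Lemma rigid_out M : is_rep c M -> rigid A d c M -> locfree d M ->
  Xc M \/ forall p, exists m, outmap M m = p.
Proof.
move=> rM gM lf; set cx' := cxM M; have nM := rep_nil rM.
have cf := coind_free (fun j _ => lf j).
have cn p : lpow cx' (d i) p = 0 by apply: cx_nil => j v; apply: nM.
have outp l m : outmap M (lpow (eps M i) l m) = lpow cx' l (outmap M m).
  by apply: lpow_comm => u; apply: outmap_eps.
(* Under this condition a vector killed by [outmap] is divisible by every power of the loop, hence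
   0. *)
have [h|h] := pselect (forall k, outmap M k \in limg cx' -> k \in limg (eps M i)).
  left=> m em; suff [k ->] : exists k, m = lpow (eps M i) (d i) k by rewrite nM.
  have: (d i <= d i)%N by [].
  elim: {1 3}(d i) => [|l IH] ld; first by exists m; rewrite lpow0.
  have [k ek] := IH (ltnW ld).
  have : lpow cx' l (outmap M k) = 0 by rewrite -outp -ek.
  move=> /(free_ker (d_gt0 i) cf (ltnW ld))[q eq].
  have : outmap M k \in limg cx'.
    have de : (d i - l = (d i - l.+1).+1)%N by lia.
    by rewrite eq de lpowS memv_img ?memvf.
  by move=> /h/memv_imgP[k' _ ek']; exists k'; rewrite lpowSr -ek'.
right; move/existsNP: h => [k /not_implyP[/memv_imgP[q _ eq] /negP nk]].
have x0 : lpow (eps M i) (d i).-1 k != 0.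
  apply: contra nk => /eqP /(free_im (d_gt0 i) (lf i))[u ->].
  by rewrite memv_img ?memvf.
have [la [la1 _]] : exists f : 'Hom(M i, K^o), f (lpow (eps M i) (d i).-1 k) = 1 /\
    forall u, u \in 0%VS -> f u = 0 by apply: functional; rewrite memv0.
have key t : exists m q, t = outmap M m + cx' q.
  (* H_i is a Frobenius algebra: the linear form [la] extends to this loop-linear map. Since [la] is
     1 on eps^(d_i - 1) k, the vector [psi k] is [t] modulo the image of [cx]. *)
  pose psi : 'Hom(M i, coind a M) := linfun (fun v =>
    \sum_(l < d i) (la (lpow (eps M i) ((d i).-1 - l) v) : K) *: lpow cx' l t).
  have psiE v : psi v =
      \sum_(l < d i) (la (lpow (eps M i) ((d i).-1 - l) v) : K) *: lpow cx' l t.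
    rewrite /psi linfun_linearE // => z u w; rewrite scaler_sumr -big_split /=.
    by apply: eq_bigr => l _; rewrite !linearP /= scalerDl scalerA.
  have psix v : psi (eps M i v) = cx' (psi v).
    rewrite !psiE linear_sum; have := d_gt0 i; have := nM i; have := cn.
    case: (d i) => // D cD nD _.
    rewrite big_ord_recl big_ord_recr /= subn0 -lpowSr nD !linear0 scale0r add0r.
    rewrite linearZ /= -lpowS cD scaler0 addr0; apply: eq_bigr => l _.
    rewrite linearZ /= -!lpowSr -lpowS; congr ((la (lpow _ _ v) : K) *: _).
    by rewrite /bump /= add1n; have := ltn_ord l; lia.
  have psip l v : psi (lpow (eps M i) l v) = lpow cx' l (psi v) by apply: lpow_comm.
  pose B j l : 'Hom(M j, M l) := (cco l 0 \o psi \o dlt M j i)%VF.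
  have Bi l v : B i l v = cco l 0 (psi v) by rewrite !comp_lfunE dlt_id.
  have Bj j l v : j != i -> B j l v = 0.
    by move=> ji; rewrite !comp_lfunE dlt_neq // !linear0.
  have [||h [he hB]] := @rigid_coboundary K n A d c M B rM gM.
  - move=> j l v na; have [ji|] := eqVneq j i; last exact: Bj.
    move: v na; rewrite ji => v; rewrite arrow_at_out negb_and negbK Bi.
    have [->|li] := eqVneq l i; first by rewrite cco_out // mult_self.
    case/orP=> [lc|/eqP A0]; first by rewrite (rep_supp rM (cco l 0 (psi v))) // inE negb_or li.
    by rewrite cco_out // mult_other // A_sym.
  - move=> j l v; have [ji|ji] := eqVneq j i; last by rewrite !Bj // linear0.
    move: v; rewrite ji => v; rewrite !Bi.
    have [a0|al] := posnP (a l); first by rewrite !cco_out ?a0 ?linear0.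
    by rewrite -(mult_other (mult_gt0 al)) psip /cx' cco_cxa.
  have psiB v : psi v = cmap a h (outmap M v) - outmap M (h i v).
    apply: coind_eq => j l la'; rewrite -(cco_cx0 (eps M) b _ la') -psip -Bi hB.
    rewrite linearB /= cco_cmap !cco_out_map //; congr (_ - arr _ _ _ _).
    exact: lpow_comm.
  exists (- h i k).
  have [w ew] : exists w, psi k = t + cx' w.
    rewrite psiE; have := d_gt0 i; have := la1; case: (d i) => //= D l1 _.
    exists (\sum_(l < D) (la (lpow (eps M i) (D - l.+1) k) : K) *: lpow cx' l t).
    rewrite big_ord_recl /= subn0 l1 scale1r lpow0 linear_sum; congr (_ + _).
    by apply: eq_bigr => l _; rewrite linearZ /= -lpowS.
  have ch : cmap a h (cx' q) = cx' (cmap a h q).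
    by apply: cmap_cx => j v _; apply: he.
  have et : t = cmap a h (outmap M k) - outmap M (h i k) - cx' w.
    by rewrite -psiB ew addrK.
  exists (cmap a h q - w); rewrite {1}et linearN linearB /= -ch -eq.
  by rewrite addrA [X in X - _]addrC.
(* Iterating [key] pushes the error into higher powers of [cx], and the [d i]-th power is 0. *)
have key2 l t : exists m q, t = outmap M m + lpow cx' l q.
  elim: l => [|l [m [q' ->]]]; first by exists 0, t; rewrite linear0 add0r lpow0.
  have [m' [q2 ->]] := key q'.
  exists (m + lpow (eps M i) l m'), q2.
  by rewrite !linearD /= outp lpowSr addrA.
by move=> p; have [m [q' ->]] := key2 (d i) p; exists m; rewrite cn addr0.
Qed.

Lemma coind_rank M m : (forall j, j != i -> \dim {:M j} = (d j * m j)%N) ->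
  \dim {:coind a M} = (d i * \sum_(j | j != i) A i j * m j)%N.
Proof.
move=> rk; rewrite dim_coind (bigD1 i) //= mult_self mul0n add0n big_distrr /=.
apply: eq_bigr => j ji; rewrite rk // mult_other // !mulnA; congr (_ * _)%N.
have [a0|a1] := posnP (A j i); first by rewrite a0 (A_sym a0) muln0.
have [|k [-> ->]] := A_d ji; first by rewrite -lt0n.
by rewrite -[RHS]mulnA (mulnC k).
Qed.

(** In the surjective case of [rigid_out], the bound on [m i] makes the source no larger than the
    target, so [outmap] is injective too. *)
Lemma rigid_Xc M m : is_rep c M -> rigid A d c M -> locfree d M -> has_rank d M m ->
  (m i <= \sum_(j | j != i) A i j * m j)%N -> Xc M.
Proof.
move=> rM gM lf rk mi; have [//|surj] := rigid_out rM gM lf.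
have dc : \dim {:coind a M} = (d i * \sum_(j | j != i) A i j * m j)%N.
  by apply: coind_rank => j _; apply: rk.
have := limg_ker_dim (outmap M) fullv; rewrite capfv.
have -> : limg (outmap M) = fullv.
  by apply/vspaceP => p; rewrite memvf; have [x <-] := surj p; rewrite memv_img ?memvf.
rewrite dc (rk i) => e x ex; have k0 : \dim (lker (outmap M)) = 0%N.
  have : (d i * m i <= d i * \sum_(j | j != i) A i j * m j)%N by rewrite leq_mul2l mi orbT.
  by rewrite -e; lia.
apply/eqP; rewrite -memv0; move/eqP: k0; rewrite dimv_eq0 => /eqP <-.
by rewrite memv_ker ex.
Qed.

Section PairTransfer.
Variables (M M' : rep) (r : refl_pair M M').
Hypotheses (xM : Xc M) (yM : Yc M').

Let rM := refl_rep r.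
Let rM' := refl_rep' r.
Let rin : 'Hom(coind a M, M' i) := (inmap M' \o cmap a (refl_to r))%VF.

Let rinE p : rin p = inmap M' (cmap a (refl_to r) p).
Proof. exact: comp_lfunE. Qed.

Let rin_surj w : exists p, rin p = w.
Proof.
have [p <-] := yM w; have [p0 <-] := cmap_to_surj r p.
by exists p0; rewrite rinE.
Qed.

Let rin_ex p : rin p = 0 <-> exists m, outmap M m = p.
Proof. by rewrite rinE; apply: refl_exact. Qed.

Let rin_cx l p : rin (lpow (cxM M) l p) = lpow (eps M' i) l (rin p).
Proof.
apply: lpow_comm => q; rewrite !rinE -inmap_cx //; congr (inmap M' _).
by apply: cmap_cx => j v /mult_gt0 ji; apply: refl_eps.
Qed.

Let out_cx l m : outmap M (lpow (eps M i) l m) = lpow (cxM M) l (outmap M m).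
Proof. by apply: lpow_comm => u; apply: outmap_eps. Qed.

Lemma refl_dim_other j : j != i -> \dim {:M j} = \dim {:M' j}.
Proof.
move=> ji; apply: (bij_dim (f := refl_to r j)); last by move=> w; apply: refl_to_surj.
by move=> v; apply: refl_to_inj.
Qed.

Lemma refl_dim : \dim {:coind a M} = (\dim {:M i} + \dim {:M' i})%N.
Proof. exact: (exact_dim (f := outmap M) (g := rin)). Qed.

Lemma refl_rank m m' : (forall j, j != i -> m' j = m j) ->
  (m i + m' i = \sum_(j | j != i) A i j * m j)%N -> has_rank d M m <-> has_rank d M' m'.
Proof.
move=> mm mi; split=> rk j.
- have [->|ji] := eqVneq j i; last by rewrite -refl_dim_other // mm.
  have := refl_dim; rewrite (@coind_rank M m) => [|k _]; last exact: rk.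
  by rewrite -mi rk mulnDr => /addnI.
- have rk' k : k != i -> \dim {:M k} = (d k * m k)%N.
    by move=> ki; rewrite refl_dim_other // rk mm.
  have [->|ji] := eqVneq j i; last exact: rk'.
  by have := refl_dim; rewrite (coind_rank rk') -mi rk mulnDr => /addIn.
Qed.

(** H_i is self-injective: in a short exact sequence with free middle term, here [coind M], the
    kernel is free if and only if the cokernel is. *)
Lemma refl_locfree : locfree d M <-> locfree d M'.
Proof.
have other j : j != i -> (free_over (eps M j) (d j) <-> free_over (eps M' j) (d j)).
  move=> ji; have to_pow k v : refl_to r j (lpow (eps M j) k v) = lpow (eps M' j) k (refl_to r j v).
    by apply: lpow_comm => u; apply: refl_eps.
  split=> ff v e.
    have [w ew] := refl_to_surj r v ji; rewrite -ew.
    have /ff[u ->] : eps M j w = 0.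
      by apply: (refl_to_inj (r := r) ji); rewrite refl_eps // ew.
    by exists (refl_to r j u); rewrite to_pow.
  have /ff[u eu] : eps M' j (refl_to r j v) = 0 by rewrite -refl_eps // e linear0.
  have [u0 eu0] := refl_to_surj r u ji; exists u0.
  by apply: (lfun_inj (fun v => @refl_to_inj _ _ r _ v ji)); rewrite to_pow eu0 eu.
have nM := rep_nil rM; have nM' := rep_nil rM'.
have outinj x y : outmap M x = outmap M y -> x = y.
  by apply: lfun_inj => z; apply: xM.
split=> lf j; have [->|ji] := eqVneq j i; try by apply/(other j ji).
- move=> v; have [p <-] := rin_surj v => e.
  have [|x ex] := (rin_ex (cxM M p)).1.
    by have := rin_cx 1 p; rewrite !lpowS !lpow0 => ->.
  have /(free_im (d_gt0 i) (lf i))[x' ex'] : lpow (eps M i) (d i).-1 x = 0.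
    apply: outinj; rewrite out_cx ex linear0 -lpowSr prednK // cx_nil //.
  have [|p2 e2] := @coind_free M (fun j _ => lf j) (p - outmap M x').
    by rewrite linearB /= -outmap_eps // -ex' ex subrr.
  exists (rin p2); rewrite -rin_cx -e2 linearB /=.
  by rewrite [X in _ - X](rin_ex _).2 ?subr0 //; exists x'.
- move=> m e.
  have lfM k : k != i -> free_over (eps M k) (d k) by move=> ki; apply/(other k ki).
  have [|q eq] := coind_free lfM (v := outmap M m); first by rewrite -outmap_eps // e linear0.
  have /(free_im (d_gt0 i) (lf i))[y ey] : lpow (eps M' i) (d i).-1 (rin q) = 0.
    by rewrite -rin_cx -eq; apply/rin_ex; exists m.
  have [z ez] := rin_surj y.
  have /rin_ex[m' em'] : rin (q - cxM M z) = 0.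
    have := rin_cx 1 z; rewrite !lpowS !lpow0 linearB /= => ->.
    by rewrite ez ey subrr.
  exists m'; apply: outinj; rewrite out_cx em' linearB /= -eq -lpowSr prednK //.
  by rewrite cx_nil ?subr0.
Qed.

(** The middle term of a self-extension inherits [Xc] or [Yc], so the sequence reflects to a
    self-extension of the partner, and a splitting of that one reflects back. *)
Lemma refl_rigid : rigid A d c M <-> rigid A d cr M'.
Proof.
split=> [gM E' f' g' rE' hf' hg' fi' gs' ex'|gM E f g rE hf hg fi gs ex].
- have yE := Yc_ext hf' hg' gs' ex' yM yM.
  have [E [q xE]] := ker_refl rE'.
  have [f [hf cf0]] := hom_from_refl r q xE hf'.
  have [g [hg cg0]] := hom_from_refl q r xM hg'.
  have cf : compat r q f f' by move=> j v ji; rewrite cf0.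
  have cg : compat q r g g' by move=> j v ji; rewrite cg0.
  have [|||s [hs gs1]] := gM E f g (refl_rep q) hf hg.
  + exact: (unrefl_inj hf cf fi' xM).
  + exact: (unrefl_surj hg hf' hg' cg gs' ex' fi' yM xM).
  + exact: (unrefl_exact hf hg hf' cf cg ex' fi' yM xE xM).
  have [s' [hs' cs]] := hom_to_refl r q yM hs.
  exists s'; split=> // j v; have [ji|ji] := eqVneq j i; last first.
    by have [w <-] := refl_to_surj r v ji; rewrite cs // cg // gs1.
  move: v; rewrite ji => v; have [p <-] := yM v; have [p0 <-] := cmap_to_surj r p.
  rewrite -!inmap_hom //; congr (inmap M' _).
  rewrite (compat_cmap _ cs) (compat_cmap _ cg); congr (cmap a _ _).
  by rewrite cmap_comp cmap_id // => k u _; rewrite comp_lfunE gs1.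
- have xE := Xc_ext hf hg fi ex xM xM.
  have [E' [q yE]] := coker_refl rE.
  have [f' [hf' cf]] := hom_to_refl r q yM hf.
  have [g' [hg' cg]] := hom_to_refl q r yE hg.
  have [|||s' [hs' gs1]] := gM E' f' g' (refl_rep' q) hf' hg'.
  + exact: (refl_inj hf hg hf' cf fi ex yM xM).
  + exact: (refl_surj hg' cg gs yM).
  + exact: (refl_exactness hg hf' hg' cf cg gs ex yM yE).
  have [s [hs cs]] := hom_from_refl r q xE hs'.
  exists s; split=> // j v; have [ji|ji] := eqVneq j i; last first.
    by apply: (lfun_inj (fun v => @refl_to_inj _ _ r _ v ji)); rewrite -cg // cs // gs1.
  move: v; rewrite ji => v; apply: (lfun_inj xM).
  rewrite !outmap_hom //; apply: (lfun_inj (cmap_to_inj (r := r))).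
  rewrite -(compat_cmap _ cg) [cmap a (refl_to q) _](_ : _ =
    cmap a s' (cmap a (refl_to r) (outmap M v))); last first.
    by rewrite !cmap_comp; apply: eq_cmap => k u /mult_gt0 ki; rewrite !comp_lfunE cs.
  by rewrite [cmap a g' _]cmap_comp [cmap a _ _](_ : _ = cmap a (refl_to r) (outmap M v))
    // cmap_id // => k u _; rewrite comp_lfunE gs1.
Qed.

End PairTransfer.

(** No arrow ends at [i], so the spaces away from [i] form a subrepresentation; the quotient is
    nonzero and concentrated at [i], and [tcl_conc] spreads it to all such representations. *)
Lemma source_conc T M : tcl A d c T -> T M -> (exists v : M i, v != 0) ->
  forall X, is_rep c X -> conc i X -> T X.
Proof.
move=> tT TM M0; have rM := tcl_rep tT TM.
pose U j : {vspace M j} := if j == i then 0%VS else fullv.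
have [|N [g [rN hg gs gU]]] := quorep_ex (U := U) rM.
  split=> [j v|j k v]; rewrite /U.
    by case: (j == i); rewrite ?memvf // !memv0 => /eqP->; rewrite linear0.
  have [->|ki] := eqVneq k i; last by rewrite memvf.
  by rewrite memv0 (rep_arr rM) // arrow_at_into.
have TN := tcl_quot tT TM rN hg gs.
have cN : conc i N.
  by move=> j v ji; have [u <-] := gs j v; apply/gU; rewrite /U (negPf ji) memvf.
have N0 : exists v : N i, v != 0.
  have [v v0] := M0; exists (g i v); apply: contra_neq v0 => /gU.
  by rewrite /U eqxx memv0 => /eqP.
by move=> X rX cX; apply: tcl_conc tT TN cN N0 rX cX.
Qed.

(** [i] is a sink of the rotated word: if [inmap] is not onto, its cokernel is a nonzero quotient
    concentrated at [i]. *)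
Lemma sink_conc T' M' : tcl A d cr T' -> T' M' -> ~ Yc M' ->
  forall X, is_rep cr X -> conc i X -> T' X.
Proof.
move=> tT TM nY; have rM := tcl_rep tT TM.
(* [dlt M' i j] only carries the image of [inmap] from the type [M' i] to [M' j]. *)
pose U j : {vspace M' j} := if j == i then limg (dlt M' i j \o inmap M')%VF else fullv.
have Ui v : v \in U i <-> exists p, inmap M' p = v.
  rewrite /U eqxx; split=> [/memv_imgP[p _ ->]|[p <-]].
    by exists p; rewrite comp_lfunE dlt_id.
  by apply/memv_imgP; exists p; rewrite ?memvf // comp_lfunE dlt_id.
have Uj j v : j != i -> v \in U j by move=> ji; rewrite /U (negPf ji) memvf.
have [|N [g [rN hg gs gU]]] := quorep_ex (U := U) rM.
  split=> [j v|j k v].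
    have [ji|ji] := eqVneq j i; last by move=> _; apply: Uj.
    move: v; rewrite ji => v /Ui[p <-]; apply/Ui.
    by exists (cxM M' p); rewrite inmap_cx.
  have [ki|ki] := eqVneq k i; last by move=> _; apply: Uj.
  move=> _; rewrite ki; apply/Ui; have [a0|aj] := posnP (a j).
    exists 0; rewrite linear0 (rep_arr rM) // arrow_at_in negb_and negbK.
    have [->|ji] := eqVneq j i; first by case/andP: uc => /negPf->.
    by rewrite -(mult_other ji) a0 eqxx orbT.
  by exists (cinj j (a j).-1 v); rewrite inmap_cinj.
have TN := tcl_quot tT TM rN hg gs.
have cN : conc i N.
  by move=> j v ji; have [u <-] := gs j v; apply/gU; apply: Uj.
have N0 : exists v : N i, v != 0.
  apply: contrapT => h; apply: nY => v; apply/Ui/gU.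
  by apply: contrapT => /eqP gv; apply: h; exists (g i v).
by move=> X rX cX; apply: tcl_conc tT TN cN N0 rX cX.
Qed.

Lemma Yc_conc M' : Yc M' -> conc i M' -> forall v : M' i, v = 0.
Proof.
move=> yM cM v; have [p <-] := yM v; rewrite (_ : p = 0) ?linear0 //.
apply: coind_eq => j k ka; rewrite linear0; apply: cM.
by apply: mult_gt0; apply: leq_ltn_trans ka.
Qed.

(** The common property of the passages from [T] to [T'] by [refl_class] and from [T'] to [T] by
    [corefl_class], so that roots are compared once for both. *)
Definition refl_related (T T' : rep -> Prop) :=
  forall M M' (_ : refl_pair M M'), Xc M -> Yc M' -> (T M <-> T' M').

Lemma refl_class_related T : tcl A d c T ->
  (forall X, is_rep c X -> conc i X -> T X) -> refl_related T (refl_class T).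
Proof.
move=> tT cT M M' r xM yM; split=> [TM|[_ [M1 [r1 [_ TM1]]]]].
  by split=> //; exists M, r.
have [h [hh ch]] := hom_from_refl r1 r xM (hom_id M').
apply: almost_surj tT cT TM1 (refl_rep r) hh _ => j w ji.
have [v ev] := refl_to_surj r1 (refl_to r j w) ji; exists v.
by apply: (lfun_inj (fun v => @refl_to_inj _ _ r _ v ji)); rewrite ch // id_lfunE ev.
Qed.

Lemma corefl_class_related T' : tcl A d cr T' -> (forall M', T' M' -> Yc M') ->
  refl_related (corefl_class T') T'.
Proof.
move=> tT yT M M' r xM yM; split=> [[M1 [r1 TM1]]|TM]; last by exists M', r.
have [h [hh ch]] := hom_to_refl r1 r (yT _ TM1) (hom_id M).
apply: (tcl_quot tT TM1 (refl_rep' r) hh); apply: (refl_surj hh ch _ yM) => j w.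
by exists w; rewrite id_lfunE.
Qed.

End Reflection.

(** * The free module of rank one at a vertex *)

Section Projective.
Variables (K : fieldType) (D : nat).
Hypothesis D0 : (0 < D)%N.

(* The regular module of [K[x]/(x^D)], as a coinduced module over one vertex. *)
Lemma jordan_block : exists (C : vectType K) (f : 'End(C)),
  [/\ \dim {:C} = D, forall v, lpow f D v = 0, free_over f D &
    forall (X : vectType K) (e : 'End(X)) (g : 'Hom(X, C)),
      (forall v, lpow e D v = 0) -> (forall v, g (e v) = f (g v)) ->
      (forall w, exists v, g v = w) ->
      exists s : 'Hom(C, X), (forall v, s (f v) = e (s v)) /\ forall v, g (s v) = v].
Proof.
pose a (j : 'I_1) := D; pose S (j : 'I_1) : vectType K := K^o.
pose z (j : 'I_1) : 'End(S j) := 0; pose b (j : 'I_1) := 1%N.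
pose f : 'End(coind a S) := cx z b; pose o : 'I_1 := ord0.
have zb k v : lpow (z o) (b o * k.+1) v = 0.
  by rewrite mul1n lpowS zero_lfunE.
have jo (j : 'I_1) : j = o by rewrite ord1.
have last_lt : (D.-1 < D)%N by rewrite prednK.
have fn v : lpow f D v = 0.
  apply: coind_eq => j k ka; rewrite (jo j) cco_cx_pow // linear0.
  by rewrite divnDl // divnn D0 add1n zb.
exists (coind a S), f; split=> //.
- by rewrite dim_coind big_ord1 dimvf /dim /= muln1.
- move=> p e; exists (cinj o D.-1 (cco o 0 p)).
  have e0 : lpow f D.-1 (cinj o (0 + D.-1)%N (cco o 0 p)) = cinj o 0 (cco o 0 p).
    by rewrite cx_cinj_pow.
  rewrite add0n in e0; rewrite e0; apply: coind_eq => j k ka; rewrite (jo j).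
  rewrite cco_cinj //; case: k ka => [|k] ka; first by rewrite dlt_id.
  have ka' : (k.+1 < a o)%N by [].
  by have := cco_cx z b p (ltnW ka'); rewrite -/f e linear0 ka'.
- move=> X e g en gf gs.
  have [x0 ex0] := gs (cinj o D.-1 (1 : S o)).
  (* [x0] lifts the generator, which sits in the last copy; the basis vector of copy [k] is its
     image under D - 1 - k loops. *)
  pose s : 'Hom(coind a S, X) :=
    linfun (fun v : coind a S => \sum_(k < D) (cco o k v : K) *: lpow e (D - k.+1) x0).
  have sE (v : coind a S) : s v = \sum_(k < D) (cco o k v : K) *: lpow e (D - k.+1) x0.
    rewrite /s linfun_linearE // => u x y; rewrite scaler_sumr -big_split /=.
    by apply: eq_bigr => k _; rewrite linearP scalerDl scalerA.
  have gpow k x : g (lpow e k x) = lpow f k (g x) by apply: lpow_comm.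
  exists s; split=> v.
    (* Both sides are the same sum with the index shifted by one; the end terms vanish because e^D =
       0 and there is no copy [D]. *)
    pose G k := (cco o k v : K) *: lpow e (D - k) x0.
    have G0 : G 0%N = 0 by rewrite /G subn0 en scaler0.
    have GD : G D = 0 by rewrite /G cco_out // scale0r.
    have -> : s (f v) = \sum_(k < D) G k.+1.
      rewrite sE; apply: eq_bigr => k _; rewrite /G cco_cx ?ltn_ord //.
      case: ifP => // /negbT; rewrite -leqNgt => Dk.
      by rewrite lpowS zero_lfunE cco_out.
    have -> : e (s v) = \sum_(k < D) G k.
      rewrite sE linear_sum; apply: eq_bigr => k _.
      rewrite linearZ /= -lpowS /G; congr (_ *: lpow _ _ _).
      by have := ltn_ord k; lia.
    have : \sum_(k < D.+1) G k = \sum_(k < D) G k by rewrite big_ord_recr /= GD addr0.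
    rewrite big_ord_recl G0 add0r => <-.
    by [].
  rewrite sE linear_sum {2}[v]cinj_sum big_ord1 /=; apply: eq_bigr => k _.
  rewrite linearZ /= gpow ex0.
  have -> : (D.-1 = k + (D - k.+1))%N by have := ltn_ord k; lia.
  rewrite cx_cinj_pow -?linearZ; last by have := ltn_ord k; rewrite /a; lia.
  by congr (cinj _ _ _); rewrite /GRing.scale /= mulr1.
Qed.

End Projective.

Section Vertex.
Variables (K : fieldType) (n : nat) (A : 'I_n -> 'I_n -> nat) (d : 'I_n -> nat).
Hypothesis d_gt0 : forall i, (0 < d i)%N.

(** Any self-extension of the free H_i-module of rank one placed at [i] is again concentrated at
    [i]; it is a sequence of H_i-modules and splits by projectivity. *)
Lemma vertex_module i c : i \in c -> exists E : rep K n,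
  [/\ is_rep A d c E, conc i E, locfree d E, rigid A d c E &
    has_rank d E (fun j => (j == i : nat))].
Proof.
move=> ic; have [C [f [dC fn ff fs]]] := jordan_block K (d_gt0 i).
pose S (j : 'I_n) : vectType K := 'rV[K]_0.
pose pt := ovr_put i C S; pose gt := ovr_get i C S.
pose E := @Rep K n (ovr i C S) (fun j => pt j \o f \o gt j)%VF (fun j k => 0).
have cE : conc i E.
  move=> j v ji; rewrite -[v]ovr_outK // (_ : ovr_out i C S j v = 0) ?linear0 //.
  exact: (thinmx0 (ovr_out i C S j v : 'rV[K]_0)).
have ptE (x : E i) : exists y, x = pt i y by exists (gt i x); rewrite /pt /gt ovr_getK.
have eE x : eps E i (pt i x) = pt i (f x).
  by rewrite /= !comp_lfunE /gt /pt ovr_putK.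
have powE k x : lpow (eps E i) k (pt i x) = pt i (lpow f k x).
  by rewrite (lpow_comm (g := eps E i)) // => y; rewrite eE.
have ptI x : pt i x = 0 -> x = 0.
  by move=> e; rewrite -[x](ovr_putK i S) -/(pt i) e linear0.
have rE : is_rep A d c E.
  split=> [j x|j k x|j k x na|j x jc].
  - have [ji|ji] := eqVneq j i; last exact: cE.
    by move: x; rewrite ji => x; have [y ->] := ptE x; rewrite powE fn linear0.
  - by rewrite /= !zero_lfunE linear0.
  - exact: zero_lfunE.
  - by apply: cE; apply: contraNneq jc => ->.
exists E; split=> //.
- move=> j; have [ji|ji] := eqVneq j i; last by move=> v _; exists 0; rewrite linear0; apply: cE.
  rewrite ji => v; have [x ->] := ptE v; rewrite eE => /ptI/ff[u ->].
  by exists (pt i u); rewrite powE.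
- move=> X p q rX hp hq pi qs ex.
  pose g : 'Hom(X i, C) := (gt i \o q i)%VF.
  have gE x : g x = gt i (q i x) by exact: comp_lfunE.
  have ptg x : pt i (g x) = q i x by rewrite gE /pt /gt ovr_getK.
  have ptinj x y : pt i x = pt i y -> x = y.
    by apply: lfun_inj => z; apply: ptI.
  have [|||s [s1 s2]] := fs (X i) (eps X i) g.
  + by move=> v; apply: (rep_nil rX).
  + by move=> v; apply: ptinj; rewrite ptg -eE ptg hq.1.
  + move=> w; have [x ex'] := qs i (pt i w); exists x.
    by apply: ptinj; rewrite ptg.
  have X0 j (v : X j) : j != i -> v = 0.
    move=> ji; have /ex[u <-] : q j v = 0 by apply: cE.
    by rewrite (cE j u ji) linear0.
  have [t [ti t0]] := at_vertex (S := E) (S' := X) (i := i) (s \o gt i)%VF.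
  have {}ti x : t i (pt i x) = s x.
    by rewrite ti comp_lfunE /gt /pt ovr_putK.
  exists t; split.
    split=> [j v|j k v].
      have [ji|ji] := eqVneq j i; last by rewrite !t0 // linear0.
      by move: v; rewrite ji => v; have [x ->] := ptE v; rewrite eE !ti s1.
    rewrite /= zero_lfunE linear0.
    have [ki|ki] := eqVneq k i; last by rewrite [RHS]X0.
    have [ji|ji] := eqVneq j i; last by rewrite t0 // linear0.
    by rewrite (rep_arr rX) // /arrow_at ji ki ltnn /= !andbF.
  move=> j v; have [ji|ji] := eqVneq j i; last by rewrite [LHS]cE // [RHS]cE.
  by move: v; rewrite ji => v; have [x ->] := ptE v; rewrite ti -ptg s2.
- move=> j; have [->|ji] := eqVneq j i.
    rewrite muln1 -dC; apply/esym/(bij_dim (f := pt i)) => [u|w]; first exact: ptI.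
    by have [y ->] := ptE w; exists y.
  by rewrite muln0 dim_eq0 // => w; apply: cE.
Qed.

End Vertex.

(** * The inversion set of a torsion class *)

Section RootsOfClasses.
Variables (R : realType) (V : vectType R) (n : nat) (Phi : root_system V n).
Variables (d : 'I_n -> nat) (K : fieldType).
Hypothesis sym : symmetrizer Phi d.

Local Notation al i := (tnth (simple_roots Phi) i).
Local Notation rt := (root_seq Phi).
Local Notation pos := (positive_root Phi).
Local Notation C i j := (cartan Phi i j).
Local Notation s i := (simple_reflection Phi i).
Local Notation inv := (inversion Phi).
Local Notation co i v := (coord (simple_roots Phi) i v).

Definition acartan i j := `|C i j|%N.
Local Notation A := acartan.
Local Notation tcl := (@tcl K n A d).
Local Notation is_rep := (@is_rep K n A d).

Implicit Types (M N L : rep K n) (T U : rep K n -> Prop).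

Lemma sym_gt0 i : (0 < d i)%N. Proof. by case: sym. Qed.

Lemma acartan_sym i j : A i j = 0%N -> A j i = 0%N.
Proof.
by rewrite /acartan => /eqP; rewrite absz_eq0 cartan_eq0 => /eqP->.
Qed.

Lemma acartan_comm i j : (d i * A i j = d j * A j i)%N.
Proof.
have [_ /matrixP/(_ i j)] := sym; rewrite /acartan; move: (cartan Phi) => c.
by rewrite mxE !mul_diag_mx !mxE => /(congr1 absz); rewrite !abszM => /esym.
Qed.

(** From d_i A_ij = d_j A_ji with one of the entries equal to 1: the common factor is [d j] if A_ij
    = 1 and [d i] if A_ji = 1. *)
Lemma acartan_d i j : i != j -> A i j != 0%N ->
  exists k, d i = (A j i * k)%N /\ d j = (A i j * k)%N.
Proof.
move=> ij; rewrite absz_eq0 => c0; have := acartan_comm i j.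
case: (cartan_min ij c0) => e; rewrite /acartan e ?muln1 ?mul1n => h.
  by exists (d j); rewrite mul1n mulnC.
by exists (d i); rewrite mul1n mulnC.
Qed.

Definition coords (a : V) (m : 'I_n -> nat) := forall j, co j a = (m j)%:R.

(** As C_ii = 2, the [i]-coordinates of [a] and [s i a] add up to the rank of [coind], mirroring the
    exact sequence of a reflection. *)
Lemma coords_s i a m : coords a m ->
  co i (s i a) + (m i)%:R = (\sum_(j | j != i) A i j * m j)%N%:R.
Proof.
move=> am; rewrite co_s_self (bigD1 i) //= cartan_diag !am natr_sum.
have -> : \sum_(j | j != i) (C i j)%:~R * co j a = - \sum_(j | j != i) (A i j * m j)%:R.
  rewrite -sumrN; apply: eq_bigr => j ji; rewrite am natrM -mulNr; congr (_ * _).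
  have ij : i != j by rewrite eq_sym.
  by rewrite natr_absz ler0_norm ?cartan_le0 // mulrNz opprK.
by set x := (m i)%:R; set y := \sum_(_ | _) _; have -> : 2%:~R = 2 :> R by []; ring.
Qed.

(** The subtraction is truncated; by [coords_refl] it is exact as soon as [s i a] is positive. *)
Definition reflm i (m : 'I_n -> nat) j :=
  if j == i then (\sum_(k | k != i) A i k * m k - m i)%N else m j.

Lemma coords_refl i a m : coords a m -> pos (s i a) ->
  (m i <= \sum_(j | j != i) A i j * m j)%N /\ coords (s i a) (reflm i m).
Proof.
move=> am ps; have e := coords_s i am.
have le : (m i <= \sum_(j | j != i) A i j * m j)%N.
  by rewrite -(ler_nat R) -e lerDr pos_co.
split=> // j; rewrite /reflm; case: eqVneq => [->|ji]; last by rewrite co_s.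
by rewrite natrB // -e addrK.
Qed.

Definition has_module c (T : rep K n -> Prop) a := pos a /\
  exists M m, [/\ T M, locfree d M, rigid A d c M, has_rank d M m & coords a m].

(** The size of N(T), part of the induction measure; [undup] because [root_seq] may list a root
    twice. *)
Definition module_count c T := count (fun a => `[< has_module c T a >]) (undup rt).

Lemma eq_module_count c c2 T U : (forall a, has_module c T a <-> has_module c2 U a) ->
  module_count c T = module_count c2 U.
Proof. by move=> e; apply: eq_count => a; apply/asboolP/asboolP => /e. Qed.

Section Reflected.
Variables (i : 'I_n) (c' : seq 'I_n).
Hypothesis uc : uniq (i :: c').
Variables (T T' : rep K n -> Prop).
Hypotheses (tT : tcl (i :: c') T) (tT' : tcl (rcons c' i) T').
Hypothesis cT : forall X, is_rep (i :: c') X -> conc i X -> T X.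
Hypothesis yT : forall M, T' M -> Yc A i M.
Hypothesis TT : refl_related A d i c' T T'.

Lemma has_module_simple : has_module (i :: c') T (al i).
Proof.
have [E [rE cE lE gE kE]] := vertex_module K A sym_gt0 (mem_head i c').
split; first exact: al_pos.
by exists E, (fun j => j == i : nat); split=> //; [apply: cT | move=> j; rewrite co_al].
Qed.

(** A representation of rank [al i] is concentrated at [i], and [Yc] would make it zero. *)
Lemma has_module_simpleN : ~ has_module (rcons c' i) T' (al i).
Proof.
move=> [_ [M [m [TM _ _ rk am]]]].
have mE j : m j = (j == i).
  by apply/eqP; rewrite -(eqr_nat R) -am co_al.
have cM : conc i M.
  move=> j v ji; apply/eqP; rewrite -memv0; have := rk j; rewrite mE (negPf ji) muln0.
  by move/eqP; rewrite dimv_eq0 => /eqP <-; rewrite memvf.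
have M0 := Yc_conc (yT TM) cM.
have := rk i; rewrite mE eqxx muln1 => e; have := sym_gt0 i; rewrite -e lt0n dimv_eq0.
by move/negP; apply; apply/eqP/vspaceP => v; rewrite (M0 v) !mem0v.
Qed.

(** Going to [T'], positivity of [s i a] gives the rank bound that [rigid_Xc] asks for; going back,
    [yT] provides [Yc] directly. *)
Lemma has_module_refl a : pos a -> a != al i ->
  has_module (i :: c') T a <-> has_module (rcons c' i) T' (s i a).
Proof.
move=> pa ai; have ps := s_pos pa ai.
have AdH := acartan_d; have AsH := acartan_sym.
split=> -[_ [M [m [TM lM gM rk am]]]]; split=> //.
  have [le am'] := coords_refl am ps; have rM := tcl_rep tT TM.
  have xM := rigid_Xc sym_gt0 AsH AdH uc rM gM lM rk le.
  have [M' [r yM]] := coker_refl AdH uc rM.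
  exists M', (reflm i m); split=> //.
  - by apply/(TT r xM yM).
  - by apply/(refl_locfree sym_gt0 AdH uc r xM yM).
  - by apply/(refl_rigid AsH AdH uc r xM yM).
  apply: (proj1 (refl_rank AsH AdH r xM yM (m := m) _ _)) rk => [j ji|].
    by rewrite /reflm (negPf ji).
  by rewrite /reflm eqxx subnKC.
have pss : pos (s i (s i a)) by rewrite sK.
have [le am'] := coords_refl am pss; rewrite sK in am'.
have yM := yT TM; have rM := tcl_rep tT' TM.
have [N [r xN]] := ker_refl AsH AdH uc rM.
exists N, (reflm i m); split=> //.
- by apply/(TT r xN yM).
- by apply/(refl_locfree sym_gt0 AdH uc r xN yM).
- by apply/(refl_rigid AsH AdH uc r xN yM).
apply: (proj2 (refl_rank AsH AdH r xN yM (m := reflm i m) _ _)) rk => [j ji|].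
  by rewrite /reflm (negPf ji).
rewrite {1}/reflm eqxx subnK //; apply: eq_bigr => j ji.
by rewrite /reflm (negPf ji).
Qed.

Lemma has_module_unrefl a : has_module (rcons c' i) T' a ->
  a != al i /\ has_module (i :: c') T (s i a).
Proof.
move=> h; have pa := h.1.
have ai : a != al i by apply/eqP => e; apply: has_module_simpleN; rewrite -e.
split=> //; have psa := s_pos pa ai; have nsa := s_neq i pa.
apply: (has_module_refl psa nsa).2.
by rewrite sK.
Qed.

(** [s i] embeds the roots of [T'] into those of [T], and [al i] is not in its image. *)
Lemma module_count_refl : (module_count (rcons c' i) T' < module_count (i :: c') T)%N.
Proof.
rewrite /module_count -!size_filter; set l' := filter _ _; set l := filter _ _.
have l'P a : (a \in l') -> has_module (rcons c' i) T' a.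
  by rewrite mem_filter => /andP[/asboolP].
rewrite -(size_map (s i) l') -[_.+1]/(size (al i :: map (s i) l')).
apply: uniq_leq_size => [/=|a].
  rewrite (map_inj_uniq (can_inj (sK Phi i))) filter_uniq ?undup_uniq // andbT.
  apply/negP => /mapP[a /l'P[pa _]] /esym/eqP; apply/negP; exact: s_neq.
rewrite inE mem_filter mem_undup => /predU1P[->|/mapP[b /l'P hb ->]].
  rewrite alr andbT; apply/asboolP; exact: has_module_simple.
have [_ h] := has_module_unrefl hb; apply/andP; split; first exact/asboolP.
by case: h.1.
Qed.

End Reflected.

Lemma has_module_le c T U a : (forall M, T M -> U M) -> has_module c T a -> has_module c U a.
Proof.
by move=> TU [pa [M [m [TM lM gM rk am]]]]; split=> //; exists M, m; split=> //; apply: TU.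
Qed.

Section Drop.
Variables (i : 'I_n) (c' : seq 'I_n).
Hypothesis uc : uniq (i :: c').

Lemma arrow_at_drop j k : j != i -> k != i -> arrow_at A (i :: c') j k = arrow_at A c' j k.
Proof.
move=> ji ki; rewrite /arrow_at !inE (negPf ji) (negPf ki) /=.
by rewrite [i == j]eq_sym [i == k]eq_sym (negPf ji) (negPf ki).
Qed.

Lemma is_rep_drop M : is_rep c' M <-> is_rep (i :: c') M /\ forall v : M i, v = 0.
Proof.
have ic : i \notin c' by case/andP: uc.
split=> [rM|[rM M0]].
  split=> [|v]; last exact: (rep_supp rM).
  split; [exact: (rep_nil rM)|exact: (rep_rel rM)| |].
    move=> j k v na; apply: (rep_arr rM); apply: contra na => ja.
    have /and3P[jc kc _] := ja.
    by rewrite arrow_at_drop //; [apply: contraNneq ic => <- | apply: contraNneq ic => <-].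
  by move=> j v; rewrite inE negb_or => /andP[_]; apply: (rep_supp rM).
split; [exact: (rep_nil rM)|exact: (rep_rel rM)| |].
  move=> j k v na; have [ji|ji] := eqVneq j i.
    by move: v; rewrite ji => v; rewrite (M0 v) linear0.
  have [ki|ki] := eqVneq k i; first by move: (arr M j k v); rewrite ki.
  by apply: (rep_arr rM); rewrite arrow_at_drop.
move=> j v jc; have [ji|ji] := eqVneq j i; first by move: v; rewrite ji.
by apply: (rep_supp rM); rewrite inE negb_or ji.
Qed.

Lemma rigid_drop M : (forall v : M i, v = 0) -> rigid A d (i :: c') M <-> rigid A d c' M.
Proof.
move=> M0; split=> gM E f g rE hf hg fi gs ex; apply: (gM E f g _ hf hg fi gs ex).
  by have [] := (is_rep_drop E).1 rE.
apply/is_rep_drop; split=> // v; have /ex[u <-] : g i v = 0 by apply: M0.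
by rewrite (M0 u) linear0.
Qed.

Lemma tcl_drop T : tcl (i :: c') T -> tcl c' (fun M => T M /\ forall v : M i, v = 0).
Proof.
move=> tT; split.
- by move=> M [TM M0]; apply/is_rep_drop; split=> //; exact: (tcl_rep tT TM).
- by move=> M /is_rep_drop[rM M0] z; split=> //; exact: (tcl_zero tT rM z).
- move=> M N h [TM M0] /is_rep_drop[rN N0] hh hs; split=> //.
  exact: (tcl_quot tT TM rN hh hs).
- move=> L M N f g /is_rep_drop[rM M0] hf hg fi gs ex [TL _] [TN _]; split=> //.
  exact: (tcl_ext tT rM hf hg fi gs ex TL TN).
Qed.

Lemma tcl_undrop T : tcl c' T -> tcl (i :: c') T.
Proof.
move=> tT; have M0 M : T M -> forall v : M i, v = 0.
  by move=> TM; have [] := (is_rep_drop M).1 (tcl_rep tT TM).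
split.
- by move=> M TM; have [] := (is_rep_drop M).1 (tcl_rep tT TM).
- by move=> M rM z; apply: (tcl_zero tT) => //; apply/is_rep_drop.
- move=> M N h TM rN hh hs; apply: (tcl_quot tT TM _ hh hs).
  apply/is_rep_drop; split=> // v; have [u <-] := hs i v.
  by rewrite (M0 M TM u) linear0.
- move=> L M N f g rM hf hg fi gs ex TL TN; apply: (tcl_ext tT _ hf hg fi gs ex TL TN).
  apply/is_rep_drop; split=> // v.
  have /ex[u <-] : g i v = 0 by apply: (M0 N TN).
  by rewrite (M0 L TL u) linear0.
Qed.

Lemma has_module_drop T a : (forall M, T M -> forall v : M i, v = 0) ->
  has_module (i :: c') T a <-> has_module c' T a.
Proof.
move=> T0; split=> -[pa [M [m [TM lM gM rk am]]]]; split=> //; exists M, m; split=> //.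
  by apply/rigid_drop => //; apply: T0.
by apply/rigid_drop => //; apply: T0.
Qed.

Lemma has_module_drop0 T a : (forall M, T M -> forall v : M i, v = 0) ->
  has_module (i :: c') T a <-> has_module c' (fun M => T M /\ forall v : M i, v = 0) a.
Proof.
move=> T0; rewrite has_module_drop //; split; apply: has_module_le => M; last by case.
by move=> TM; split=> //; apply: T0.
Qed.

End Drop.

Lemma rep_nil_word M : is_rep [::] M -> forall j (v : M j), v = 0.
Proof. by move=> rM j v; apply: (rep_supp rM). Qed.

Lemma has_module_nil c T a :
  has_module c T a -> (forall M, T M -> is_rep [::] M) -> False.
Proof.
move=> [[/root_nz/eqP a0 _] [M [m [TM _ _ rk am]]]] /(_ M TM)/rep_nil_word M0.
apply: a0; apply: (@co_eq _ _ _ Phi) => j; rewrite linear0 am.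
have := rk j; rewrite (dim_eq0 (M0 j)).
by move/esym/eqP; rewrite muln_eq0 (gtn_eqF (sym_gt0 j)) => /eqP->.
Qed.

Lemma class_dichotomy i c' T : tcl (i :: c') T ->
  (forall M, T M -> forall v : M i, v = 0) \/
  (forall X, is_rep (i :: c') X -> conc i X -> T X).
Proof.
move=> tT; have [h|/existsNP[M /not_implyP[TM /existsNP[v /eqP v0]]]] :=
  pselect (forall M, T M -> forall v : M i, v = 0); first by left.
by right; apply: source_conc tT TM _; exists v.
Qed.

Theorem class_le c T U : uniq c -> tcl c T -> tcl c U ->
  (forall a, has_module c T a -> has_module c U a) -> forall M, T M -> U M.
Proof.
have [k] := ubnP (size c + module_count c T)%N.
elim: k c T U => // k IH [|i c'] T U.
  by move=> _ _ tT tU _ M TM; apply: (tcl_zero tU (tcl_rep tT TM)); apply: rep_nil_word (tcl_rep tT TM).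
move=> lt uc tT tU TU; have uc' : uniq c' by case/andP: uc.
have [T0|cT] := class_dichotomy tT.
  have tT2 := tcl_drop uc tT; have tU2 := tcl_drop uc tU.
  have TT2 a := has_module_drop0 uc a T0.
  move=> M TM; suff [] : U M /\ forall v : M i, v = 0 by [].
  apply: (IH _ _ _ _ uc' tT2 tU2); last by split=> //; apply: T0.
    by rewrite -(eq_module_count TT2); move: lt => /=; lia.
  move=> a /TT2 ha; have [pa [N [m [UN lN gN rk am]]]] := TU a ha.
  have [_ [M1 [m1 [TM1 _ _ rk1 am1]]]] := ha.
  (* Members of [U] may be nonzero at [i]. But [a] has [i]-coordinate 0, since its representation in
     [T] vanishes there, so the one in [U] vanishes there too. *)
  have N0 (v : N i) : v = 0.
    have m0 : m i = m1 i by apply/eqP; rewrite -(eqr_nat R) -am am1.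
    have : \dim {:N i} = 0%N by rewrite rk m0 -rk1 (dim_eq0 (T0 M1 TM1)).
    by move/eqP; rewrite dimv_eq0 => /eqP e0; apply/eqP; rewrite -memv0 -e0 memvf.
  split=> //; exists N, m; split=> //.
  by apply/(rigid_drop uc N0).
(* [al i] is in N(T), hence in N(U), so [U] has a member that is nonzero at [i]. *)
have cU : forall X, is_rep (i :: c') X -> conc i X -> U X.
  have [_ [E [m [UE _ _ rk am]]]] := TU _ (has_module_simple cT).
  apply: (source_conc tU UE); apply: contrapT => h.
  have := rk i; have -> : m i = 1%N by apply/eqP; rewrite -(eqr_nat R) -am co_al eqxx.
  rewrite muln1 => e; have := sym_gt0 i; rewrite -e lt0n dimv_eq0 => /negP; apply.
  apply/eqP/vspaceP => v; rewrite memvf; apply/esym.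
  suff -> : v = 0 by rewrite mem0v.
  by apply: contrapT => /eqP v0; apply: h; exists v.
have AdH := acartan_d; have AsH := acartan_sym.
have tT' := refl_class_tcl AsH AdH uc tT cT; have tU' := refl_class_tcl AsH AdH uc tU cU.
have rT := refl_class_related AsH uc tT cT; have rU := refl_class_related AsH uc tU cU.
have yT M : refl_class A d i c' T M -> Yc A i M by case.
have yU M : refl_class A d i c' U M -> Yc A i M by case.
apply: (refl_class_le AsH AdH uc tT tU cT cU) => M'; move: M'.
apply: (IH _ _ _ _ _ tT' tU'); last 2 first.
- by rewrite rcons_uniq.
- move=> a ha; have [ai hs] := has_module_unrefl uc tT tT' yT rT ha.
  have psa := hs.1; have nsa := s_neq i ha.1.
  have := (has_module_refl uc tU tU' yU rU psa nsa).1 (TU _ hs).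
  by rewrite sK.
have := module_count_refl uc tT tT' cT yT rT.
by move: lt; rewrite size_rcons /=; lia.
Qed.

Theorem class_csort c T : uniq c -> tcl c T ->
  exists2 w, csort Phi c w & forall a, has_module c T a <-> inv w a.
Proof.
have [k] := ubnP (size c + module_count c T)%N.
elim: k c T => // k IH [|i c'] T.
  move=> _ _ tT; exists \1%VF; first exact: csort_nil.
  by move=> a; split=> [/has_module_nil h|/inv_id//]; case: h => M; apply: tcl_rep.
move=> lt uc tT; have /andP[ic uc'] := uc.
have [T0|cT] := class_dichotomy tT.
  have tT2 := tcl_drop uc tT.
  have TT2 a := has_module_drop0 uc a T0.
  have [|w cw hw] := IH _ _ _ uc' tT2.
    by rewrite -(eq_module_count TT2); move: lt => /=; lia.
  exists w; first exact: csort_drop.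
  by move=> a; rewrite TT2.
have AdH := acartan_d; have AsH := acartan_sym.
have tT' := refl_class_tcl AsH AdH uc tT cT.
have rT := refl_class_related AsH uc tT cT.
have yT M : refl_class A d i c' T M -> Yc A i M by case.
have [||w cw hw] := IH _ _ _ _ tT'.
- have := module_count_refl uc tT tT' cT yT rT.
  by move: lt; rewrite size_rcons /=; lia.
- by rewrite rcons_uniq.
have ni : ~ inv w (al i) by rewrite -hw; apply: has_module_simpleN.
exists (s i \o w)%VF; first exact: csort_refl.
move=> a; split=> [ha|ia].
  apply/(inv_csort_refl cw ni ha.1); have [->|ai] := eqVneq a (al i); first by left.
  by right; split=> //; apply/hw/(has_module_refl uc tT tT' yT rT ha.1 ai).
have pa := inv_pos ia; have [->|[ai /hw h]] := (inv_csort_refl cw ni pa).1 ia.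
  exact: (has_module_simple cT).
exact: ((has_module_refl uc tT tT' yT rT pa ai).2 h).
Qed.

Theorem csort_class c w : uniq c -> csort Phi c w ->
  exists2 T, tcl c T & forall a, has_module c T a <-> inv w a.
Proof.
move=> uc cw; elim: cw uc => {c w} [|i c w cw IH|i c w cw IH ni] uc.
- exists (is_rep [::]); first by split.
  by move=> a; split=> [/has_module_nil h|/inv_id//]; case: h.
- have /andP[ic uc'] := uc; have [T tT hT] := IH uc'.
  exists T; first exact: tcl_undrop.
  move=> a; rewrite -hT; apply: has_module_drop => // M TM.
  by have [] := (is_rep_drop uc M).1 (tcl_rep tT TM).
have ucr : uniq (rcons c i) by rewrite rcons_uniq.
have [T' tT' hT] := IH ucr.
have AdH := acartan_d; have AsH := acartan_sym.
(* A member violating [Yc] would bring the free module of rank one at [i] into [T'] and make [al i]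
   an inversion of [w], against [ni]. *)
have yT M : T' M -> Yc A i M.
  move=> TM; apply: contrapT => nY; apply: ni; apply/hT.
  have ic : i \in rcons c i by rewrite mem_rcons mem_head.
  have [E [rE cE lE gE kE]] := vertex_module K A sym_gt0 ic.
  split; first exact: al_pos.
  exists E, (fun j => j == i : nat); split=> //; last by move=> j; rewrite co_al.
  exact: (sink_conc uc tT' TM nY rE cE).
pose T := corefl_class A d i c T'.
have tT : tcl (i :: c) T := corefl_class_tcl AdH uc tT' yT.
have rT : refl_related A d i c T T' := corefl_class_related uc tT' yT.
(* A representation concentrated at [i] reflects to one that is concentrated at [i] and satisfies
   [Yc], hence to zero. *)
have cT X : is_rep (i :: c) X -> conc i X -> T X.
  move=> rX cX; have [X' [r yX]] := coker_refl AdH uc rX; exists X', r.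
  apply: (tcl_zero tT' (refl_rep' r)).
  have cX' : conc i X'.
    move=> j v ji; have [u <-] := refl_to_surj r v ji.
    by rewrite (cX j u ji) linear0.
  move=> j v; have [ji|] := eqVneq j i; last exact: cX'.
  by move: v; rewrite ji; apply: Yc_conc yX cX'.
exists T => // a; split=> [ha|ia].
  apply/(inv_csort_refl cw ni ha.1); have [->|ai] := eqVneq a (al i); first by left.
  by right; split=> //; apply/hT/(has_module_refl uc tT tT' yT rT ha.1 ai).
have pa := inv_pos ia; have [->|[ai /hT h]] := (inv_csort_refl cw ni pa).1 ia.
  exact: (has_module_simple cT).
exact: ((has_module_refl uc tT tT' yT rT pa ai).2 h).
Qed.

End RootsOfClasses.

(** * Modules over the path algebra *)

(* Sealed: the unifier would otherwise compare two of these by evaluating them. *)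
HB.lock Definition vtx (K : fieldType) (Q : quiver) (v : vertex Q) : path_algebra K Q :=
  path_elt K (trivial_path v).

HB.lock Definition parr (K : fieldType) (Q : quiver) (a : arrow Q) : path_algebra K Q :=
  arrow_elt K a.

HB.lock Definition act (R : realType) (V : vectType R) (n : nat) (Phi : root_system V n)
    (c : seq 'I_n) (d : 'I_n -> nat) (K : fieldType) (N : rmod (gls_algebra Phi c d K))
    (x : path_algebra K (gls_quiver Phi c)) (m : N) : N :=
  (@quotient_pi (path_algebra K (gls_quiver Phi c)) (@gls_relation R V n Phi c d K) x :
    (gls_algebra Phi c d K)^c) *: m.

Section PathAlgebraFacts.
Variables (K : fieldType) (Q : quiver).
Local Notation PA := (path_algebra K Q).
Local Notation vtx := (@vtx K Q).
Local Notation parr := (@parr K Q).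

Lemma pa_scaleAl (k : K) (x y : PA) : k *: (x * y) = (k *: x) * y.
Proof. by rewrite -[RHS]/(path_ext _ _) linearZ. Qed.

Lemma path_extZ (h : qpath Q -> PA) (k : K) (y : PA) :
  path_ext h (k *: y) = k *: path_ext h y.
Proof. exact: linearZ. Qed.

Lemma pa_scaleAr (k : K) (x y : PA) : k *: (x * y) = x * (k *: y).
Proof.
have E (G : qpath Q -> PA) : k *: path_ext G x = path_ext (fun p => k *: G p) x.
  rewrite /path_ext scaler_sumr; apply: eq_bigr => p _.
  by rewrite 2!scalerA (mulrC k).
transitivity (path_ext (fun p => k *: path_ext (path_mul K p) y) x); first exact: E.
by apply: eq_path_ext => p; rewrite path_extZ.
Qed.

Lemma pa_scaleE (k : K) (x : PA) : k *: x = x * (k *: (1 : PA)).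
Proof. by rewrite -(pa_scaleAr k x 1) mulr1. Qed.

Lemma pa_scale_comm (k : K) (x : PA) : x * (k *: (1 : PA)) = (k *: (1 : PA)) * x.
Proof. by rewrite -(pa_scaleAr k x 1) -(pa_scaleAl k 1 x) mulr1 mul1r. Qed.

Lemma pa_mul_elt (p q : qpath Q) : path_elt K p * path_elt K q = path_mul K p q.
Proof. by rewrite -[LHS]/(path_ext _ _) !path_extU. Qed.

Lemma pa_one_sum : (1 : PA) = \sum_v vtx v.
Proof. by apply: eq_bigr => v _; rewrite unlock. Qed.

Lemma vtx_mul u v : vtx u * vtx v = if u == v then vtx u else 0.
Proof.
rewrite !unlock pa_mul_elt /path_mul; case: eqP => [<-|uv].
  by rewrite (path_catE (r := trivial_path u)).
by rewrite path_catNE //; apply/eqP.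
Qed.

Lemma vtx_arrow v a : vtx v * parr a = if v == source a then parr a else 0.
Proof.
rewrite !unlock pa_mul_elt /path_mul; case: eqP => [->|uv].
  by rewrite (path_catE (r := arrow_path a)).
by rewrite path_catNE //; apply/eqP.
Qed.

Lemma arrow_vtx v a : parr a * vtx v = if v == target a then parr a else 0.
Proof.
rewrite !unlock pa_mul_elt /path_mul; case: eqP => [->|uv].
  by rewrite (path_catE (r := arrow_path a)).
by rewrite path_catNE // eq_sym; apply/eqP.
Qed.

Lemma path_elt_rcons v s a (h : composable v (rcons s a)) (h' : composable v s) :
  path_elt K (exist _ (v, rcons s a) h : qpath Q) =
  path_elt K (exist _ (v, s) h' : qpath Q) * parr a.
Proof.
rewrite !unlock pa_mul_elt /path_mul (path_catE (r := exist _ (v, rcons s a) h)) //=.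
  have : composable v (rcons s a) by [].
  by rewrite -cats1 composable_cat /= andbT => /andP[_ /eqP].
by rewrite cats1.
Qed.

(** Vertices and arrows generate the path algebra: a path grows by one arrow on the right. *)
Lemma pa_ind (P : PA -> Prop) :
  (forall x y, P x -> P y -> P (x + y)) -> (forall k x, P x -> P (k *: x)) ->
  (forall x y, P x -> P y -> P (x * y)) -> (forall v, P (vtx v)) ->
  (forall a, P (parr a)) -> P 0 -> forall x, P x.
Proof.
move=> PD PZ PM Pv Pa P0 x; rewrite -[x]path_ext_id /path_ext.
elim/big_ind: _ => // p _; apply: PZ; case: p => [[v s] h].
elim/last_ind: s h => [|s a IH] h.
  rewrite (_ : exist _ _ _ = trivial_path v); first by have := Pv v; rewrite unlock.
  exact: val_inj.
have h' : composable v s by move: (h); rewrite /= -cats1 composable_cat => /andP[].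
by rewrite (path_elt_rcons h h'); apply: PM.
Qed.

End PathAlgebraFacts.

Section Realization.
Variables (R : realType) (V : vectType R) (n : nat) (Phi : root_system V n).
Variables (c : seq 'I_n) (d : 'I_n -> nat) (K : fieldType).
Hypothesis cox : coxeter_word c.
Hypothesis sym : symmetrizer Phi d.

Local Notation Q := (gls_quiver Phi c).
Local Notation PA := (path_algebra K Q).
Local Notation H := (gls_algebra Phi c d K).
Local Notation A := (acartan Phi).
Local Notation is_rep := (@is_rep K n A d).
Local Notation pi := (@quotient_pi PA (@gls_relation R V n Phi c d K)).

Lemma is_arrowE j k : is_arrow Phi c (j, k) = arrow_at A c j k.
Proof.
have cE l : l \in c by rewrite (perm_mem cox) mem_enum.
rewrite /is_arrow /arrow_at !cE /=; case lt: (_ < _)%N => //=.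
have jk : j != k by apply: contraTneq lt => ->; rewrite ltnn.
by rewrite comm_cartan // /acartan absz_eq0.
Qed.

Section Act.
Variable N : rmod H.
Local Notation act := (@act R V n Phi c d K N).
Implicit Types (x y : PA) (m : N).

Lemma actE x m : act x m = (pi x : H^c) *: m.
Proof. by rewrite unlock. Qed.

Lemma actD x y m : act (x + y) m = act x m + act y m.
Proof. by rewrite !actE quotient_piD scalerDl. Qed.

Lemma actDr x m m' : act x (m + m') = act x m + act x m'.
Proof. rewrite !actE; exact: scalerDr. Qed.

(** The action is on the right, so [x] acts before [y], in agreement with the order of composition
    of paths. *)
Lemma actM x y m : act (x * y) m = act y (act x m).
Proof. by rewrite !actE quotient_piM scalerA. Qed.

Lemma act1 m : act 1 m = m.
Proof. rewrite actE; exact: scale1r. Qed.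

Lemma act_rel x m : generated_ideal (@gls_relation R V n Phi c d K) x -> act x m = 0.
Proof.
move=> h; rewrite !actE (_ : pi x = pi 0).
  have -> : pi 0 = 0 by apply: (addrI (pi 0)); rewrite -quotient_piD !addr0.
  exact: scale0r.
by apply/quotient_piP; rewrite subr0.
Qed.

Lemma act0 m : act 0 m = 0. Proof. by apply: act_rel; apply: Ideal_zero. Qed.

Lemma act0r x : act x (0 : N) = 0. Proof. rewrite actE; exact: scaler0. Qed.

Lemma act_sum (I : Type) (r : seq I) (F : I -> PA) m :
  act (\sum_(j <- r) F j) m = \sum_(j <- r) act (F j) m.
Proof.
by elim: r => [|j r IH]; rewrite ?big_nil ?act0 // !big_cons actD IH.
Qed.

(** An [rmod] carries no separate K-structure; it is recovered from the multiples of 1, which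
    commute with everything. *)
Definition kact (k : K) m := act (k *: (1 : PA) : PA) m.

Lemma act_scale k x m : act (k *: x) m = kact k (act x m).
Proof. by rewrite pa_scaleE; apply: actM. Qed.

Lemma kact_comm k x m : kact k (act x m) = act x (kact k m).
Proof. by rewrite /kact -2!actM pa_scale_comm. Qed.

Lemma act_pow x k m : act (x ^+ k) m = iter k (act x) m.
Proof.
elim: k => [|k IH]; first by rewrite expr0 act1.
by rewrite exprSr actM IH.
Qed.

End Act.

Local Notation e := (@vtx K Q).
Local Notation loop j := (@parr K Q (inl j)).
Local Notation ar jk := (@parr K Q (inr (exist (is_arrow Phi c) _ jk))).

(* [M j] is identified with [N e_j]: [th] is the inclusion, [cm] is [x |-> x e_j]. *)
Record realization (N : rmod H) (M : rep K n) := Realization {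
  th : forall j, M j -> N;
  cm : forall j, N -> M j;
  thD : forall j u v, @th j (u + v) = @th j u + @th j v;
  thZ : forall j k v, @th j (k *: v) = kact k (@th j v);
  cm_th : forall j v, cm j (@th j v) = v;
  th_cm : forall j x, @th j (cm j x) = act (e j) x;
  th_vtx : forall j v, act (e j) (@th j v) = @th j v;
  th_eps : forall j v, @th j (eps M j v) = act (loop j) (@th j v);
  th_arr : forall j k (jk : is_arrow Phi c (j, k)) v,
    @th k (arr M j k v) = act (ar jk) (@th j v)
}.
Arguments th {N M} r j _ : rename.

Lemma vtx_sum (N : rmod H) (x : N) : x = \sum_j act (e j) x.
Proof. by rewrite -act_sum -pa_one_sum act1. Qed.

Lemma act_vtx (N : rmod H) j k (x : N) :
  act (e k) (act (e j) x) = if j == k then act (e j) x else 0.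
Proof.
rewrite -actM.
rewrite vtx_mul.
case: (j =P k) => // _.
by rewrite act0. Qed.

Lemma act_loop (N : rmod H) j (x : N) : act (loop j) (act (e j) x) = act (loop j) x.
Proof. by rewrite -actM vtx_arrow eqxx. Qed.

Lemma vtx_loop (N : rmod H) j (x : N) : act (e j) (act (loop j) x) = act (loop j) x.
Proof. by rewrite -actM arrow_vtx eqxx. Qed.

Lemma act_arrow (N : rmod H) j k (jk : is_arrow Phi c (j, k)) (x : N) :
  act (ar jk) (act (e j) x) = act (ar jk) x.
Proof. by rewrite -actM vtx_arrow eqxx. Qed.

Lemma vtx_arrow_act (N : rmod H) j k (jk : is_arrow Phi c (j, k)) (x : N) :
  act (e k) (act (ar jk) x) = act (ar jk) x.
Proof. by rewrite -actM arrow_vtx eqxx. Qed.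

Section RealizationTheory.
Variables (N : rmod H) (M : rep K n) (r : realization N M).

Lemma th_inj j u v : th r j u = th r j v -> u = v.
Proof. by move=> E; rewrite -[u](cm_th r) E cm_th. Qed.

Lemma th0 j : th r j 0 = 0.
Proof. by rewrite -[X in th r j X](scale0r (0 : M j)) thZ /kact scale0r act0. Qed.

Lemma cmD j x y : cm r j (x + y) = cm r j x + cm r j y.
Proof. by apply: (@th_inj j); rewrite thD !th_cm actDr. Qed.

Lemma cmZ j k x : cm r j (kact k x) = k *: cm r j x.
Proof. by apply: (@th_inj j); rewrite thZ !th_cm kact_comm. Qed.

Lemma cm0 j : cm r j 0 = 0.
Proof. by apply: (@th_inj j); rewrite th_cm th0 act0r. Qed.

Lemma cm_other j k v : j != k -> cm r k (th r j v) = 0.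
Proof.
move=> jk; apply: (@th_inj k); rewrite th_cm th0 -(th_vtx r) act_vtx.
by rewrite (negPf jk).
Qed.

Lemma real_sum x : x = \sum_j th r j (cm r j x).
Proof. by rewrite {1}[x]vtx_sum; apply: eq_bigr => j _; rewrite th_cm. Qed.

Lemma real_eq x y : (forall j, cm r j x = cm r j y) -> x = y.
Proof. by move=> E; rewrite [x]real_sum [y]real_sum; apply: eq_bigr => j _; rewrite E. Qed.

Lemma cm_vtx j k x : cm r k (act (e j) x) = if j == k then cm r k x else 0.
Proof.
apply: (@th_inj k); rewrite th_cm act_vtx; case: eqP => [->|_]; first by rewrite th_cm.
by rewrite th0.
Qed.

Lemma cm_loop j k x : cm r k (act (loop j) x) = if j == k then eps M k (cm r k x) else 0.
Proof.
rewrite -vtx_loop cm_vtx; case: eqP => // <-.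
by apply: (@th_inj j); rewrite th_cm vtx_loop th_eps th_cm act_loop.
Qed.

Lemma cm_arrow j k l (jk : is_arrow Phi c (j, k)) x :
  cm r l (act (ar jk) x) = if k == l then arr M j l (cm r j x) else 0.
Proof.
rewrite -vtx_arrow_act cm_vtx; case: eqP => // <-.
by apply: (@th_inj k); rewrite th_cm vtx_arrow_act th_arr th_cm act_arrow.
Qed.

Lemma cm_sum_th (F : forall k, M k) j :
  cm r j (\sum_k th r k (F k)) = F j.
Proof.
have E : forall s : seq 'I_n, uniq s ->
    cm r j (\sum_(k <- s) th r k (F k)) = if j \in s then F j else 0.
  elim=> [|k s IH] /=; first by rewrite big_nil cm0.
  case/andP=> ks us; rewrite big_cons cmD IH // inE.
  have [->|jk] := eqVneq j k; first by rewrite cm_th (negPf ks) addr0.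
  by rewrite cm_other 1?eq_sym // add0r.
by rewrite E ?mem_index_enum ?index_enum_uniq.
Qed.

End RealizationTheory.

Lemma rmod_linearZ (N N' : rmod H) (h : {linear N -> N'}) (a : H^c) m : h (a *: m) = a *: h m.
Proof. exact: linearZ_LR. Qed.

Lemma linear_act (N N' : rmod H) (h : {linear N -> N'}) x m : h (act x m) = act x (h m).
Proof. by rewrite !actE rmod_linearZ. Qed.

Lemma hom_of_linear (N N' : rmod H) M M' (r : realization N M) (r' : realization N' M')
    (h : {linear N -> N'}) : is_rep c M -> is_rep c M' ->
  exists f : M ~> M', is_hom f /\
    forall j v, th r' j (f j v) = h (th r j v).
Proof.
move=> rM rM'; have ha := linear_act h.
pose f j := linfun (fun v => cm r' j (h (th r j v))).
have fE j v : f j v = cm r' j (h (th r j v)).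
  apply: linfun_linearE => k u w.
  by rewrite thD thZ linearD /kact ha cmD cmZ.
have tE j v : th r' j (f j v) = h (th r j v).
  by rewrite fE th_cm -ha th_vtx.
exists f; split=> //; split=> [j v|j k v].
  by apply: (th_inj (r := r')); rewrite tE !th_eps ha tE.
have [jk|jk] := boolP (is_arrow Phi c (j, k)).
  by apply: (th_inj (r := r')); rewrite tE !(th_arr _ jk) ha tE.
by rewrite (rep_arr rM) ?(rep_arr rM') ?linear0 // -is_arrowE.
Qed.

(** Linearity over H is checked on vertices and arrows, where it is the definition of a morphism of
    representations. *)
Lemma linear_of_hom (N N' : rmod H) M M' (r : realization N M) (r' : realization N' M')
    (f : M ~> M') : is_hom f ->
  exists h : {linear N -> N'}, forall j x, cm r' j (h x) = f j (cm r j x).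
Proof.
move=> [f1 f2]; pose h0 x := \sum_j th r' j (f j (cm r j x)).
have h0E j x : cm r' j (h0 x) = f j (cm r j x).
  exact: cm_sum_th.
have h0D x y : h0 (x + y) = h0 x + h0 y.
  by apply: (real_eq (r := r')) => j; rewrite cmD !h0E cmD linearD.
have h0A (x : PA) : forall m, h0 (act x m) = act x (h0 m).
  elim/pa_ind: x => [x y hx hy m|k x hx m|x y hx hy m|v m|a m|m].
  - by rewrite !actD h0D hx hy.
  - rewrite !act_scale -hx; apply: (real_eq (r := r')) => j.
    by rewrite cmZ !h0E cmZ linearZ.
  - by rewrite !actM hy hx.
  - apply: (real_eq (r := r')) => j; rewrite h0E !cm_vtx h0E.
    by case: eqP => // _; rewrite linear0.
  - case: a => [j|[[j k] jk]]; apply: (real_eq (r := r')) => l.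
      rewrite h0E !cm_loop h0E.
      by case: eqP => [<-|_]; rewrite ?linear0 ?f1.
    rewrite h0E !cm_arrow h0E.
    by case: eqP => [<-|_]; rewrite ?linear0 ?f2.
  - by rewrite !act0 /h0 big1 // => j _; rewrite cm0 linear0 th0.
have lh : linear (h0 : N -> N').
  move=> a x y; have [x0 <-] := quotient_pi_surj a.
  by rewrite h0D -2!actE h0A.
pose h : {linear N -> N'} := HB.pack h0 (GRing.isLinear.Build H^c N N' *:%R h0 lh).
by exists h.
Qed.

(** * From representations to modules *)

Section LinearExtension.
Variables (W : lmodType K) (h : qpath Q -> W).

Definition mext (x : PA) : W := \sum_(p <- msupp x) mcoeff p x *: h p.

Lemma mextEw (s : {fset qpath Q}) (x : PA) : (msupp x `<=` s)%fset ->
  mext x = \sum_(p <- s) mcoeff p x *: h p.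
Proof.
move=> sub; rewrite /mext (big_fset_incl _ sub) // => p _ px.
by rewrite mcoeff_outdom // scale0r.
Qed.

Lemma mext_linear k x y : mext (k *: x + y) = k *: mext x + mext y.
Proof.
pose s := (msupp x `|` (msupp y `|` msupp (k *: x + y)))%fset.
have sx : (msupp x `<=` s)%fset by exact: fsubsetUl.
have sy : (msupp y `<=` s)%fset by exact: fsubset_trans (fsubsetUl _ _) (fsubsetUr _ _).
rewrite (mextEw sx) (mextEw sy) (@mextEw s); last first.
  exact: fsubset_trans (fsubsetUr _ _) (fsubsetUr _ _).
rewrite scaler_sumr -big_split /=; apply: eq_bigr => p _.
by rewrite mcoeffD mcoeffZ scalerDl scalerA.
Qed.

Lemma mext0 : mext 0 = 0.
Proof. by have := mext_linear (-1) 0 0; rewrite scaler0 addr0 scaleN1r addNr. Qed.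

Lemma mextD x y : mext (x + y) = mext x + mext y.
Proof. by have := mext_linear 1 x y; rewrite !scale1r. Qed.

Lemma mextZ k x : mext (k *: x) = k *: mext x.
Proof. by have := mext_linear k x 0; rewrite mext0 !addr0. Qed.

Lemma mextU p : mext (path_elt K p) = h p.
Proof. by rewrite (mextEw (msuppU_le (x := 1))) big_seq_fset1 mcoeffUU scale1r. Qed.

End LinearExtension.

Lemma mext_path_ext (W : lmodType K) (h : qpath Q -> W) g x :
  mext h (path_ext g x) = mext (fun p => mext h (g p)) x.
Proof.
rewrite /path_ext; have : forall s : seq (qpath Q), mext h (\sum_(p <- s) mcoeff p x *: g p) =
    \sum_(p <- s) mcoeff p x *: mext h (g p).
  by elim=> [|p s IH]; rewrite ?big_nil ?mext0 // !big_cons mextD mextZ IH.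
exact.
Qed.

Section ModuleOfRep.
Variables (M : rep K n).
Hypothesis rM : is_rep c M.

Definition tot : vectType K := dsum (M : 'I_n -> vectType K).

Definition tco j : 'Hom(tot, M j) := linfun (dco (S := M) j : tot -> M j).

Lemma tcoE j w : tco j w = dco (S := M) j w.
Proof. exact: (linfun_linearE (@dco_linear K _ M j)). Qed.

Lemma tot_eq w w' : (forall j, tco j w = tco j w') -> w = w'.
Proof. by move=> E; apply: dsum_eq => j; rewrite -!tcoE E. Qed.

Definition tinj j : 'Hom(M j, tot) := linfun (fun v => dmk (fun k => dlt M j k v) : tot).

Lemma tco_tinj j k v : tco k (tinj j v) = dlt M j k v.
Proof.
rewrite /tinj linfun_linearE ?tcoE ?dmkK // => u x y; apply: tot_eq => l.
by rewrite linearP /= !tcoE !dmkK linearP.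
Qed.

Definition prj v : 'End(tot) := (tinj v \o tco v)%VF.

Definition aact (a : arrow Q) : 'End(tot) :=
  match a with
  | inl i => (tinj i \o eps M i \o tco i)%VF
  | inr p => (tinj (val p).2 \o arr M (val p).1 (val p).2 \o tco (val p).1)%VF
  end.

Lemma prjE u v w : prj u (prj v w) = if u == v then prj v w else 0.
Proof.
rewrite /prj !comp_lfunE tco_tinj; case: eqP => [->|/eqP uv].
  by rewrite dlt_id.
by rewrite dlt_neq 1?eq_sym // linear0.
Qed.

Lemma prj_aact (a : arrow Q) w : prj (@target Q a) (aact a w) = aact a w.
Proof. by case: a => [j|p]; rewrite !comp_lfunE tco_tinj dlt_id. Qed.

Lemma aact_prj (a : arrow Q) w : aact a (prj (@source Q a) w) = aact a w.
Proof. by case: a => [j|p]; rewrite !comp_lfunE tco_tinj dlt_id. Qed.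

(** The initial projection to the start vertex makes trivial paths act as idempotents, and paths
    that do not compose act successively as 0. *)
Definition pact (p : qpath Q) : 'End(tot) :=
  foldl (fun f a => aact a \o f)%VF (prj (val p).1) (val p).2.

Lemma foldl_aact (f g : 'End(tot)) s w :
  (foldl (fun f a => aact a \o f)%VF (f \o g)%VF s) w =
  (foldl (fun f a => aact a \o f)%VF f s) (g w).
Proof.
elim/last_ind: s => [|s a IH]; first by rewrite /= comp_lfunE.
by rewrite -!cats1 !foldl_cat /= !comp_lfunE IH.
Qed.

Lemma prj_pact v p w : prj v (pact p w) = if v == path_end p then pact p w else 0.
Proof.
rewrite /pact /path_end; case: p => [[u s] /= _].
case/lastP: s => [|s a] /=; first by rewrite prjE.
rewrite -cats1 foldl_cat map_cat last_cat /= comp_lfunE.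
by rewrite -prj_aact prjE.
Qed.

Lemma pactM p q w :
  pact q (pact p w) = mext (fun r => pact r w) (path_mul K p q).
Proof.
have -> : pact q (pact p w) = (foldl (fun f a => aact a \o f)%VF \1%VF (val q).2)
    (prj (path_start q) (pact p w)).
  by rewrite -(foldl_aact \1%VF (prj (path_start q))) comp_lfun1l.
rewrite prj_pact /path_mul; case E: (path_cat p q) => [r|].
  have [e1 e2 e3 e4] := path_catP E.
  rewrite mextU e1 eqxx -(foldl_aact \1%VF (pact p)) comp_lfun1l {2}/pact e2 /= foldl_cat.
  by [].
by rewrite mext0 eq_sym (negPf (path_catN E)) linear0.
Qed.

Definition ract (x : PA) (w : tot) : tot := mext (fun p => pact p w) x.

Lemma ractD x y w : ract (x + y) w = ract x w + ract y w.
Proof. exact: mextD. Qed.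

Lemma ractZ k x w : ract (k *: x) w = k *: ract x w.
Proof. exact: mextZ. Qed.

Lemma ract0 w : ract 0 w = 0.
Proof. exact: mext0. Qed.

Lemma ractB x y w : ract (x - y) w = ract x w - ract y w.
Proof. by rewrite -scaleN1r ractD ractZ scaleN1r. Qed.

Lemma ractDr x w w' : ract x (w + w') = ract x w + ract x w'.
Proof.
by rewrite /ract /mext -big_split; apply: eq_bigr => p _; rewrite linearD scalerDr.
Qed.

Lemma ractZr x k w : ract x (k *: w) = k *: ract x w.
Proof.
rewrite /ract /mext scaler_sumr; apply: eq_bigr => p _.
by rewrite linearZ /= !scalerA mulrC.
Qed.

Lemma ract0r x : ract x 0 = 0.
Proof. by have := ractZr x 0 0; rewrite !scale0r. Qed.

Lemma ractM x y w : ract (x * y) w = ract y (ract x w).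
Proof.
transitivity (mext (fun p => ract y (pact p w)) x).
  rewrite -[x * y]/(path_ext (fun p => path_ext (path_mul K p) y) x) [LHS]mext_path_ext.
  apply: eq_bigr => p _; congr (_ *: _); rewrite mext_path_ext.
  by apply: eq_bigr => q _; rewrite pactM.
have E : forall s : seq (qpath Q), \sum_(p <- s) mcoeff p x *: ract y (pact p w) =
    ract y (\sum_(p <- s) mcoeff p x *: pact p w).
  elim=> [|p s IH]; first by rewrite !big_nil ract0r.
  by rewrite !big_cons ractDr ractZr IH.
exact: E.
Qed.

Lemma ract_vtx v w : ract (e v) w = prj v w.
Proof. by rewrite /ract vtx.unlock mextU. Qed.

Lemma ract_arrow a w : ract (@parr K Q a) w = aact a w.
Proof. by rewrite /ract parr.unlock mextU /pact /= comp_lfunE aact_prj. Qed.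

Lemma ract1 w : ract 1 w = w.
Proof.
rewrite pa_one_sum; have : forall s : seq 'I_n, ract (\sum_(j <- s) e j) w = \sum_(j <- s) prj j w.
  elim=> [|j s IH]; first by rewrite !big_nil ract0.
  by rewrite !big_cons ractD IH ract_vtx.
move=> ->; apply: tot_eq => j; rewrite linear_sum (bigD1 j) //= [X in _ + X]big1 ?addr0.
  by rewrite comp_lfunE tco_tinj dlt_id.
by move=> k kj; rewrite comp_lfunE tco_tinj dlt_neq.
Qed.

Lemma tco_loops j k w : tco j (iter k (ract (loop j)) w) = lpow (eps M j) k (tco j w).
Proof.
elim: k => [|k IH]; first by rewrite lpow0.
by rewrite iterS ract_arrow !comp_lfunE tco_tinj dlt_id IH.
Qed.

Lemma loops_tinj j k v : iter k (ract (loop j)) (tinj j v) = tinj j (lpow (eps M j) k v).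
Proof.
elim: k => [|k IH]; first by rewrite lpow0.
by rewrite iterS IH ract_arrow !comp_lfunE tco_tinj dlt_id.
Qed.

Lemma ractX x k w : ract (x ^+ k) w = iter k (ract x) w.
Proof. by elim: k => [|k IH]; rewrite ?expr0 ?ract1 // exprSr ractM IH. Qed.

Lemma loopE j : gls_loop Phi c K j = loop j. Proof. by rewrite parr.unlock. Qed.

Lemma arrowE j k (jk : is_arrow Phi c (j, k)) : gls_arrow K jk = ar jk.
Proof. by rewrite parr.unlock. Qed.

Lemma ract_loop_arrow p j k (jk : is_arrow Phi c (j, k)) w :
  ract (loop j ^+ p * ar jk) w = tinj k (arr M j k (lpow (eps M j) p (tco j w))).
Proof. by rewrite ractM ractX ract_arrow !comp_lfunE tco_loops. Qed.

Lemma ract_arrow_loop p j k (jk : is_arrow Phi c (j, k)) w :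
  ract (ar jk * loop k ^+ p) w = tinj k (lpow (eps M k) p (arr M j k (tco j w))).
Proof. by rewrite ractM ractX ract_arrow !comp_lfunE loops_tinj. Qed.

Lemma ract_ideal x : generated_ideal (@gls_relation R V n Phi c d K) x -> forall w, ract x w = 0.
Proof.
elim=> {x} [x [j|j k jk]|w|x y _ hx _ hy w|x y z _ hy w].
- move=> w; rewrite loopE ractX -(prednK (sym_gt0 sym j)) iterSr ract_arrow !comp_lfunE.
  rewrite loops_tinj -lpowSr prednK ?(sym_gt0 sym) //.
  by rewrite (rep_nil rM) linear0.
- move=> w.
  rewrite ractB.
  rewrite (loopE j).
  rewrite (loopE k).
  rewrite (arrowE jk).
  have E1 := ract_loop_arrow `|cartan Phi k j| jk w.
  have E2 := ract_arrow_loop `|cartan Phi j k| jk w.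
  refine (eq_trans (f_equal2 (fun u v : tot => u - v) E1 E2) _).
  by rewrite (rep_rel rM) subrr.
- by rewrite ract0.
- by rewrite ractD hx hy addr0.
- by rewrite !ractM hy ract0r.
Qed.

Definition tmod : Type := tot.
HB.instance Definition _ := GRing.Zmodule.on tmod.

(** [repr] picks an arbitrary representative; by [ract_ideal] the action does not depend on it. *)
Definition tscale (a : H^c) (w : tmod) : tmod := ract (generic_quotient.repr (a : H)) w.

Lemma tscale_pi x w : tscale (pi x) w = ract x w.
Proof.
rewrite /tscale; set y := generic_quotient.repr _; apply/eqP; rewrite -subr_eq0; apply/eqP.
have /ract_ideal/(_ w) : generated_ideal (@gls_relation R V n Phi c d K) (y - x).
  by apply/quotient_piP; rewrite [LHS]generic_quotient.reprK.
by rewrite ractB.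
Qed.

Lemma tscaleA a b w : tscale a (tscale b w) = tscale (a * b) w.
Proof.
have [x <-] := quotient_pi_surj a; have [y <-] := quotient_pi_surj b.
have E : (pi (y * x) : H^c) = (pi x : H^c) * (pi y : H^c) := quotient_piM _ y x.
apply: (eq_trans (congr1 (tscale (pi x)) (tscale_pi y w))).
apply: (eq_trans (tscale_pi x (ract y w))).
apply: (eq_trans (esym (ractM y x w))).
by apply: (eq_trans (esym (tscale_pi (y * x) w))); rewrite E.
Qed.

Lemma tscale1 : left_id 1 tscale.
Proof. by move=> w; apply: (eq_trans (tscale_pi 1 w)); apply: ract1. Qed.

Lemma tscaleDr : right_distributive tscale +%R.
Proof. by move=> a w w'; apply: ractDr. Qed.

Lemma tscaleDl w : {morph tscale^~ w : a b / a + b}.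
Proof.
move=> a b; have [x <-] := quotient_pi_surj a; have [y <-] := quotient_pi_surj b.
apply: (eq_trans (congr1 (tscale^~ w) (esym (quotient_piD _ x y)))).
rewrite (eq_trans (tscale_pi (x + y) w) (ractD x y w)).
by apply: (f_equal2 (fun u v : tot => u + v)); symmetry; apply: tscale_pi.
Qed.

HB.instance Definition _ := GRing.Zmodule_isLmodule.Build H^c tmod
  tscaleA tscale1 tscaleDr tscaleDl.

Lemma act_tmod x (w : tmod) : act x w = ract x w.
Proof. by rewrite actE; exact: tscale_pi. Qed.

Lemma kact_tmod k (w : tmod) : kact k w = k *: (w : tot).
Proof. by rewrite /kact act_tmod ractZ ract1. Qed.

Lemma tmod_realization : exists N : rmod H, finitely_generated N /\ exists r : realization N M, True.
Proof.
exists (tmod : rmod H); split.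
  exists (\dim {:tot}), (fun k => tnth (vbasis {:tot}) k : tmod) => w.
  have E := coord_basis (vbasisP {:tot}) (memvf (w : tot)).
  exists (fun k => pi (coord (vbasis {:tot}) k (w : tot) *: (1 : PA) : PA)).
  rewrite {1}E; apply: eq_bigr => k _.
  transitivity (kact (coord (vbasis {:tot}) k (w : tot)) (tnth (vbasis {:tot}) k : tmod)).
    by rewrite kact_tmod (tnth_nth 0).
  exact: actE.
have aE a (w : tmod) : act (@parr K Q a) w = aact a w by rewrite act_tmod ract_arrow.
suff r : realization (tmod : rmod H) M by exists r.
exists (fun j v => tinj j v : tmod) (fun j (w : tmod) => tco j w) => //.
- by move=> j u v; rewrite linearD.
- by move=> j k v; rewrite kact_tmod linearZ.
- by move=> j v; rewrite tco_tinj dlt_id.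
- by move=> j x; rewrite act_tmod ract_vtx comp_lfunE.
- by move=> j v; rewrite act_tmod ract_vtx comp_lfunE tco_tinj dlt_id.
- by move=> j v; rewrite aE !comp_lfunE tco_tinj dlt_id.
- by move=> j k jk v; rewrite aE !comp_lfunE tco_tinj dlt_id.
Qed.

End ModuleOfRep.

(** * From finitely generated modules to representations *)

Section FiniteModules.
Variable N : rmod H.
Local Notation act := (@act R V n Phi c d K N).
Local Notation kact := (@kact N).

Lemma kactDl k k' m : kact (k + k') m = kact k m + kact k' m.
Proof. by rewrite /kact scalerDl actD. Qed.

Lemma kactDr k m m' : kact k (m + m') = kact k m + kact k m'.
Proof. exact: actDr. Qed.

Lemma kact0l m : kact 0 m = 0.
Proof. by rewrite /kact scale0r act0. Qed.

Lemma kact1 m : kact 1 m = m.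
Proof. by rewrite /kact scale1r act1. Qed.

Lemma kactA k k' m : kact k (kact k' m) = kact (k * k') m.
Proof. by rewrite {2}/kact -act_scale scalerA. Qed.

Lemma kactN m : kact (-1) m = - m.
Proof. by apply/eqP; rewrite -subr_eq0 opprK -{2}[m]kact1 -kactDl addNr kact0l. Qed.

Inductive kspan (s : seq N) : N -> Prop :=
| KSpan_mem x of x \in s : kspan s x
| KSpan_zero : kspan s 0
| KSpan_add x y of kspan s x & kspan s y : kspan s (x + y)
| KSpan_scale k x of kspan s x : kspan s (kact k x).

Lemma kspan_sub s t x : {subset s <= t} -> kspan s x -> kspan t x.
Proof.
move=> st; elim=> {x} [x /st|||]; by [exact: KSpan_mem|exact: KSpan_zero|
  move=> x y _ ? _ ?; exact: KSpan_add|move=> k x _ ?; exact: KSpan_scale].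
Qed.

(** In effect, [x] generates a submodule of finite dimension over K. *)
Definition kfinite (x : N) : Prop := exists s, forall a, kspan s (act a x).

Lemma kfinite_common (ys : seq N) : (forall y, y \in ys -> kfinite y) ->
  exists s, forall y a, y \in ys -> kspan s (act a y).
Proof.
elim: ys => [|y ys IH] fy; first by exists [::].
have [s1 h1] := fy y (mem_head _ _).
have [|s2 h2] := IH; first by move=> z zy; apply: fy; rewrite inE zy orbT.
exists (s1 ++ s2) => z a; rewrite inE => /predU1P[->|/h2 hz].
  by apply: (@kspan_sub s1) => // w; rewrite mem_cat => ->.
by apply: (@kspan_sub s2) => // w; rewrite mem_cat => ->; rewrite orbT.
Qed.

Lemma kfinite0 : kfinite 0.
Proof. by exists [::] => a; rewrite act0r; apply: KSpan_zero. Qed.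

Lemma kfiniteD x y : kfinite x -> kfinite y -> kfinite (x + y).
Proof.
move=> fx fy; have [|s hs] := @kfinite_common [:: x; y].
  by move=> z; rewrite !inE => /orP[]/eqP->.
by exists s => a; rewrite actDr; apply: KSpan_add; apply: hs; rewrite !inE eqxx ?orbT.
Qed.

Lemma loop_nilpotent j m : iter (d j) (act (loop j)) m = 0.
Proof.
rewrite -act_pow; apply: act_rel; rewrite -loopE.
by apply: Ideal_gen; apply: GLS_nilpotent.
Qed.

Lemma loops_comm j k (jk : is_arrow Phi c (j, k)) m :
  act (ar jk) (iter `|cartan Phi k j|%N (act (loop j)) m) =
  iter `|cartan Phi j k|%N (act (loop k)) (act (ar jk) m).
Proof.
have E1 : gls_loop Phi c K j ^+ `|cartan Phi k j|%N * gls_arrow K jk =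
    loop j ^+ `|cartan Phi k j|%N * ar jk.
  exact: (f_equal2 (fun x y : PA => x ^+ `|cartan Phi k j|%N * y) (loopE j) (arrowE jk)).
have E2 : gls_arrow K jk * gls_loop Phi c K k ^+ `|cartan Phi j k|%N =
    ar jk * loop k ^+ `|cartan Phi j k|%N.
  exact: (f_equal2 (fun x y : PA => y * x ^+ `|cartan Phi j k|%N) (loopE k) (arrowE jk)).
have h : act (loop j ^+ `|cartan Phi k j|%N * ar jk) m =
         act (ar jk * loop k ^+ `|cartan Phi j k|%N) m.
  apply/eqP; rewrite -subr_eq0 -kactN -act_scale -actD scaleN1r -E1 -E2; apply/eqP.
  by apply: act_rel; apply: Ideal_gen; apply: GLS_commute.
apply: (eq_trans _ (eq_trans h _)); last by rewrite actM act_pow.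
by symmetry; rewrite actM act_pow.
Qed.

Section Vertex.
Variables (k : 'I_n) (x : N) (ys s : seq N).
Hypothesis ex : act (e k) x = x.
Let lx l := iter l (act (loop k)) x.
Hypothesis ysP : forall y a, y \in ys -> kspan s (act a y).
Hypothesis lxy : forall l a, (l < d k)%N -> act (@parr K Q (inr a)) (lx l) \in ys.
Hypothesis lxs : forall l, (l < d k)%N -> lx l \in s.

(** The span of the loop powers of [x] and of vectors whose whole orbit lies in the span of [s]. It
    is stable under the path algebra: a loop shifts the powers, an arrow leads into [ys]. *)
Inductive vspan : N -> Prop :=
| Vspan_loop l of (l < d k)%N : vspan (lx l)
| Vspan_tail y of (forall a, kspan s (act a y)) : vspan y
| Vspan_add y z of vspan y & vspan z : vspan (y + z)
| Vspan_scale t y of vspan y : vspan (kact t y).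

Lemma vspan0 : vspan 0.
Proof. by apply: Vspan_tail => a; rewrite act0r; apply: KSpan_zero. Qed.

Lemma vspan_kspan y : vspan y -> kspan s y.
Proof.
elim=> {y} [l ld|y h|y z _ hy _ hz|t y _ hy].
- by apply: KSpan_mem; apply: lxs.
- by have := h 1; rewrite act1.
- exact: KSpan_add.
- exact: KSpan_scale.
Qed.

Lemma vtx_lx l : act (e k) (lx l) = lx l.
Proof. by case: l => [|l]; rewrite /lx ?iterS ?vtx_loop. Qed.

Lemma vspan_gen a y : (forall l, (l < d k)%N -> vspan (act a (lx l))) ->
  vspan y -> vspan (act a y).
Proof.
move=> ha; elim=> {y} [//|y h|y z _ hy _ hz|t y _ hy].
- by apply: Vspan_tail => b; rewrite -actM; apply: h.
- by rewrite actDr; apply: Vspan_add.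
- by rewrite -kact_comm; apply: Vspan_scale.
Qed.

Lemma vspan_act a y : vspan y -> vspan (act a y).
Proof.
elim/pa_ind: a y => [a b ha hb y|t a ha y|a b ha hb y|v y|a y|y] hy.
- by rewrite actD; apply: Vspan_add; [apply: ha|apply: hb].
- by rewrite act_scale; apply: Vspan_scale; apply: ha.
- by rewrite actM; apply: hb; apply: ha.
- apply: vspan_gen hy => l ld; rewrite -vtx_lx act_vtx; case: eqP => _; last exact: vspan0.
  by rewrite vtx_lx; apply: Vspan_loop.
- apply: vspan_gen hy => l ld.
  case: a => [j|a]; last by apply: Vspan_tail => b; apply: ysP; apply: lxy.
  rewrite -act_loop -vtx_lx act_vtx; case: eqP => [<-|_]; last first.
    by rewrite act0r; apply: vspan0.
  rewrite vtx_lx -[act _ _]/(lx l.+1); move: ld; rewrite leq_eqVlt.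
  case/orP => [/eqP ld|]; last exact: Vspan_loop.
  by rewrite /lx ld loop_nilpotent; apply: vspan0.
- by rewrite act0; apply: vspan0.
Qed.

End Vertex.

(* Downward induction along the word: arrows leave [k] towards later letters. *)
Lemma kfinite_vtx m k x : (n - index k c <= m)%N -> kfinite (act (e k) x).
Proof.
have cE l : l \in c by rewrite (perm_mem cox) mem_enum.
have sc : size c = n by rewrite (perm_size cox) size_enum_ord.
elim: m k x => [|m IH] k x.
  by have := index_mem k c; rewrite cE sc; lia.
move=> km; set y := act (e k) x.
have ey : act (e k) y = y by rewrite /y act_vtx eqxx.
pose l l := iter l (act (loop k)) y.
pose ys := [seq act (@parr K Q (inr a)) (l i) | a <- enum {: {p | is_arrow Phi c p}},
                                                 i <- iota 0 (d k)].
have [|s hs] := @kfinite_common ys.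
  move=> _ /allpairsP[[[[j k'] jk] i] [_ _ ->]] /=.
  rewrite -act_arrow -[l i](vtx_lx ey i) act_vtx; case: eqP => [kj|_]; last first.
    by rewrite act0r; apply: kfinite0.
  rewrite -vtx_arrow_act; apply: IH; move: (jk) km; rewrite /is_arrow /= -kj.
  by move=> /andP[lt _]; have := index_mem k c; rewrite cE sc; lia.
exists ([seq l i | i <- iota 0 (d k)] ++ s) => a.
have ls i : (i < d k)%N -> l i \in [seq l i | i <- iota 0 (d k)] ++ s.
  by move=> id; rewrite mem_cat map_f // mem_iota.
apply: (@vspan_kspan k y _ ls).
apply: (@vspan_act k y ys _ ey); last first.
- by rewrite -[y]/(l 0%N); apply: Vspan_loop; apply: (sym_gt0 sym).
- by move=> i b id; apply/allpairsP; exists (b, i); rewrite mem_enum mem_iota.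
- by move=> z b zy; apply: kspan_sub (hs z b zy) => w; rewrite mem_cat orbC => ->.
Qed.

Lemma kfinite_all x : kfinite x.
Proof.
rewrite [x]vtx_sum; elim/big_ind: _ => [||k _]; [exact: kfinite0|exact: kfiniteD|].
exact: kfinite_vtx (leqnn _).
Qed.

Lemma fg_kspan : finitely_generated N -> exists s, forall x, kspan s x.
Proof.
case=> m [g hg]; have [|s hs] := @kfinite_common [seq g i | i <- enum 'I_m].
  by move=> y _; apply: kfinite_all.
exists s => x; have [a ->] := hg x.
elim/big_ind: _ => [||k _]; [exact: KSpan_zero|exact: KSpan_add|].
have [b <-] := quotient_pi_surj (a k : H).
by rewrite -actE; apply: hs; apply: map_f; rewrite mem_enum.
Qed.

(** Induction on the list: a vector outside the image reached so far adds one coordinate. *)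
Lemma kspan_basis (s : seq N) : exists (m : nat) (f : 'rV[K]_m -> N),
  [/\ forall u v, f (u + v) = f u + f v, forall k v, f (k *: v) = kact k (f v),
      forall v, f v = 0 -> v = 0, forall v, kspan s (f v) &
      forall x, x \in s -> exists v, f v = x].
Proof.
elim: s => [|x s [m [f [fD fZ fI fs sf]]]].
  exists 0%N, (fun=> 0); split=> //.
  - by move=> u v; rewrite addr0.
  - by move=> k v; rewrite /kact act0r.
  - by move=> v _; apply/rowP; case.
  - by move=> _; apply: KSpan_zero.
have ss y : kspan s y -> kspan (x :: s) y.
  by apply: kspan_sub => z zs; rewrite inE zs orbT.
have [[v vx]|nx] := pselect (exists v, f v = x).
  exists m, f; split=> // [w|y]; first exact: ss.
  by rewrite inE => /predU1P[->|/sf//]; exists v.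
exists (1 + m)%N, (fun w : 'rV[K]_(1 + m) => kact (w 0 0) x + f (rsubmx w)); split.
- by move=> u w; rewrite mxE kactDl linearD fD /= addrACA.
- by move=> k w; rewrite mxE linearZ fZ /= -kactA kactDr.
- move=> w /eqP; rewrite addr_eq0 => /eqP wx.
  have w0 : w 0 0 = 0.
    (* A nonzero coefficient could be divided out, which would put [x] into the image of [f]. *)
    apply: contrapT => /eqP w0; case: nx; exists (- (w 0 0)^-1 *: rsubmx w).
    rewrite fZ -[f _]opprK -wx -kactN !kactA.
    by rewrite mulrN1 opprK mulVf // kact1.
  have wr : rsubmx w = 0.
    by apply: fI; apply/eqP; rewrite -oppr_eq0 -wx w0 kact0l.
  rewrite -[w]hsubmxK wr -[RHS]row_mx0; congr row_mx.
  apply/rowP => i; rewrite !mxE -[RHS]w0; congr (w _ _).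
  by apply/val_inj; case: i => -[].
- move=> w; apply: KSpan_add; last exact: ss.
  by apply: KSpan_scale; apply: KSpan_mem; rewrite mem_head.
- move=> y; rewrite inE => /predU1P[->|/sf[v <-]].
    exists (row_mx 1 0); rewrite row_mxKr.
    have -> : f 0 = 0 by rewrite -(scale0r 0) fZ kact0l.
    rewrite addr0 (_ : row_mx 1 0 0 0 = 1) ?kact1 //.
    have -> : 0 = lshift m (0 : 'I_1) :> 'I_(1 + m) by apply/val_inj.
    by rewrite row_mxEl mxE.
  exists (row_mx 0 v); rewrite row_mxKr.
  have -> : 0 = lshift m (0 : 'I_1) :> 'I_(1 + m) by apply/val_inj.
  by rewrite row_mxEl mxE kact0l add0r.
Qed.

(** Coordinates on N e_j. The dimension is packed with the two maps so that a single use of choice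
    serves all vertices. *)
Lemma vtx_basis : finitely_generated N -> forall j,
  exists p : {m : nat & ('rV[K]_m -> N) * (N -> 'rV[K]_m)}%type,
  let f := (tagged p).1 in let g := (tagged p).2 in
  [/\ forall u v, f (u + v) = f u + f v, forall k v, f (k *: v) = kact k (f v),
      forall v, g (f v) = v, forall x, f (g x) = act (e j) x &
      forall v, act (e j) (f v) = f v].
Proof.
move=> /fg_kspan[s hs] j.
have [m [f [fD fZ fI fs sf]]] := kspan_basis [seq act (e j) x | x <- s].
have im y : kspan s y -> exists v, f v = act (e j) y.
  elim=> {y} [y ys||y z _ [u hu] _ [v hv]|k y _ [u hu]].
  - by apply: sf; apply: map_f.
  - by exists 0; rewrite act0r -(scale0r 0) fZ kact0l.
  - by exists (u + v); rewrite fD hu hv actDr.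
  - by exists (k *: u); rewrite fZ hu kact_comm.
have ef v : act (e j) (f v) = f v.
  elim: {v}(f v) / (fs v) => [y /mapP[z _ ->]||y z _ hy _ hz|k y _ hy].
  - by rewrite act_vtx eqxx.
  - by rewrite act0r.
  - by rewrite actDr hy hz.
  - by rewrite -kact_comm hy.
have finj u v : f u = f v -> u = v.
  move=> E; apply/eqP; rewrite -subr_eq0; apply/eqP/fI.
  by rewrite fD -scaleN1r fZ kactN E subrr.
pose g x := projT1 (cid (im x (hs x))).
have gE x : f (g x) = act (e j) x by rewrite /g; case: cid.
exists (existT _ m (f, g)); split; [exact: fD|exact: fZ|move=> v|exact: gE|exact: ef].
by apply: finj; rewrite [LHS]gE ef.
Qed.

Lemma realization_ex : finitely_generated N ->
  exists M : rep K n, is_rep c M /\ exists r : realization N M, True.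
Proof.
move=> /vtx_basis/choice[p fg]; pose m j := tag (p j).
pose f j : 'rV[K]_(m j) -> N := (tagged (p j)).1.
pose g j : N -> 'rV[K]_(m j) := (tagged (p j)).2.
have fD j : forall u v, f j (u + v) = f j u + f j v by case: (fg j).
have fZ j : forall k v, f j (k *: v) = kact k (f j v) by case: (fg j).
have gf j : forall v, g j (f j v) = v by case: (fg j).
have fgE j : forall x, f j (g j x) = act (e j) x by case: (fg j).
have ef j : forall v, act (e j) (f j v) = f j v by case: (fg j).
have finj j u v : f j u = f j v -> u = v by move=> E; rewrite -[u]gf E gf.
have f0 j : f j 0 = 0 by rewrite -(scale0r 0) fZ kact0l.
have glin j k (a : PA) : linear (fun v => g k (act a (f j v))).
  move=> t u v; apply: finj.
  by rewrite !fD !fZ !fgE !actDr !kact_comm.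
pose ep j : 'End('rV[K]_(m j)) := linfun (fun v => g j (act (loop j) (f j v))).
(* An arrow of the quiver contains a proof of [is_arrow]; matching on [idP] supplies one, and
   [bool_irrelevance] makes it immaterial which. *)
pose rr j k : 'Hom('rV[K]_(m j), 'rV[K]_(m k)) :=
  match @idP (is_arrow Phi c (j, k)) with
  | ReflectT jk => linfun (fun v => g k (act (ar jk) (f j v)))
  | _ => 0
  end.
have epE j v : f j (ep j v) = act (loop j) (f j v).
  by rewrite linfun_linearE ?fgE ?vtx_loop //; apply: glin.
have rrE j k (jk : is_arrow Phi c (j, k)) v : f k (rr j k v) = act (ar jk) (f j v).
  rewrite /rr; case: {-}_ / idP => // jk'; rewrite (bool_irrelevance jk' jk).
  by rewrite linfun_linearE ?fgE ?vtx_arrow_act //; apply: glin.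
have rr0 j k : ~~ is_arrow Phi c (j, k) -> rr j k = 0.
  by rewrite /rr; case: {-}_ / idP => // jk /negP[].
pose M := Rep ep rr.
have lE l j v : f j (lpow (ep j) l v) = iter l (act (loop j)) (f j v).
  by elim: l => [|l IH]; rewrite ?lpow0 // lpowS epE IH.
exists M; split; last first.
  by exists (@Realization N M f g fD fZ gf fgE ef epE rrE).
have cE l : l \in c by rewrite (perm_mem cox) mem_enum.
split.
- by move=> j v; apply: finj; rewrite lE loop_nilpotent f0.
- move=> j k v; have [jk|jk] := boolP (is_arrow Phi c (j, k)); last first.
    by rewrite /= rr0 // !zero_lfunE linear0.
  by apply: finj; rewrite /= lE !rrE // lE loops_comm.
- by move=> j k v; rewrite -is_arrowE => /rr0 /= ->; rewrite zero_lfunE.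
- by move=> j v; rewrite cE.
Qed.

End FiniteModules.

(** * The isomorphism *)

Local Notation tcl := (@tcl K n A d c).
Implicit Types (M : rep K n) (N : rmod H).

Section Homs.
Variables (N N' : rmod H) (M M' : rep K n).
Variables (r : realization N M) (r' : realization N' M').
Variables (h : {linear N -> N'}) (f : M ~> M').

Lemma cm_hom : (forall j v, th r' j (f j v) = h (th r j v)) ->
  forall j x, cm r' j (h x) = f j (cm r j x).
Proof.
move=> fh j x; apply: (th_inj (r := r')).
by rewrite fh !th_cm linear_act.
Qed.

Hypothesis hf : forall j x, cm r' j (h x) = f j (cm r j x).

Lemma surjection_of_hsurj : hsurj f -> surjection h.
Proof.
move=> sf y; pose F j := projT1 (cid (sf j (cm r' j y))).
exists (\sum_k th r k (F k)); apply: (real_eq (r := r')) => j.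
by rewrite hf cm_sum_th /F; case: cid.
Qed.

Lemma injective_of_hinj : hinj f -> injective h.
Proof.
move=> hj x y E; apply: (real_eq (r := r)) => j; apply/eqP; rewrite -subr_eq0; apply/eqP.
by apply: hj; rewrite linearB /= -!hf E subrr.
Qed.

Lemma hsurj_of_surjection : surjection h -> hsurj f.
Proof.
move=> sh j v; have [x hx] := sh (th r' j v); exists (cm r j x).
by rewrite -hf hx cm_th.
Qed.

Lemma hinj_of_injective : (forall j v, th r' j (f j v) = h (th r j v)) ->
  injective h -> hinj f.
Proof.
move=> fh ih j v fv; apply: (th_inj (r := r)); apply: ih.
by rewrite -fh fv !th0 linear0.
Qed.

End Homs.

Section Exact.
Variables (N1 N2 N3 : rmod H) (M1 M2 M3 : rep K n).
Variables (r1 : realization N1 M1) (r2 : realization N2 M2) (r3 : realization N3 M3).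
Variables (h : {linear N1 -> N2}) (f : M1 ~> M2).
Variables (k : {linear N2 -> N3}) (g : M2 ~> M3).
Hypothesis hf : forall j x, cm r2 j (h x) = f j (cm r1 j x).
Hypothesis kg : forall j x, cm r3 j (k x) = g j (cm r2 j x).

Lemma exact_of_hexact : hexact f g -> forall y, k y = 0 <-> exists x, h x = y.
Proof.
move=> fg y; split=> [ky|[x <-]].
  have gy j : g j (cm r2 j y) = 0 by rewrite -kg ky cm0.
  pose F j := projT1 (cid ((fg j _).1 (gy j))).
  exists (\sum_l th r1 l (F l)); apply: (real_eq (r := r2)) => j.
  by rewrite hf cm_sum_th /F; case: cid.
apply: (real_eq (r := r3)) => j; rewrite kg hf cm0; apply/fg; by exists (cm r1 j x).
Qed.

Lemma hexact_of_exact : (forall j v, th r2 j (f j v) = h (th r1 j v)) ->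
  (forall j v, th r3 j (g j v) = k (th r2 j v)) ->
  (forall y, k y = 0 <-> exists x, h x = y) -> hexact f g.
Proof.
move=> fh gk hk j v; split=> [gv|[u <-]].
  have [|x hx] := (hk (th r2 j v)).1; first by rewrite -gk gv th0.
  by exists (cm r1 j x); rewrite -hf hx cm_th.
apply: (th_inj (r := r3)); rewrite gk fh th0; apply/hk.
by exists (th r1 j u).
Qed.

End Exact.

(** Through this map, closure under quotients lets torsion classes depend only on the representation
    realized. *)
Lemma realization_transport N N' M (r : realization N M) (r' : realization N' M) :
  exists h : {linear N -> N'}, surjection h.
Proof.
have [h hE] := linear_of_hom r r' (hom_id M); exists h.
by apply: (surjection_of_hsurj hE) => j w; exists w; rewrite id_lfunE.
Qed.

Lemma fg_quot N N' (h : {linear N -> N'}) :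
  surjection h -> finitely_generated N -> finitely_generated N'.
Proof.
move=> sh [m [g gen]]; exists m, (fun i => h (g i)) => y.
have [x <-] := sh y; have [a ->] := gen x; exists a.
by rewrite raddf_sum; apply: eq_bigr => i _; exact: rmod_linearZ.
Qed.

Lemma fg_ext N1 N2 N3 (h : {linear N1 -> N2}) (k : {linear N2 -> N3}) :
  surjection k -> (forall y, k y = 0 <-> exists x, h x = y) ->
  finitely_generated N1 -> finitely_generated N3 -> finitely_generated N2.
Proof.
move=> sk hk [m [g gen]] [m' [g' gen']].
pose l i := projT1 (cid (sk (g' i))).
have kl i : k (l i) = g' i by rewrite /l; case: cid.
exists (m + m')%N, (fun i => match split i with inl i => h (g i) | inr i => l i end) => y.
have [b yb] := gen' (k y).
have [|x hx] := (hk (y - \sum_i b i *: l i)).1.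
  apply/eqP; rewrite linearB /= subr_eq0 yb raddf_sum; apply/eqP/eq_bigr => i _.
  by rewrite -kl; symmetry; exact: rmod_linearZ.
have [a xa] := gen x.
exists (fun i => match split i with inl i => a i | inr i => b i end).
rewrite big_split_ord /=; apply: (canRL (subrK _)).
rewrite -[\sum_(i < m) _](_ : \sum_(i < m) a i *: h (g i) = _); last first.
  by apply: eq_bigr => i _; rewrite (unsplitK (inl i)).
rewrite -[\sum_(i < m') _](_ : \sum_(i < m') b i *: l i = _); last first.
  by apply: eq_bigr => i _; rewrite (unsplitK (inr i)).
by rewrite -hx xa raddf_sum; apply: eq_bigr => i _; exact: rmod_linearZ.
Qed.

Definition rep_class (T : rmod H -> Prop) M :=
  is_rep c M /\ exists N, T N /\ exists r : realization N M, True.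

Definition module_class (T : rep K n -> Prop) N :=
  finitely_generated N /\ exists M, T M /\ exists r : realization N M, True.

Lemma tcl_rep_class (T : rmod H -> Prop) : torsion_class T -> tcl (rep_class T).
Proof.
case=> tf tz tq te; split=> [M []//|M rM M0|M M' f [rM [N [TN [r _]]]] rM' hf sf
  |L M P f g rM hf hg jf sg ex [rL [N1 [TN1 [r1 _]]]] [rP [N3 [TN3 [r3 _]]]]].
- split=> //; have [N [_ [r _]]] := tmod_realization rM.
  exists N; split; last by exists r.
  by apply: tz => x; apply: (real_eq (r := r)) => j; rewrite [LHS]M0 cm0.
- split=> //; have [N' [_ [r' _]]] := tmod_realization rM'.
  exists N'; split; last by exists r'.
  have [h hE] := linear_of_hom r r' hf.
  exact: tq (surjection_of_hsurj hE sf) TN.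
- split=> //; have [N2 [_ [r2 _]]] := tmod_realization rM.
  exists N2; split; last by exists r2.
  have [h hE] := linear_of_hom r1 r2 hf.
  have [k kE] := linear_of_hom r2 r3 hg.
  exact: te (injective_of_hinj hE jf) (surjection_of_hsurj kE sg)
    (exact_of_hexact hE kE ex) TN1 TN3.
Qed.

Lemma torsion_module_class (T : rep K n -> Prop) : tcl T -> torsion_class (module_class T).
Proof.
move=> tT; have [tr tz tq te] := tT.
split=> [N []//|N N0|N N' h sh [fN [M [TM [r _]]]]
  |N1 N2 N3 h k ih sk ex [f1 [M1 [TM1 [r1 _]]]] [f3 [M3 [TM3 [r3 _]]]]].
- have fN : finitely_generated N.
    by exists 0%N, (fun=> 0) => x; exists (fun=> 0); rewrite big_ord0.
  split=> //; have [M [rM [r _]]] := realization_ex fN.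
  exists M; split; last by exists r.
  by apply: tz => // j v; rewrite -[v](cm_th r) [th r j v]N0 cm0.
- have fN' := fg_quot sh fN; split=> //.
  have [M' [rM' [r' _]]] := realization_ex fN'.
  exists M'; split; last by exists r'.
  have [f [hf fE]] := hom_of_linear r r' h (tr _ TM) rM'.
  exact: tq TM rM' hf (hsurj_of_surjection (cm_hom fE) sh).
- have f2 := fg_ext sk ex f1 f3; split=> //.
  have [M2 [rM2 [r2 _]]] := realization_ex f2.
  exists M2; split; last by exists r2.
  have [f [hf fE]] := hom_of_linear r1 r2 h (tr _ TM1) rM2.
  have [g [hg gE]] := hom_of_linear r2 r3 k rM2 (tr _ TM3).
  exact: te rM2 hf hg (hinj_of_injective fE ih) (hsurj_of_surjection (cm_hom gE) sk)
    (hexact_of_exact (cm_hom fE) fE gE ex) TM1 TM3.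
Qed.

Lemma rep_module_class (T : rep K n -> Prop) M : tcl T ->
  rep_class (module_class T) M <-> T M.
Proof.
move=> tT; split=> [[rM [N [[fN [M' [TM' [r' _]]]] [r _]]]]|TM].
  have [f [hf fE]] := hom_of_linear r' r (idfun : {linear N -> N}) (tcl_rep tT TM') rM.
  apply: (tcl_quot tT) TM' rM hf (hsurj_of_surjection (cm_hom fE) _).
  by move=> y; exists y.
have rM := tcl_rep tT TM; split=> //.
have [N [fN [r _]]] := tmod_realization rM.
by exists N; split; [split=> //; exists M; split=> //; exists r|exists r].
Qed.

Lemma rep_class_le (T U : rmod H -> Prop) : torsion_class T -> torsion_class U ->
  (forall M, rep_class T M -> rep_class U M) -> forall N, T N -> U N.
Proof.
move=> tT tU TU N TN.
have [M [rM [r _]]] := realization_ex (torsion_fg tT TN).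
have [|_ [N' [UN' [r' _]]]] := TU M; first by split=> //; exists N; split=> //; exists r.
have [h sh] := realization_transport r' r.
exact: torsion_quot tU _ _ h sh UN'.
Qed.

End Realization.

(** The isomorphism sends [T] to the sortable element with inversion set N(T). It reflects the order
    by [class_le], and is injective by antisymmetry of inclusion. *)
Theorem corollary1p3 (R : realType) (V : vectType R) (n : nat)
    (Phi : root_system V n) (c : seq 'I_n) (d : 'I_n -> nat) (K : fieldType) :
  coxeter_word c -> symmetrizer Phi d ->
  order_isomorphic (@tors_le (gls_algebra Phi c d K)) (@cambrian_le R V n Phi c).
Proof.
move=> cox sym; set H := gls_algebra Phi c d K.
have uc : uniq c by rewrite (perm_uniq cox) enum_uniq.
have hw (T : tors H) : exists w : cambrian Phi c,
    forall a, has_module Phi d c (rep_class (sval T)) a <-> inversion Phi (sval w) a.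
  have [w cw wE] := class_csort sym uc (tcl_rep_class sym (svalP T)).
  have sw : sortable Phi c w by apply/sortableE.
  by exists (exist _ w sw).
pose f T := projT1 (cid (hw T)).
have fE T a : has_module Phi d c (rep_class (sval T)) a <-> inversion Phi (sval (f T)) a.
  by rewrite /f; case: cid.
have cinj (v w : cambrian Phi c) :
    (forall a, inversion Phi (sval v) a <-> inversion Phi (sval w) a) -> v = w.
  case: v w => [v sv] [w sw] /= E.
  have [u _ vu] := csort_word ((sortableE Phi v cox).1 sv).
  have [u' _ wu] := csort_word ((sortableE Phi w cox).1 sw).
  have vw : v = w by rewrite vu wu in E *; apply: inversion_inj.
  by move: sw E; rewrite -vw => sw _; congr exist; apply: Prop_irrelevance.
have le T U : tors_le T U <-> cambrian_le (f T) (f U).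
  split=> [TU a /fE h|h].
    apply/fE; apply: has_module_le h => M [rM [N [TN r]]].
    by split=> //; exists N; split=> //; apply: TU.
  apply: (rep_class_le cox sym (svalP T) (svalP U)) => M.
  apply: (class_le sym uc (tcl_rep_class sym (svalP T)) (tcl_rep_class sym (svalP U))) => a ha.
  by apply/fE; apply: h; apply/fE.
have surj w : exists T, f T = w.
  have [T tT TE] := csort_class K sym uc ((sortableE Phi (sval w) cox).1 (svalP w)).
  pose X : tors H := exist _ _ (torsion_module_class cox sym tT).
  exists X; apply: cinj => a.
  have XT M := rep_module_class cox sym M tT.
  rewrite -TE -fE; split; apply: has_module_le => M; first exact: (XT M).1.
  exact: (XT M).2.
pose g w := projT1 (cid (surj w)).
have fg w : f (g w) = w by rewrite /g; case: cid.
exists f; split=> //; exists g => // T.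
have E : f (g (f T)) = f T by [].
move: (g (f T)) E => S; case: S T => [X tX] [Y tY] E.
(* Equal images give inclusions both ways, so the two predicates on modules coincide. *)
have XY : X = Y.
  apply/funext => N; apply/propext; split.
    by apply: (proj2 (le (exist _ X tX) (exist _ Y tY))); rewrite E.
  by apply: (proj2 (le (exist _ Y tY) (exist _ X tX))); rewrite E.
by case: _ / XY tY E => tY _; congr exist; apply: Prop_irrelevance.
Qed.
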